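(* (Maximum principle) Let $1\le d\le 5$, $m>\frac d2+1$ an integer, $a>0$, and let $0<\rho_1\le\rho_2$ be constants. Let $\rho_0$ satisfy $\rho_0-1\in H^{m-1}(\mathbb{R}^d)$ and $\rho_1\le\rho_0(x)\le\rho_2$ for all $x\in\mathbb{R}^d$. Let $T>0$ and let $\rho$ be a classical solution on $[0,T]\times\mathbb{R}^d$, with $\rho-1\in C([0,T];H^{m-1}(\mathbb{R}^d))$ and $\rho$ away from zero, of $$\partial_t\rho-a^2\Delta\rho=\operatorname{div}(\rho\nabla\phi),\qquad \nabla\phi=\nabla(-\Delta)^{-1}(\rho-1),\qquad \rho(0,\cdot)=\rho_0 .$$ Then for all $(t,x)\in[0,T]\times\mathbb{R}^d$, $$\rho_1\le\rho(t,x)\le\rho_2 .$$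
   Context: $H^s(\mathbb{R}^d)$ are the $L^2$-based Sobolev spaces. $\nabla(-\Delta)^{-1}$ is the Fourier multiplier with symbol $i\xi/|\xi|^2$, so that $-\Delta\phi=\rho-1$. *)

(* Defs.v *)
From HB Require Import structures.
From mathcomp Require Import all_boot all_order all_algebra.
From mathcomp Require Import all_classical all_reals all_analysis.
From mathcomp Require Import complex.

Set Implicit Arguments.
Unset Strict Implicit.
Unset Printing Implicit Defensive.

Import Order.TTheory GRing.Theory Num.Theory.
Import numFieldNormedType.Exports.

Local Open Scope classical_set_scope.
Local Open Scope ring_scope.

(* The product (= Borel) sigma-algebra on R^n, generated by the coordinates. *)
Section rV_measurable.
Context {R : realType} (n : nat).

Let coors : 'I_n -> 'rV[R]_n -> measurableTypeR R := fun i x => x ord0 i.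

Let rV_set0 : g_sigma_preimage coors set0.
Proof. exact: sigma_algebra0. Qed.

Let rV_setC A : g_sigma_preimage coors A -> g_sigma_preimage coors (~` A).
Proof. exact: sigma_algebraC. Qed.

Let rV_bigcup (F : _^nat) : (forall i, g_sigma_preimage coors (F i)) ->
  g_sigma_preimage coors (\bigcup_i (F i)).
Proof. exact: sigma_algebra_bigcup. Qed.

HB.instance Definition _ := @isMeasurable.Build default_measure_display
  'rV[R]_n (g_sigma_preimage coors) rV_set0 rV_setC rV_bigcup.

End rV_measurable.

Section rV_measurable_fun.
Context {R : realType} {d} {T : measurableType d} (n : nat).

Lemma measurable_fun_rVP (f : T -> 'rV[R]_n) :
  measurable_fun [set: T] f <->
  forall i, measurable_fun [set: T] (fun x => f x ord0 i : measurableTypeR R).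
Proof.
apply: (@iff_trans _ (g_sigma_preimage
    (fun i x => f x ord0 i : measurableTypeR R) `<=` measurable)).
  rewrite (g_sigma_preimage_comp
    (fun i (x : 'rV[R]_n) => x ord0 i : measurableTypeR R)).
  split=> [mf A [/= C preC <-]|prefS]; first exact: mf.
  by move=> _ A mA; apply: prefS; exists A.
split=> [fS i _ A mA|mf].
  apply: fS; apply: sub_sigma_algebra; rewrite -bigcup_seq/=.
  by exists i; [rewrite /= mem_index_enum|exists A].
apply: smallest_sub; first exact: sigma_algebra_measurable.
by rewrite -bigcup_seq => A [i _ [B mB <-]]; exact: mf.
Qed.

End rV_measurable_fun.

Lemma measurable_rV_coord (R : realType) n (i : 'I_n) :
  measurable_fun [set: 'rV[R]_n] (fun x => x ord0 i : measurableTypeR R).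
Proof. exact: (measurable_fun_rVP (@id 'rV[R]_n)).1 (@measurable_id _ _ _) i. Qed.

Definition cons_rV {R : realType} {n} (p : measurableTypeR R * 'rV[R]_n) :
  'rV[R]_n.+1 :=
  \row_i (if unlift ord0 i is Some j then p.2 ord0 j else p.1).

Lemma measurable_cons_rV (R : realType) n :
  measurable_fun [set: measurableTypeR R * 'rV[R]_n] cons_rV.
Proof.
apply/measurable_fun_rVP => i; under eq_fun do rewrite mxE.
case: unliftP => [j _|_]; last exact: measurable_fst.
exact: (measurableT_comp (measurable_rV_coord j) measurable_snd).
Qed.

Section lebesgue_rV_step.
Context {R : realType} (n : nat).
Local Open Scope ereal_scope.
Variable mu : {sigma_finite_measure set 'rV[R]_n -> \bar R}.

Definition lebesgue_rV_step : set 'rV[R]_n.+1 -> \bar R :=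
  pushforward (@lebesgue_measure R \x mu) cons_rV.

Let step0 : lebesgue_rV_step set0 = 0.
Proof. by rewrite /lebesgue_rV_step /pushforward preimage_set0 measure0. Qed.

Let step_ge0 A : 0 <= lebesgue_rV_step A.
Proof. by apply: measure_ge0; exact: measurable_cons_rV. Qed.

Let step_sigma_additive : semi_sigma_additive lebesgue_rV_step.
Proof.
by apply: measure_semi_sigma_additive; exact: measurable_cons_rV.
Qed.

HB.instance Definition _ := isMeasure.Build _ _ _ lebesgue_rV_step
  step0 step_ge0 step_sigma_additive.

Let step_sigma_finite : sigma_finite setT lebesgue_rV_step.
Proof.
have /sigma_finiteP[F [TF ndF Foo]] := sigma_finiteT (@lebesgue_measure R).
have /sigma_finiteP[G [TG ndG Goo]] := sigma_finiteT mu.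
pose u (x : 'rV[R]_n.+1) : measurableTypeR R * 'rV[R]_n :=
  (x ord0 ord0, \row_i x ord0 (lift ord0 i)).
have uK p : u (cons_rV p) = p.
  case: p => a b; rewrite /u; congr pair; first by rewrite mxE unlift_none.
  by apply/rowP => i; rewrite !mxE liftK.
have mu_ : measurable_fun setT u.
  apply/measurable_fun_pairP; split; first exact: measurable_rV_coord.
  apply/measurable_fun_rVP => i /=; rewrite /comp /u /=.
  by under eq_fun do rewrite mxE; exact: measurable_rV_coord.
exists (fun k => u @^-1` (F k `*` G k)).
  rewrite -preimage_bigcup (_ : \bigcup_k _ = setT) ?preimage_setT//.
  apply/seteqP; split=> // -[x y] _.
  have [i _ Fix] : (\bigcup_k F k) x by rewrite -TF.
  have [j _ Gjy] : (\bigcup_k G k) y by rewrite -TG.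
  exists (maxn i j) => //; split.
    by move: x Fix; exact/subsetPset/ndF/leq_maxl.
  by move: y Gjy; exact/subsetPset/ndG/leq_maxr.
move=> k; have [mF Fkoo] := Foo k; have [mG Gkoo] := Goo k; split.
  by rewrite -[X in measurable X]setTI; apply: mu_ => //; exact: measurableX.
rewrite /lebesgue_rV_step /pushforward -comp_preimage.
rewrite (_ : u \o cons_rV = id); last by apply/funext => p; exact: uK.
by rewrite preimage_id product_measure1E// lte_mul_pinfty// ge0_fin_numE.
Qed.

HB.instance Definition _ := Measure_isSigmaFinite.Build _ _ _ lebesgue_rV_step
  step_sigma_finite.

End lebesgue_rV_step.

(* Lebesgue measure on R^n; [lebesgue_rV_box] below gives its value on
   measurable boxes, which characterizes it. *)
Fixpoint lebesgue_rV (R : realType) (n : nat) :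
    {sigma_finite_measure set 'rV[R]_n -> \bar R} :=
  match n with
  | 0 => @dirac _ 'rV[R]_0 0 R
  | n'.+1 => lebesgue_rV_step (lebesgue_rV R n')
  end.

Lemma lebesgue_rV_box (R : realType) n (A : 'I_n -> set (measurableTypeR R)) :
  (forall i, measurable (A i)) ->
  lebesgue_rV R n [set x | forall i, A i (x ord0 i)] =
  (\prod_i lebesgue_measure (A i))%E.
Proof.
elim: n A => [|n IHn] A mA /=.
  rewrite big_ord0 diracE (_ : 0 \in _) //.
  by apply/mem_set => -[].
rewrite big_ord_recl -IHn// /lebesgue_rV_step /pushforward.
rewrite (_ : _ @^-1` _ =
  A ord0 `*` [set x : 'rV[R]_n | forall i, A (lift ord0 i) (x ord0 i)]).
  rewrite product_measure1E//.
  rewrite (_ : [set x | _] = \big[setI/setT]_(i < n)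
    ((fun x : 'rV[R]_n => x ord0 i : measurableTypeR R) @^-1`
       A (lift ord0 i))).
    apply: bigsetI_measurable => i _; rewrite -[X in measurable X]setTI.
    exact: measurable_rV_coord.
  apply/seteqP; split=> x /=; rewrite -bigcap_seq => h i.
    by move=> _; exact: h.
  by apply: (h i); rewrite /= mem_index_enum.
apply/seteqP; split=> [[a x]/= h|[a x]/= [h0 h] i].
  by split=> [|i]; [have := h ord0|have := h (lift ord0 i)];
    rewrite mxE ?unlift_none ?liftK.
by rewrite mxE; case: unliftP => [j ->|->].
Qed.

Section fourier.
Context {R : realType} {d : nat}.
Local Notation vec := 'rV[R]_d.
Local Notation mu := (lebesgue_rV R d).
Implicit Types (f : vec -> R) (u g : vec -> R[i]).
Local Open Scope complex_scope.

Definition dot (x y : vec) : R := \sum_i x ord0 i * y ord0 i.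

Definition cis (t : R) : R[i] := cos t +i* sin t.

Definition cintegrable u : Prop :=
  mu.-integrable setT (fun x => (complex.Re (u x))%:E) /\
  mu.-integrable setT (fun x => (complex.Im (u x))%:E).

Definition cintegral u : R[i] :=
  (\int[mu]_x complex.Re (u x)) +i* (\int[mu]_x complex.Im (u x)).

(* The convention is \hat u(xi) = \int e^{- i x.xi} u(x) dx, so that
   differentiation in x_j becomes multiplication by i xi_j. *)
Definition fourier u (xi : vec) : R[i] :=
  cintegral (fun x => cis (- dot x xi) * u x).

Definition partial (i : 'I_d) f : vec -> R := 'D_(delta_mx ord0 i) f.

Definition partials (s : seq 'I_d) f : vec -> R := foldr partial f s.

(* Frechet differentiability of all the iterated partial derivatives makes them
   continuous, hence this is C^infinity. *)
Definition smooth f : Prop := forall s x, differentiable (partials s f) x.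

Definition real_schwartz f : Prop := smooth f /\
  forall (k : nat) s, exists C : R, forall x, `|x| ^+ k * `|partials s f x| <= C.

Definition schwartz u : Prop :=
  real_schwartz (fun x => complex.Re (u x)) /\
  real_schwartz (fun x => complex.Im (u x)).

(* Functions that act on Schwartz functions by integration. *)
Definition tempered u : Prop :=
  forall psi, schwartz psi -> cintegrable (fun x => u x * psi x).

(* [g] is the Fourier transform of [u] in the sense of tempered distributions:
   <\hat u, psi> = <u, \hat psi>. *)
Definition is_fourier u g : Prop := [/\ tempered u, tempered g &
  forall psi, schwartz psi ->
    cintegral (fun x => u x * fourier psi x) =
    cintegral (fun xi => g xi * psi xi)].

Definition is_fourier_multiplier (sigma : vec -> R[i]) u v : Prop :=
  exists2 g, is_fourier u g & is_fourier v (fun xi => sigma xi * g xi).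

(* The Bessel-potential norm || (1 + |xi|^2)^{s/2} \hat f ||_{L^2}, valued in
   [0, +oo]. The Fourier transform is unique almost everywhere, so the infimum
   is over a set with at most one element; it is +oo when \hat f is not a
   function. *)
Definition sobolev_norm (s : R) f : \bar R :=
  ereal_inf [set Lnorm mu 2%:E (fun xi =>
      ((1 + dot xi xi) `^ (s / 2) * Normc.normc (g xi))%:E)
    | g in is_fourier (fun x => (f x)%:C)].

Definition sobolev (s : R) : set (vec -> R) :=
  [set f | (sobolev_norm s f < +oo)%E].

(* [F] is the vector field \nabla (- \Delta)^{-1} f, with symbol
   i xi / |xi|^2 (whose value at the negligible point xi = 0 is 0 here). *)
Definition is_grad_inv_neg_laplacian f (F : vec -> vec) : Prop :=
  forall j : 'I_d, is_fourier_multiplier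
    (fun xi => (0 +i* (xi ord0 j / dot xi xi)))
    (fun x => (f x)%:C) (fun x => (F x ord0 j)%:C).

Definition laplacian f (x : vec) : R := \sum_i partial i (partial i f) x.

Definition divergence (F : vec -> vec) (x : vec) : R :=
  \sum_i partial i (fun y => F y ord0 i) x.

Definition continuous_sobolev (s T : R) (u : R -> vec -> R) : Prop :=
  (forall t, 0 <= t <= T -> sobolev s (u t)) /\
  (forall t, 0 <= t <= T ->
    sobolev_norm s (fun x => u t' x - u t x)
      @[t' --> within `[0, T] (nbhs t)] --> 0%E).

(* The equation and the C^{1,2} regularity are only required for 0 < t < T,
   together with continuity on [0, T] x R^d: data in H^{m-1} need not be C^2. *)
Definition classical_regularity (T : R) (rho : R -> vec -> R) : Prop :=
  let I := `]0, T[ `*` [set: vec] in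
  [/\ {within `[0, T] `*` [set: vec], continuous (fun z => rho z.1 z.2)},
      forall t x, 0 < t < T ->
        [/\ derivable (rho ^~ x) t 1,
            forall i, derivable (rho t) x (delta_mx ord0 i) &
            forall i j,
              derivable (partial i (rho t)) x (delta_mx ord0 j)],
      {within I, continuous (fun z => derive1 (rho ^~ z.2) z.1)},
      forall i, {within I, continuous (fun z => partial i (rho z.1) z.2)} &
      forall i j, {within I,
        continuous (fun z => partial j (partial i (rho z.1)) z.2)}].

Definition C1_field (F : vec -> vec) : Prop := forall i j : 'I_d,
  (forall x, derivable (fun y => F y ord0 i) x (delta_mx ord0 j)) /\
  continuous (partial j (fun y => F y ord0 i)).

(* [gradphi t] is the field \nabla \phi at time t; only this field, not a
   potential \phi, is determined by the multiplier. *)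
Record classical_solution (a T : R) (rho0 : vec -> R) (rho : R -> vec -> R)
    (gradphi : R -> vec -> vec) : Prop := {
  solution_regular : classical_regularity T rho ;
  solution_C1_gradphi : forall t, 0 < t < T -> C1_field (gradphi t) ;
  solution_eq : forall t x, 0 < t < T ->
    derive1 (rho ^~ x) t - a ^+ 2 * laplacian (rho t) x =
    divergence (fun y => rho t y *: gradphi t y) x ;
  solution_gradphi : forall t, 0 <= t <= T ->
    is_grad_inv_neg_laplacian (fun x => rho t x - 1) (gradphi t) ;
  solution_init : forall x, rho 0 x = rho0 x
}.

End fourier.

(* Main.v *)
Require Import Defs.
From mathcomp Require Import all_boot all_order all_algebra.
From mathcomp Require Import all_classical all_reals all_analysis.
From mathcomp Require Import measurable_realfun complex ring lra.
Import Order.TTheory GRing.Theory Num.Theory.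
Import numFieldNormedType.Exports.
Local Open Scope classical_set_scope.
Local Open Scope ring_scope.
Set Implicit Arguments.
Unset Strict Implicit.
Unset Printing Implicit Defensive.

(** Put [u = rho - 1].  The gradient field satisfies [div gradphi = - u], so at
    a point where the spatial gradient of [rho] vanishes the equation reads
    [d_t rho - a^2 Laplacian rho = - rho u].
    Let [sigma] be [1] or [-1], let [M >= 0] bound [sigma u] at time [0], and
    suppose that [sigma u] exceeds [M] somewhere.  At a point where [sigma u]
    is maximal over the whole of space and all times up to some [t], the
    spatial gradient vanishes, the Laplacian of [sigma u] is nonpositive and
    its time derivative, taken from the left, is nonnegative, whereas
    [- rho sigma u] is negative because [rho > 0]: a contradiction
    ([max_principle]).  The two bounds are the cases
    [sigma = 1, M = rho2 - 1] and [sigma = -1, M = 1 - rho1].  It remains to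
    find a point of maximum, to see that both [M] are nonnegative, and to prove
    the identity for the divergence.

    Decay.  The function [u(t, x)] tends to [0] as [|x|] tends to infinity,
    uniformly in [t] ([uniform_vanishing]); this confines the maximum
    to a compact set, and at time [0] it forces [rho1 <= 1 <= rho2].  As [m - 1 > d / 2], the
    Sobolev norm controls the integral of the Fourier transform
    ([sobolev_norm_lt]), hence the sup norm ([sobolev_sup]); it also makes
    each slice square integrable and uniformly continuous, and such a function
    vanishes at infinity ([fourier_vanishing]).  Uniformity in [t] follows from
    continuity in the Sobolev norm and compactness of [[0, T]].

    Fourier analysis.  Fourier transforms are only known by duality with
    Schwartz functions, and Gaussian packets, modulated and translated
    Gaussians whose transforms are explicit ([fourier_packet]), are enough
    test functions: letting them concentrate yields the inversion formula
    ([fourier_inversion]), and integrating them against the transform itself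
    yields a Parseval inequality ([parseval_gauss]).

    Divergence.  The Sobolev norm provides one integrable transform [g] of [u],
    while each component [gradphi_j] comes with its own transform [g_j] of [u],
    known to agree with [g] only when integrated against Schwartz functions,
    and its symbol [xi_j / |xi|^2] is singular at the origin.  Increments of
    [gradphi_j] along the [j]-th axis bring in a factor that vanishes with
    [xi_j] and compensates the singularity; a differentiation in the width of
    the Gaussian removes the denominator ([Rint_grad_symbol_eq0]), so [g_j] may
    be replaced by [g] ([gradient_increment]).  Differentiating under the
    integral and summing [xi_j * xi_j / |xi|^2] to [1] gives the identity
    ([divergence_grad_inv_neg_laplacian]). *)

(** * Real and complex integrals on R^n *)

Notation L1 mu h := (mu.-integrable setT (EFin \o h)).

Section real_integrals.
Context {dT} {T : measurableType dT} {R : realType}.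
Variable mu : {measure set T -> \bar R}.
Implicit Types f g h k : T -> R.

Lemma L1_measurable f : L1 mu f -> measurable_fun setT f.
Proof. by move=> /measurable_int /measurable_EFinP. Qed.

Lemma L1_le f k : measurable_fun setT f -> L1 mu k ->
  (forall x, `|f x| <= k x) -> L1 mu f.
Proof.
move=> mf ik fk; apply: le_integrable ik => //; first exact/measurable_EFinP.
by move=> x _ /=; rewrite lee_fin (le_trans (fk x))// ler_norm.
Qed.

Lemma eq_L1 f g : f =1 g -> L1 mu f -> L1 mu g.
Proof. by move=> /funext ->. Qed.

Lemma eq_Rint f g : f =1 g -> \int[mu]_x f x = \int[mu]_x g x.
Proof. by move=> /funext ->. Qed.

Lemma L1D f g : L1 mu f -> L1 mu g -> L1 mu (fun x => f x + g x).
Proof. by move=> f1 g1; exact: (@integrableD _ _ _ mu _ _ (EFin \o f) (EFin \o g)). Qed.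

Lemma L1B f g : L1 mu f -> L1 mu g -> L1 mu (fun x => f x - g x).
Proof. by move=> f1 g1; exact: (@integrableB _ _ _ mu _ _ (EFin \o f) (EFin \o g)). Qed.

Lemma L1Z r f : L1 mu f -> L1 mu (fun x => r * f x).
Proof. by move=> f1; exact: (@integrableZl _ _ _ mu _ _ r (EFin \o f)). Qed.

Lemma L1_norm f : L1 mu f -> L1 mu (fun x => `|f x|).
Proof. by move=> f1; exact: (@integrable_norm _ _ _ mu). Qed.

Lemma EFin_Rint f : L1 mu f -> (\int[mu]_x f x)%:E = (\int[mu]_x (f x)%:E)%E.
Proof. by move=> f1; rewrite /Rintegral fineK//; exact: integrable_fin_num f1. Qed.

Lemma ge0_L1P f : measurable_fun setT f -> (forall x, 0 <= f x) ->
  L1 mu f <-> (\int[mu]_x (f x)%:E < +oo)%E.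
Proof.
move=> mf f0; split=> [/integrableP[_]|h].
  by under eq_integral do rewrite /= ger0_norm//.
apply/integrableP; split; first exact/measurable_EFinP.
by under eq_integral do rewrite /= ger0_norm//.
Qed.

Lemma Rint_cvg_dominated (f_ : nat -> T -> R) f k :
  (forall n, measurable_fun setT (f_ n)) -> 
  (forall x, f_ ^~ x @ \oo --> f x) -> L1 mu k ->
  (forall n x, `|f_ n x| <= k x) ->
  (\int[mu]_x f_ n x) @[n --> \oo] --> \int[mu]_x f x.
Proof.
move=> mf_ cf ik fk.
have mf : measurable_fun setT f by exact: measurable_fun_cvg mf_ (fun x _ => cf x).
have cfE x : setT x -> (EFin \o f_ ^~ x) @ \oo --> (f x)%:E.
  by move=> _; apply: cvg_EFin; [exact: nearW|exact: cf].
have [i_f _ ] := @dominated_convergence _ T R mu setT measurableT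
  (fun n => EFin \o f_ n) (EFin \o f) (EFin \o k)
  (fun n => (measurable_EFinP _ _).2 (mf_ n)) ((measurable_EFinP _ _).2 mf)
  (aeW _ cfE) ik
  (aeW _ (fun x n _ => fk n x)).
rewrite -(EFin_Rint i_f) => /fine_cvgP[_]; apply: cvg_trans.
by apply: near_eq_cvg; apply: nearW.
Qed.

End real_integrals.

Section complex_integrals.
Context {dT} {T : measurableType dT} {R : realType}.
Variable mu : {measure set T -> \bar R}.
Local Open Scope complex_scope.
Implicit Types u v : T -> R[i].

Definition cL1 u : Prop :=
  L1 mu (fun x => complex.Re (u x)) /\ L1 mu (fun x => complex.Im (u x)).

Definition cint u : R[i] :=
  (\int[mu]_x complex.Re (u x)) +i* (\int[mu]_x complex.Im (u x)).

End complex_integrals.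

Lemma ReM (R : realType) (z w : R[i]) :
  complex.Re (z * w) = complex.Re z * complex.Re w - complex.Im z * complex.Im w.
Proof. by case: z w => [? ?] [? ?]. Qed.

Lemma ImM (R : realType) (z w : R[i]) :
  complex.Im (z * w) = complex.Re z * complex.Im w + complex.Im z * complex.Re w.
Proof. by case: z w => [? ?] [? ?]. Qed.

Section tensor.
Context {d1 d2} {X : measurableType d1} {Y : measurableType d2} {R : realType}.
Variables (m1 : {sigma_finite_measure set X -> \bar R}).
Variables (m2 : {sigma_finite_measure set Y -> \bar R}).
Local Notation m12 := (m1 \x m2)%E.

Lemma L1_tensor (f : X -> R) (g : Y -> R) : L1 m1 f -> L1 m2 g ->
  L1 m12 (fun z => f z.1 * g z.2).
Proof.
move=> f1 g1; have mf := L1_measurable f1; have mg := L1_measurable g1.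
have mfg : measurable_fun setT (fun z : X * Y => f z.1 * g z.2).
  by apply: measurable_funM; exact: measurableT_comp.
apply/integrable12ltyP; first exact/measurable_EFinP.
rewrite /=; have -> : (fun x => (\int[m2]_y `|((f x)%R * g y)%R%:E|)%E)
    = EFin \o (fun x => (\int[m2]_y `|g y|) * `|f x|).
  apply/funext => x /=; rewrite EFinM EFin_Rint; last exact: L1_norm.
  rewrite muleC -integralZl//; last exact: L1_norm.
  by apply: eq_integral => y _; rewrite normrM EFinM.
apply: integrable_lty => //; apply: L1Z; exact: L1_norm.
Qed.

Lemma Rint_tensor (f : X -> R) (g : Y -> R) : L1 m1 f -> L1 m2 g ->
  \int[m12]_z (f z.1 * g z.2) = (\int[m1]_x f x) * \int[m2]_y g y.
Proof.
move=> f1 g1; rewrite /Rintegral.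
rewrite -(integral12_prod_meas1 (L1_tensor f1 g1)) /fubini_F /=.
rewrite (eq_integral (fun x => ((\int[m2]_y g y) * f x)%:E)); last first.
  move=> x _; rewrite EFinM EFin_Rint// muleC -integralZl//.
by rewrite -[LHS]/(Rintegral _ _ _) RintegralZl// mulrC.
Qed.

Local Open Scope complex_scope.
Lemma cL1_tensor (u : X -> R[i]) (v : Y -> R[i]) : cL1 m1 u -> cL1 m2 v ->
  cL1 m12 (fun z => u z.1 * v z.2).
Proof.
move=> [u1 u2] [v1 v2]; split.
  by apply: eq_L1 (L1B (L1_tensor u1 v1) (L1_tensor u2 v2)) => z; rewrite ReM.
by apply: eq_L1 (L1D (L1_tensor u1 v2) (L1_tensor u2 v1)) => z; rewrite ImM.
Qed.

Lemma cint_tensor (u : X -> R[i]) (v : Y -> R[i]) : cL1 m1 u -> cL1 m2 v ->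
  cint m12 (fun z => u z.1 * v z.2) = cint m1 u * cint m2 v.
Proof.
move=> [u1 u2] [v1 v2]; apply/eqP; rewrite eq_complex ReM ImM /=; apply/andP; split; apply/eqP.
  rewrite -(Rint_tensor u1 v1) -(Rint_tensor u2 v2) -RintegralB//.
  - by apply: eq_Rint => z; rewrite ReM.
  - exact: L1_tensor u1 v1.
  - exact: L1_tensor u2 v2.
rewrite -(Rint_tensor u1 v2) -(Rint_tensor u2 v1) -RintegralD//.
- by apply: eq_Rint => z; rewrite ImM.
- exact: L1_tensor u1 v2.
- exact: L1_tensor u2 v1.
Qed.

End tensor.

Section products.
Context {R : realType}.
Local Open Scope complex_scope.
Local Notation leb := (@lebesgue_measure R).

Lemma measurable_complex_prod {d} {T : measurableType d} n (u : 'I_n -> T -> R[i]) :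
  (forall i, measurable_fun setT (fun x => complex.Re (u i x)) /\
             measurable_fun setT (fun x => complex.Im (u i x))) ->
  measurable_fun setT (fun x => complex.Re (\prod_i u i x)) /\
  measurable_fun setT (fun x => complex.Im (\prod_i u i x)).
Proof.
elim: n u => [|n IH] u mu; first by split; under eq_fun do rewrite big_ord0; exact: measurable_cst.
have [h1 h2] := mu ord0; have [h3 h4] := IH (fun i => u (lift ord0 i)) (fun i => mu _).
split; under eq_fun do rewrite big_ord_recl ?ReM ?ImM.
  by apply: measurable_funB; exact: measurable_funM.
by apply: measurable_funD; exact: measurable_funM.
Qed.

(** On [R^n] the Lebesgue measure is built one coordinate at a time, so a
    product of functions of single coordinates is integrated by induction on
    [n], one tensor product at each step.  The complex form is the one needed
    for plane waves, whose real part is not such a product. *)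
Lemma cint_prod n (u : 'I_n -> measurableTypeR R -> R[i]) :
  (forall i, cL1 leb (u i)) ->
  cL1 (lebesgue_rV R n) (fun x => \prod_i u i (x ord0 i)) /\
  cint (lebesgue_rV R n) (fun x => \prod_i u i (x ord0 i)) = \prod_i cint leb (u i).
Proof.
elim: n u => [|n IH] u u1.
  rewrite big_ord0; split; first split.
  - apply: (@eq_L1 _ _ _ _ (cst 1)) => [x|]; first by rewrite big_ord0.
    exact: finite_measure_integrable_cst.
  - apply: (@eq_L1 _ _ _ _ (cst 0)) => [x|]; first by rewrite big_ord0.
    exact: integrable0.
  - rewrite /cint (@eq_Rint _ _ _ _ _ (cst 1)); last by move=> x; rewrite big_ord0.
    rewrite (@eq_Rint _ _ _ _ (fun x => complex.Im _) (cst 0)); last first.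
      by move=> x; rewrite big_ord0.
    rewrite !Rintegral_cst//.
    set e := (X in fine X); have -> : e = 1%E by exact: diracT.
    by rewrite /= mul1r mul0r.
have [v1 v2] := IH (fun i => u (lift ord0 i)) (fun i => u1 _).
pose F (x : 'rV[R]_n.+1) := \prod_i u i (x ord0 i).
have FE : F \o cons_rV = fun z => u ord0 z.1 * \prod_i u (lift ord0 i) (z.2 ord0 i).
  apply/funext => -[a x]; rewrite /F /= big_ord_recl mxE unlift_none; congr (_ * _).
  by apply: eq_bigr => i _; rewrite mxE liftK.
have [mR mI] : measurable_fun setT (fun x => complex.Re (F x)) /\
             measurable_fun setT (fun x => complex.Im (F x)).
  apply: measurable_complex_prod => i; have [/L1_measurable h1 /L1_measurable h2] := u1 i.
  split.
    exact: (measurableT_comp h1 (measurable_rV_coord i)).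
  exact: (measurableT_comp h2 (measurable_rV_coord i)).
have [i1 i2] := cL1_tensor (u1 ord0) v1.
have j1 : L1 (leb \x lebesgue_rV R n)%E ((fun x => complex.Re (F x)) \o cons_rV).
  by rewrite (_ : _ \o _ = fun z => complex.Re ((F \o cons_rV) z))// FE.
have j2 : L1 (leb \x lebesgue_rV R n)%E ((fun x => complex.Im (F x)) \o cons_rV).
  by rewrite (_ : _ \o _ = fun z => complex.Im ((F \o cons_rV) z))// FE.
split; first split.
- by apply: integrable_pushforward => //; [exact: measurable_cons_rV|exact/measurable_EFinP].
- by apply: integrable_pushforward => //; [exact: measurable_cons_rV|exact/measurable_EFinP].
rewrite big_ord_recl -v2 -(cint_tensor (u1 ord0) v1) /cint /Rintegral /=; congr (fine _ +i* fine _).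
  rewrite [LHS](@integral_pushforward _ _ _ _ _ cons_rV (@measurable_cons_rV R n)
    (leb \x lebesgue_rV R n)%E setT (fun x => (complex.Re (F x))%:E))//.
  - by apply: eq_integral => z _; rewrite -[RHS](f_equal (fun h => (complex.Re (h z))%:E) FE).
  - exact/measurable_EFinP.
rewrite [LHS](@integral_pushforward _ _ _ _ _ cons_rV (@measurable_cons_rV R n)
    (leb \x lebesgue_rV R n)%E setT (fun x => (complex.Im (F x))%:E))//.
- by apply: eq_integral => z _; rewrite -[RHS](f_equal (fun h => (complex.Im (h z))%:E) FE).
- exact/measurable_EFinP.
Qed.

Lemma Rint_prod n (u : 'I_n -> measurableTypeR R -> R) :
  (forall i, L1 leb (u i)) ->
  L1 (lebesgue_rV R n) (fun x => \prod_i u i (x ord0 i)) /\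
  \int[lebesgue_rV R n]_x (\prod_i u i (x ord0 i)) = \prod_i \int[leb]_x u i x.
Proof.
move=> u1; have [|[v1 _] v2] := @cint_prod n (fun i x => (u i x)%:C).
  by move=> i; split; [exact: u1|exact: integrable0].
have E x : \prod_i (u i (x ord0 i))%:C = (\prod_i u i (x ord0 i))%:C.
  by rewrite rmorph_prod.
have E2 : \prod_i cint leb (fun x => (u i x)%:C) = (\prod_i \int[leb]_x u i x)%:C.
  rewrite rmorph_prod; apply: eq_bigr => i _; rewrite /cint /=.
  by rewrite Rintegral_cst//= mul0r.
split; first by apply: eq_L1 v1 => x; rewrite E.
by move: v2; rewrite E2 /cint => -[<- _]; apply: eq_Rintegral => x _; rewrite E.
Qed.

End products.

(** * Integration by parts against the normal density *)

(** The domination is only asked for near the point, in the form in which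
    derivatives of Gaussians in their parameter satisfy it. *)
Lemma is_derive_Rint {dT} {T : measurableType dT} {R : realType}
    (mu : {measure set T -> \bar R}) (f df : R -> T -> R) (G : T -> R) (a u v : R) :
  u < a < v ->
  (forall x, u < x < v -> L1 mu (f x)) ->
  (forall (x : R) y, u < x < v -> is_derive x 1 (f ^~ y) (df x y)) ->
  L1 mu G -> (forall x y, u < x < v -> `|df x y| <= G y) ->
  is_derive a 1 (fun x => \int[mu]_y f x y) (\int[mu]_y df a y).
Proof.
move=> uav fi fd Gi dfG.
have Ia : `]u, v[%classic a by rewrite /= in_itv.
have E x y : u < x < v -> partial1of2 f x y = df x y.
  by move=> /fd h; rewrite partial1of2E; exact: derive_val.
have G0 y : 0 <= G y by rewrite (le_trans _ (dfG a y uav)).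
have h1 x : `]u, v[%classic x -> L1 mu (f x) by rewrite /= in_itv /=; exact: fi.
have h2 x y : `]u, v[%classic x -> setT y -> derivable (f ^~ y) x 1.
  by rewrite /= in_itv /= => xuv _; case: (fd x y xuv).
have h3 x y : `]u, v[%classic x -> setT y -> `|partial1of2 f x y| <= G y.
  by rewrite /= in_itv /= => xuv _; rewrite E//; exact: dfG.
split; first exact: (@derivable_under_integral _ _ _ mu f setT measurableT a u v Ia h1 h2 G).
rewrite -derive1E.
rewrite (@differentiation_under_integral _ _ _ mu f setT measurableT a u v Ia h1 h2 G)//.
by apply: eq_Rint => y; exact: E.
Qed.

Section line.
Context {R : realType}.
Local Notation leb := (@lebesgue_measure R).

(** The fundamental theorem of calculus on growing segments; decay of the
    primitive is needed along one sequence on each side only. *)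
Lemma Rint_derive_eq0 (u u' : R -> R) (c : R) :
  (forall x : R, is_derive x 1 u (u' x)) -> continuous u' -> L1 leb u' ->
  u (c + n.+1%:R) @[n --> \oo] --> 0 -> u (c - n.+1%:R) @[n --> \oo] --> 0 ->
  \int[leb]_x u' x = 0.
Proof.
move=> ud cu' iu' up um.
pose I n : set R := `[c - n.+1%:R, c + n.+1%:R]%classic.
have cu : continuous u.
  by move=> x; apply: differentiable_continuous; apply/derivable1_diffP; case: (ud x).
have h1 : (\int[leb]_x (u' \_ (I n)) x) @[n --> \oo] --> \int[leb]_x u' x.
  apply: (@Rint_cvg_dominated _ _ _ leb _ _ (fun x => `|u' x|)).
  - move=> n; apply/measurable_restrict => //=; first exact: measurable_itv.
    by apply: measurable_funTS; exact: continuous_measurable_fun.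
  - move=> x; apply: cvg_near_cst; near=> n; rewrite /patch ifT// inE /I /= in_itv /=.
    suff : `|x - c| <= n.+1%:R by rewrite ler_norml => /andP[? ?]; apply/andP; split; lra.
    rewrite (le_trans _ (_ : n%:R <= _)) ?ler_nat//; near: n; exact: nbhs_infty_ger.
  - exact: L1_norm.
  - move=> n x; rewrite /patch; case: ifPn => // _; by rewrite normr0.
have h2 : (\int[leb]_x (u' \_ (I n)) x) @[n --> \oo] --> (0 - 0 : R).
  apply: cvg_trans; last exact: cvgB up um.
  apply: near_eq_cvg; apply: nearW => n; rewrite -Rintegral_mkcond /Rintegral.
  rewrite (@continuous_FTC2 _ u' u)//.
  - have := @ltr0Sn R n; lra.
  - exact: continuous_subspaceT.
  - split; first by move=> x _; case: (ud x).
      by apply: cvg_at_right_filter; exact: cu.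
    by apply: cvg_at_left_filter; exact: cu.
  - by move=> x _; rewrite derive1E; exact: derive_val.
by rewrite -(subr0 0); exact: cvg_unique h1 h2.
Unshelve. all: by end_near. Qed.

Section normal.
Variables (c s : R) (s0 : 0 < s).
Let p := normal_pdf c s.

Lemma normal_pdf_exp x :
  normal_pdf c s x = normal_peak s * expR (- (x - c) ^+ 2 / (s ^+ 2 *+ 2)).
Proof. by rewrite normal_pdfE// gt_eqF. Qed.

Lemma is_derive_normal_pdf (x : R) : is_derive x 1 p (- ((x - c) / s ^+ 2) * p x).
Proof.
rewrite (_ : p = fun x => normal_peak s * expR (- (x - c) ^+ 2 / (s ^+ 2 *+ 2))); last first.
  by apply/funext => y; exact: normal_pdf_exp.
have h : is_derive x 1 (fun x : R => - (x - c) ^+ 2 / (s ^+ 2 *+ 2)) (- ((x - c) / s ^+ 2)).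
  apply: is_derive_eq; rewrite /GRing.scale /=.
  have : s != 0 by rewrite gt_eqF.
  by move=> ?; field.
have h2 := @is_derive1_comp _ expR _ x _ _ (is_derive_expR _) h.
apply: is_derive_eq; rewrite /GRing.scale /=; ring.
Qed.

Lemma continuous_npdf : continuous p.
Proof. by apply: continuous_normal_pdf; rewrite gt_eqF. Qed.

Lemma le_abs_expR_sqr (y : R) : `|y| <= s * expR (y ^+ 2 / (s ^+ 2 *+ 2)).
Proof.
apply: (@le_trans _ _ (s * (1 + y ^+ 2 / (s ^+ 2 *+ 2)))); last first.
  by rewrite ler_pM2l// expR_ge1Dx.
have -> : s * (1 + y ^+ 2 / (s ^+ 2 *+ 2)) = (s ^+ 2 *+ 2 + `|y| ^+ 2) / (s *+ 2).
  by rewrite real_normK ?num_real//; field; rewrite gt_eqF.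
rewrite ler_pdivlMr ?mulrn_wgt0//; move: `|y| => z.
rewrite -subr_ge0 (_ : _ - _ = (z - s) ^+ 2 + s ^+ 2); last by ring.
by rewrite addr_ge0// sqr_ge0.
Qed.

(** A decay of order [1] is all that integration by parts needs to discard
    the boundary terms. *)
Lemma normal_pdf_decay (x : R) : x != c -> `|p x| <= normal_peak s * s / `|x - c|.
Proof.
move=> xc; rewrite ger0_norm ?normal_pdf_ge0// /p normal_pdf_exp -mulrA.
rewrite ler_wpM2l// ?normal_peak_ge0// ler_pdivlMr ?normr_gt0 ?subr_eq0//.
rewrite mulNr expRN mulrC ler_pdivrMr ?expR_gt0//; exact: le_abs_expR_sqr.
Qed.

(** Doubling the standard deviation absorbs a linear factor, so that the
    first moment is integrable because every normal density is. *)
Lemma normal_pdf_mul_le (x : R) : `|(x - c) * normal_pdf c s x| <=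
  normal_peak s * (s *+ 2) / normal_peak (s *+ 2) * normal_pdf c (s *+ 2) x.
Proof.
have s20 : 0 < s *+ 2 by rewrite mulrn_wgt0.
rewrite normrM [`|normal_pdf _ _ _|]ger0_norm ?normal_pdf_ge0//.
rewrite normal_pdf_exp normal_pdfE ?gt_eqF//.
rewrite mulrA divfK ?gt_eqF ?normal_peak_gt0 ?gt_eqF//.
rewrite mulrCA -mulrA ler_pM2l ?normal_peak_gt0 ?gt_eqF//.
set y := x - c; rewrite /normal_fun -/y.
have -> : - y ^+ 2 / (s ^+ 2 *+ 2) = - y ^+ 2 / ((s *+ 2) ^+ 2 *+ 2) +
   - (3 / 4 * (y ^+ 2 / (s ^+ 2 *+ 2))).
  by field; rewrite gt_eqF.
rewrite expRD mulrCA [leRHS]mulrC ler_pM2l ?expR_gt0// expRN ler_pdivrMr ?expR_gt0//.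
apply: (@le_trans _ _ (s *+ 2 * (1 + 3 / 4 * (y ^+ 2 / (s ^+ 2 *+ 2))))); last first.
  by rewrite ler_pM2l// expR_ge1Dx.
have -> : s *+ 2 * (1 + 3 / 4 * (y ^+ 2 / (s ^+ 2 *+ 2))) =
   (8 * s ^+ 2 + 3 * `|y| ^+ 2) / (4 * s).
  by rewrite real_normK ?num_real//; field; rewrite gt_eqF.
rewrite ler_pdivlMr ?mulr_gt0//; move: `|y| => z.
rewrite -subr_ge0 (_ : _ - _ = 2 * (z - s) ^+ 2 + z ^+ 2 + 6 * s ^+ 2); last by ring.
have := sqr_ge0 (z - s); have := sqr_ge0 z; have := sqr_ge0 s; lra.
Qed.

Lemma L1_pdf : L1 leb p. Proof. exact: integrable_normal_pdf. Qed.

Lemma L1_xpdf : L1 leb (fun x => x * p x).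
Proof.
have i1 : L1 leb (fun x => (x - c) * p x).
  apply: (@L1_le _ _ _ leb _ (fun x => normal_peak s * (s *+ 2) / normal_peak (s *+ 2) *
     normal_pdf c (s *+ 2) x)).
  - apply: measurable_funM; last exact: measurable_normal_pdf.
    by apply: measurable_funB.
  - by apply: L1Z; exact: integrable_normal_pdf.
  - exact: normal_pdf_mul_le.
by apply: eq_L1 (L1D i1 (L1Z c L1_pdf)) => x; ring.
Qed.

Lemma L1_bounded_mul (b h : R -> R) : continuous b -> (forall x, `|b x| <= 1) ->
  L1 leb h -> L1 leb (fun x => b x * h x).
Proof.
move=> cb b1 hi; apply: (@L1_le _ _ _ leb _ (fun x => `|h x|)).
- by apply: measurable_funM; [exact: continuous_measurable_fun|exact: L1_measurable hi].
- exact: L1_norm.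
- by move=> x; rewrite normrM ler_piMl.
Qed.

(** As [p' = - (x - c) / s^2 * p], integration by parts turns a derivative
    falling on [b] into the first moment of [b p]. *)
Lemma Rint_ibp_pdf (b b' : R -> R) (K : R) : (forall x : R, is_derive x 1 b (b' x)) ->
  continuous b' -> (forall x, `|b x| <= 1) -> (forall x, `|b' x| <= K) ->
  \int[leb]_x (b' x * p x) =
  (\int[leb]_x (b x * (x * p x)) - c * \int[leb]_x (b x * p x)) / s ^+ 2.
Proof.
move=> bd cb' b1 b'K.
have cb : continuous b.
  by move=> x; apply: differentiable_continuous; apply/derivable1_diffP; case: (bd x).
have i0 : L1 leb (fun x => b x * p x) by apply: L1_bounded_mul => //; exact: L1_pdf.
have i1 : L1 leb (fun x => b x * (x * p x)) by apply: L1_bounded_mul => //; exact: L1_xpdf.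
have i2 : L1 leb (fun x => b' x * p x).
  apply: (@L1_le _ _ _ leb _ (fun x => K * p x)).
  - by apply: measurable_funM; [exact: continuous_measurable_fun|exact: measurable_normal_pdf].
  - by apply: L1Z; exact: L1_pdf.
  - move=> x; rewrite normrM [`|p x|]ger0_norm ?normal_pdf_ge0//.
    by rewrite ler_wpM2r// normal_pdf_ge0.
(* The boundary terms at [c + (n + 1)] and [c - (n + 1)]. *)
have u0 (e : nat -> R) : (forall n, `|e n| = n.+1%:R) -> b (c + e n) * p (c + e n) @[n --> \oo] --> 0.
  move=> eE; apply: norm_cvg0.
  apply: (@squeeze_cvgr _ _ _ _ (cst 0) (fun n => normal_peak s * s * n.+1%:R^-1)).
  - apply: nearW => n; rewrite normr_ge0 /=.
    rewrite normrM (le_trans (ler_piMl _ (b1 _)))//.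
    have := @normal_pdf_decay (c + e n); rewrite addrAC subrr add0r eE; apply.
    by rewrite -subr_eq0 addrAC subrr add0r -normr_gt0 eE.
  - exact: cvg_cst.
  - rewrite -(mulr0 (normal_peak s * s)); apply: cvgMr; exact: cvg_harmonic.
have E x : b' x * p x + b x * (- ((x - c) / s ^+ 2) * p x) =
   b' x * p x - ((s ^+ 2)^-1 * (b x * (x * p x)) - c / s ^+ 2 * (b x * p x)).
  by ring.
have := @Rint_derive_eq0 (fun x => b x * p x)
   (fun x => b' x * p x + b x * (- ((x - c) / s ^+ 2) * p x)) c.
rewrite (eq_Rint leb E) RintegralB//; last first.
  by apply: L1B; exact: L1Z.
rewrite RintegralB//; [|exact: L1Z|exact: L1Z].
rewrite !RintegralZl// => H; apply/eqP; rewrite -subr_eq0; apply/eqP.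
rewrite -[RHS]H.
- by ring.
- move=> x; have := is_derive_normal_pdf x; have := bd x => h1 h2.
  by apply: is_derive_eq; rewrite /GRing.scale /=; ring.
- move=> x; apply: cvgD; first by apply: cvgM; [exact: cb'|exact: continuous_npdf].
  apply: cvgM; first exact: cb.
  apply: cvgM; last exact: continuous_npdf.
  by apply: cvgN; apply: cvgMl; apply: cvgB; [exact: cvg_id|exact: cvg_cst].
- apply: eq_L1 (L1B i2 (L1B (L1Z (s ^+ 2)^-1 i1) (L1Z (c / s ^+ 2) i0))) => x.
  by rewrite E.
- by apply: u0 => n; rewrite ger0_norm.
- by apply: (u0 (fun n => - n.+1%:R)) => n; rewrite normrN ger0_norm.
Qed.

End normal.
End line.

(** * Fourier transform of the normal density *)

Section normal_fourier.
Context {R : realType}.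
Local Notation leb := (@lebesgue_measure R).
Variables (c s : R) (s0 : 0 < s).
Let p := normal_pdf c s.
Let C t := \int[leb]_x (cos (t * x) * p x).
Let S t := \int[leb]_x (sin (t * x) * p x).

Let ccos t : continuous (fun x : R => cos (t * x)).
Proof. by move=> x; apply: continuous_comp; [exact: mulrl_continuous|exact: continuous_cos]. Qed.

Let csin t : continuous (fun x : R => sin (t * x)).
Proof. by move=> x; apply: continuous_comp; [exact: mulrl_continuous|exact: continuous_sin]. Qed.

Let dcos t (x : R) : is_derive x 1 (fun x : R => cos (t * x)) (- t * sin (t * x)).
Proof.
have h : is_derive x 1 (fun x : R => t * x) t.
  by apply: is_derive_eq; rewrite /GRing.scale /=; ring.
by have := is_derive1_comp (is_derive_cos (t * x)) h => h2; apply: is_derive_eq; ring.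
Qed.

Let dsin t (x : R) : is_derive x 1 (fun x : R => sin (t * x)) (t * cos (t * x)).
Proof.
have h : is_derive x 1 (fun x : R => t * x) t.
  by apply: is_derive_eq; rewrite /GRing.scale /=; ring.
by have := is_derive1_comp (is_derive_sin (t * x)) h => h2; apply: is_derive_eq; ring.
Qed.

Let iC t : L1 leb (fun x => cos (t * x) * p x).
Proof. by apply: L1_bounded_mul => // [x|]; [exact: cos_max|exact: L1_pdf]. Qed.
Let iS t : L1 leb (fun x => sin (t * x) * p x).
Proof. by apply: L1_bounded_mul => // [x|]; [exact: sin_max|exact: L1_pdf]. Qed.
Let iXS t : L1 leb (fun x => sin (t * x) * (x * p x)).
Proof. by apply: L1_bounded_mul => // [x|]; [exact: sin_max|exact: L1_xpdf]. Qed.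

Let XC t : \int[leb]_x (cos (t * x) * (x * p x)) = c * C t - s ^+ 2 * t * S t.
Proof.
have h1 : continuous (fun x : R => - t * sin (t * x)).
  by move=> x; apply: cvgMr; exact: csin.
have h2 x : `|- t * sin (t * x)| <= `|t| by rewrite normrM normrN ler_piMr// sin_max.
have := @Rint_ibp_pdf R c s s0 _ _ `|t| (dcos t) h1 (fun x => cos_max _) h2.
rewrite -/p (@eq_Rint _ _ _ leb _ (fun x => - t * (sin (t * x) * p x))); last by move=> x; ring.
rewrite RintegralZl// -/(C t) -/(S t) => /(congr1 (fun z => z * s ^+ 2)).
rewrite divfK; last by rewrite expf_neq0// gt_eqF.
by move=> H; rewrite -[LHS](subrK (c * C t)) -H; ring.
Qed.

Let XS t : \int[leb]_x (sin (t * x) * (x * p x)) = c * S t + s ^+ 2 * t * C t.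
Proof.
have h1 : continuous (fun x : R => t * cos (t * x)).
  by move=> x; apply: cvgMr; exact: ccos.
have h2 x : `|t * cos (t * x)| <= `|t| by rewrite normrM ler_piMr// cos_max.
have := @Rint_ibp_pdf R c s s0 _ _ `|t| (dsin t) h1 (fun x => sin_max _) h2.
rewrite -/p (@eq_Rint _ _ _ leb _ (fun x => t * (cos (t * x) * p x))); last by move=> x; ring.
rewrite RintegralZl// -/(C t) -/(S t) => /(congr1 (fun z => z * s ^+ 2)).
rewrite divfK; last by rewrite expf_neq0// gt_eqF.
by move=> H; rewrite -[LHS](subrK (c * S t)) -H; ring.
Qed.

Let dC (t : R) : is_derive t 1 C (- (c * S t + s ^+ 2 * t * C t)).
Proof.
rewrite -XS -mulN1r -RintegralZl//.
apply: (@is_derive_Rint _ _ _ leb _ (fun t x => -1 * (sin (t * x) * (x * p x)))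
   (fun x => `|x * p x|) t (t - 1) (t + 1)).
- by apply/andP; split; lra.
- by move=> x _; exact: iC.
- move=> u x _; have h : is_derive u 1 (fun u : R => u * x) x.
    by apply: is_derive_eq; rewrite /GRing.scale /=; ring.
  have h2 := @is_derive1_comp _ cos (fun u : R => u * x) u _ _ (is_derive_cos _) h.
  by apply: is_derive_eq; rewrite /GRing.scale /=; ring.
- by apply: L1_norm; exact: L1_xpdf.
- by move=> u x _; rewrite mulN1r normrN normrM ler_piMl// sin_max.
Qed.

Let dS (t : R) : is_derive t 1 S (c * C t - s ^+ 2 * t * S t).
Proof.
rewrite -XC.
apply: (@is_derive_Rint _ _ _ leb _ (fun t x => cos (t * x) * (x * p x))
   (fun x => `|x * p x|) t (t - 1) (t + 1)).
- by apply/andP; split; lra.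
- by move=> x _; exact: iS.
- move=> u x _; have h : is_derive u 1 (fun u : R => u * x) x.
    by apply: is_derive_eq; rewrite /GRing.scale /=; ring.
  have h2 := @is_derive1_comp _ sin (fun u : R => u * x) u _ _ (is_derive_sin _) h.
  by apply: is_derive_eq; rewrite /GRing.scale /=; ring.
- by apply: L1_norm; exact: L1_xpdf.
- by move=> u x _; rewrite normrM ler_piMl// cos_max.
Qed.

Let E t := expR (s ^+ 2 * t ^+ 2 / 2).

Let dE (t : R) : is_derive t 1 E (s ^+ 2 * t * E t).
Proof.
have h : is_derive t 1 (fun t : R => s ^+ 2 * t ^+ 2 / 2) (s ^+ 2 * t).
  by apply: is_derive_eq; rewrite /GRing.scale /=; field.
by have h2 := is_derive1_comp (is_derive_expR _) h; apply: is_derive_eq; rewrite mulrC.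
Qed.

Let dcosc (t : R) : is_derive t 1 (fun t : R => cos (t * c)) (- c * sin (t * c)).
Proof.
have h : is_derive t 1 (fun u : R => u * c) c.
  by apply: is_derive_eq; rewrite /GRing.scale /=; ring.
by have h2 := @is_derive1_comp _ cos (fun u : R => u * c) t _ _ (is_derive_cos _) h; apply: is_derive_eq; ring.
Qed.

Let dsinc (t : R) : is_derive t 1 (fun t : R => sin (t * c)) (c * cos (t * c)).
Proof.
have h : is_derive t 1 (fun u : R => u * c) c.
  by apply: is_derive_eq; rewrite /GRing.scale /=; ring.
by have h2 := @is_derive1_comp _ sin (fun u : R => u * c) t _ _ (is_derive_sin _) h; apply: is_derive_eq; ring.
Qed.

Let C0 : C 0 = 1.
Proof.
rewrite /C (@eq_Rint _ _ _ leb _ p); last by move=> x; rewrite mul0r cos0 mul1r.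
by rewrite /Rintegral integral_normal_pdf.
Qed.

Let S0 : S 0 = 0.
Proof.
rewrite /S (@eq_Rint _ _ _ leb _ (cst 0)); last by move=> x; rewrite mul0r sin0 mul0r.
by rewrite Rintegral_cst//= mul0r.
Qed.

Let PE t : E t * (C t * cos (t * c) + S t * sin (t * c)) = 1.
Proof.
transitivity (E 0 * (C 0 * cos (0 * c) + S 0 * sin (0 * c))); last first.
  by rewrite C0 S0 /E expr0n /= mulr0 !mul0r cos0 expR0; ring.
apply: (@is_derive_0_is_cst _ (fun t => E t * (C t * cos (t * c) + S t * sin (t * c)))) => x.
have := dE x; have := dC x; have := dS x; have := dcosc x; have := dsinc x => ? ? ? ? ?.
by apply: is_derive_eq; rewrite /GRing.scale /=; ring.
Qed.

Let QE t : E t * (S t * cos (t * c) - C t * sin (t * c)) = 0.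
Proof.
transitivity (E 0 * (S 0 * cos (0 * c) - C 0 * sin (0 * c))); last first.
  by rewrite C0 S0 !mul0r sin0; ring.
apply: (@is_derive_0_is_cst _ (fun t => E t * (S t * cos (t * c) - C t * sin (t * c)))) => x.
have := dE x; have := dC x; have := dS x; have := dcosc x; have := dsinc x => ? ? ? ? ?.
by apply: is_derive_eq; rewrite /GRing.scale /=; ring.
Qed.

Local Open Scope complex_scope.

Lemma cL1_cis_pdf t : cL1 leb (fun x => cis (t * x) * (p x)%:C).
Proof.
split; first by apply: eq_L1 (iC t) => x; rewrite ReM /=; ring.
by apply: eq_L1 (iS t) => x; rewrite ImM /=; ring.
Qed.

(** The cosine and sine transforms [C] and [S] of the density satisfy the
    linear system [C' = - (c S + s^2 t C)], [S' = c C - s^2 t S], obtained by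
    differentiating under the integral and integrating by parts.  Hence
    [(C + i S) e^(- i t c) e^(s^2 t^2 / 2)] has zero derivative, and it is [1]
    at [t = 0]. *)
Lemma cint_cis_pdf t : cint leb (fun x => cis (t * x) * (p x)%:C) =
  cis (t * c) * (expR (- (s ^+ 2 * t ^+ 2 / 2)))%:C.
Proof.
rewrite /cint (@eq_Rint _ _ _ leb _ (fun x => cos (t * x) * p x)); last first.
  by move=> x; rewrite ReM /=; ring.
rewrite (@eq_Rint _ _ _ leb (fun x => complex.Im _) (fun x => sin (t * x) * p x)); last first.
  by move=> x; rewrite ImM /=; ring.
rewrite -/(C t) -/(S t) expRN -/(E t).
have E0 : E t != 0 by rewrite gt_eqF// expR_gt0.
have cs := cos2Dsin2 (t * c).
have C1 : C t = cos (t * c) / E t.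
  apply: (mulfI E0); rewrite [RHS]mulrCA divff// mulr1.
  transitivity (E t * (C t * cos (t * c) + S t * sin (t * c)) * cos (t * c) -
     E t * (S t * cos (t * c) - C t * sin (t * c)) * sin (t * c)).
    by rewrite -[C t in LHS]mulr1 -cs; ring.
  by rewrite PE QE; ring.
have S1 : S t = sin (t * c) / E t.
  apply: (mulfI E0); rewrite [RHS]mulrCA divff// mulr1.
  transitivity (E t * (C t * cos (t * c) + S t * sin (t * c)) * sin (t * c) +
     E t * (S t * cos (t * c) - C t * sin (t * c)) * cos (t * c)).
    by rewrite -[S t in LHS]mulr1 -cs; ring.
  by rewrite PE QE; ring.
by apply/eqP; rewrite eq_complex ReM ImM /= C1 S1 !mulr0 subr0 add0r !eqxx.
Qed.

End normal_fourier.

(** * Gaussian test functions *)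

Lemma is_derive_comp_real {R : realType} {V : normedModType R} (h : R -> R)
    (f : V -> R) (x v : V) (dh df : R) :
  is_derive (f x) 1 h dh -> differentiable f x -> is_derive x v f df ->
  differentiable (h \o f) x /\ is_derive x v (h \o f) (dh * df).
Proof.
move=> [h1 h2] f1 [_ f3].
have h3 : differentiable h (f x) by exact/derivable1_diffP.
have hf : differentiable (h \o f) x by exact: differentiable_comp.
split; first exact: hf.
split; first exact: diff_derivable hf.
rewrite (deriveE v hf) diff_comp// (deriv1E h1) /=.
by rewrite -(deriveE v f1) f3 derive1E h2 /GRing.scale /= mulrC.
Qed.

Section rV_calculus.
Context {R : realType} {d : nat}.
Local Notation vec := 'rV[R]_d.
Implicit Types (x y v b c : vec).

Lemma is_derive_coord x v (i : 'I_d) :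
  is_derive x v (fun y => y ord0 i) (v ord0 i).
Proof.
have df : differentiable (fun y : vec => y ord0 i : R) x by exact: differentiable_coord.
split; first exact: diff_derivable.
apply: cvg_lim => //; apply: cvg_near_cst; near=> h.
rewrite /= !mxE addrK /GRing.scale /= mulrA mulVf ?mul1r//.
by near: h; exact: nbhs_dnbhs_neq.
Unshelve. all: by end_near. Qed.

Lemma differentiable_dotl b x : differentiable (dot b) x.
Proof.
rewrite (_ : dot b = \sum_i (fun y : vec => b ord0 i *: (y ord0 i : R^o))).
  by apply: differentiable_sum => i; apply: differentiableZ; exact: differentiable_coord.
by apply/funext => y; rewrite fct_sumE.
Qed.

Lemma is_derive_dotl b x v : is_derive x v (dot b) (dot b v).
Proof.
rewrite (_ : dot b = \sum_i (fun y : vec => b ord0 i *: (y ord0 i : R^o))); last first.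
  by apply/funext => y; rewrite fct_sumE.
rewrite (_ : _ v = \sum_i b ord0 i *: (v ord0 i : R^o)); last by rewrite fct_sumE.
by apply: is_derive_sum => i; apply: is_deriveZ; exact: is_derive_coord.
Qed.

Definition sqdist c x := dot (x - c) (x - c).

Lemma sqdistE c x : sqdist c x = \sum_i (x ord0 i - c ord0 i) ^+ 2.
Proof. by apply: eq_bigr => i _; rewrite !mxE expr2. Qed.

Lemma differentiable_sqdist c x : differentiable (sqdist c) x.
Proof.
rewrite (_ : sqdist c = \sum_i ((fun y : vec => y ord0 i : R) - cst (c ord0 i)) ^+ 2).
  apply: differentiable_sum => i; apply: differentiableX; apply: differentiableB => //.
  exact: differentiable_coord.
by apply/funext => y; rewrite fct_sumE sqdistE; apply: eq_bigr => i _; rewrite fctE.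
Qed.

Lemma is_derive_sqdist c x (i : 'I_d) :
  is_derive x (delta_mx ord0 i) (sqdist c) (2 * (x ord0 i - c ord0 i)).
Proof.
rewrite (_ : sqdist c = \sum_j ((fun y : vec => y ord0 j : R) - cst (c ord0 j)) ^+ 2); last first.
  by apply/funext => y; rewrite fct_sumE sqdistE; apply: eq_bigr => j _; rewrite fctE.
rewrite (_ : 2 * _ = \sum_j 2 * (x ord0 j - c ord0 j) * (delta_mx ord0 i : vec) ord0 j).
  apply: is_derive_sum => j.
  have h := is_derive_coord x (delta_mx ord0 i) j.
  have h2 : is_derive x (delta_mx ord0 i) (cst (c ord0 j) : vec -> R) 0 by exact: is_derive_cst.
  by apply: is_derive_eq; rewrite /GRing.scale /= fctE expr1 subr0 -mulr_natl.
rewrite (bigD1 i)//= big1 ?addr0; first by rewrite mxE !eqxx mulr1.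
by move=> j ji; rewrite mxE (negbTE ji) andbF mulr0.
Qed.

Definition gauss (a : R) c x := expR (- (a * sqdist c x)).

Lemma differentiable_gauss a c x (i : 'I_d) : differentiable (gauss a c) x /\
  is_derive x (delta_mx ord0 i) (gauss a c) (- (2 * a) * ((x ord0 i - c ord0 i) * gauss a c x)).
Proof.
have h : is_derive (sqdist c x) 1 (fun r : R => expR (- (a * r))) (- a * gauss a c x).
  have h1 : is_derive (sqdist c x) 1 (fun r : R => - (a * r)) (- a).
    by apply: is_derive_eq; rewrite /GRing.scale /=; ring.
  have := is_derive1_comp (is_derive_expR _) h1 => h2.
  by apply: is_derive_eq; rewrite mulrC.
have [h1 h2] := is_derive_comp_real h (differentiable_sqdist c x) (is_derive_sqdist c x i).
by split=> //; apply: is_derive_eq; ring.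
Qed.

Lemma dot_delta b i : dot b (delta_mx ord0 i) = b ord0 i.
Proof.
rewrite /dot (bigD1 i)//= big1 ?addr0; first by rewrite mxE !eqxx mulr1.
by move=> j ji; rewrite mxE (negbTE ji) andbF mulr0.
Qed.

Lemma dotC x y : dot x y = dot y x.
Proof. by apply: eq_bigr => i _; rewrite mulrC. Qed.

Lemma dot_shift (j : 'I_d) (t : R) x y :
  dot (t *: delta_mx ord0 j + x) y - dot x y = t * y ord0 j.
Proof.
rewrite /dot -sumrB (bigD1 j)//= big1 ?addr0; last first.
  by move=> i ij; rewrite !mxE (negbTE ij) andbF mulr0 add0r subrr.
by rewrite !mxE !eqxx mulr1 mulrDl addrK.
Qed.

(** The constructors are what a partial derivative of a modulated Gaussian
    brings in, so the class is stable under all of them; being inductive, it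
    has its decay checked constructor by constructor. *)
Inductive gauss_class a c : (vec -> R) -> Prop :=
| gauss_class_cos b : gauss_class a c (fun x => cos (dot b x) * gauss a c x)
| gauss_class_sin b : gauss_class a c (fun x => sin (dot b x) * gauss a c x)
| gauss_classD f g : gauss_class a c f -> gauss_class a c g -> gauss_class a c (fun x => f x + g x)
| gauss_classZ r f : gauss_class a c f -> gauss_class a c (fun x => r * f x)
| gauss_classX i f : gauss_class a c f -> gauss_class a c (fun x => x ord0 i * f x).

Lemma gauss_class_derive a c f i : gauss_class a c f ->
  exists2 g, gauss_class a c g & forall x, differentiable f x /\
    is_derive x (delta_mx ord0 i) f (g x).
Proof.
elim=> [b|b|{}f g _ [f' cf' df] _ [g' cg' dg]|r {}f _ [f' cf' df]|j {}f cf [f' cf' df]].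
- exists (fun x => - (b ord0 i) * (sin (dot b x) * gauss a c x) +
    - (2 * a) * (x ord0 i * (cos (dot b x) * gauss a c x) + - c ord0 i * (cos (dot b x) * gauss a c x))).
    apply: gauss_classD; first by apply: gauss_classZ; exact: gauss_class_sin.
    apply: gauss_classZ; apply: gauss_classD; first by apply: gauss_classX; exact: gauss_class_cos.
    by apply: gauss_classZ; exact: gauss_class_cos.
  move=> x; have [g1 g2] := differentiable_gauss a c x i.
  have [h1 h2] := is_derive_comp_real (is_derive_cos (dot b x))
    (differentiable_dotl b x) (is_derive_dotl b x (delta_mx ord0 i)).
  split; first exact: differentiableM.
  by apply: is_derive_eq; rewrite dot_delta /GRing.scale /=; ring.
- exists (fun x => b ord0 i * (cos (dot b x) * gauss a c x) +
    - (2 * a) * (x ord0 i * (sin (dot b x) * gauss a c x) + - c ord0 i * (sin (dot b x) * gauss a c x))).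
    apply: gauss_classD; first by apply: gauss_classZ; exact: gauss_class_cos.
    apply: gauss_classZ; apply: gauss_classD; first by apply: gauss_classX; exact: gauss_class_sin.
    by apply: gauss_classZ; exact: gauss_class_sin.
  move=> x; have [g1 g2] := differentiable_gauss a c x i.
  have [h1 h2] := is_derive_comp_real (is_derive_sin (dot b x))
    (differentiable_dotl b x) (is_derive_dotl b x (delta_mx ord0 i)).
  split; first exact: differentiableM.
  by apply: is_derive_eq; rewrite dot_delta /GRing.scale /=; ring.
- exists (fun x => f' x + g' x); first exact: gauss_classD.
  move=> x; have [? ?] := df x; have [? ?] := dg x.
  by split; [exact: differentiableD|exact: is_deriveD].
- exists (fun x => r * f' x); first exact: gauss_classZ.
  move=> x; have [? ?] := df x.
  by split; [exact: (@differentiableZ R vec R^o)|exact: (@is_deriveZ R vec R^o)].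
- exists (fun x => x ord0 j * f' x + (delta_mx ord0 i : vec) ord0 j * f x).
    by apply: gauss_classD; [exact: gauss_classX|exact: gauss_classZ].
  move=> x; have [? ?] := df x; have := is_derive_coord x (delta_mx ord0 i) j => ?.
  split; first by apply: differentiableM => //; exact: differentiable_coord.
  by apply: is_derive_eq; rewrite /GRing.scale /=; ring.
Qed.

Lemma gauss_class_partials a c f s : gauss_class a c f -> gauss_class a c (partials s f).
Proof.
move=> cf; elim: s => //= i s IH.
have [g cg dg] := gauss_class_derive i IH.
rewrite (_ : partial _ _ = g)//; apply/funext => x.
by have [_ h] := dg x; exact: derive_val.
Qed.

Lemma gauss_class_smooth (i0 : 'I_d) a c f : gauss_class a c f -> smooth f.
Proof.
by move=> cf s x; have [g _ /(_ x)[]] := gauss_class_derive i0 (gauss_class_partials s cf).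
Qed.

Lemma normr_coord_le x i : `|x ord0 i| <= `|x|.
Proof.
rewrite [`|x|]mx_normrE; apply: (@le_bigmax_cond _ _ _ _ (ord0, i) xpredT (fun ij => `|x ij.1 ij.2|)).
by [].
Qed.

Lemma normr_le_coord x (r : R) : 0 <= r -> (forall i, `|x ord0 i| <= r) -> `|x| <= r.
Proof.
move=> r0 xr; rewrite [`|x|]mx_normrE; apply: bigmax_le => // -[i j] _ /=.
by rewrite (ord1 i).
Qed.

Lemma coord_sqr_le_dot x i : x ord0 i ^+ 2 <= dot x x.
Proof.
rewrite /dot (bigD1 i)//= -expr2 lerDl sumr_ge0// => j _.
by rewrite -expr2 sqr_ge0.
Qed.

Lemma dot_ge0 x : 0 <= dot x x.
Proof. by apply: sumr_ge0 => i _; rewrite -expr2 sqr_ge0. Qed.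

Lemma normr_sqr_le_dot x : `|x| ^+ 2 <= dot x x.
Proof.
rewrite -[leRHS]sqr_sqrtr ?dot_ge0// ler_pXn2r ?nnegrE ?sqrtr_ge0//.
apply: normr_le_coord => [|i]; first exact: sqrtr_ge0.
by rewrite -sqrtr_sqr ler_sqrt ?dot_ge0// coord_sqr_le_dot.
Qed.

Lemma exprn_le_expR (k : nat) (z : R) : 0 <= z -> z ^+ k <= k`!%:R * expR z.
Proof.
move=> z0; rewrite mulrC -ler_pdivrMr ?ltr0n ?fact_gt0//.
case: k => [|k]; first by rewrite expr0 fact0 invr1 mulr1 -expR0 ler_expR.
by apply: le_trans (expR_ge1Dxn k z0); rewrite lerDr.
Qed.

(** Completing the square: this lets a Gaussian absorb an exponential. *)
Lemma sub_sqr_le (a z : R) : 0 < a -> z - a * z ^+ 2 <= (4 * a)^-1.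
Proof.
move=> a0; rewrite -subr_ge0.
have -> : (4 * a)^-1 - (z - a * z ^+ 2) = a * (z - (2 * a)^-1) ^+ 2.
  by field; rewrite gt_eqF.
by rewrite mulr_ge0 ?sqr_ge0// ltW.
Qed.

Lemma gauss_decay a c (k : nat) : 0 < a ->
  exists C, forall x, `|x| ^+ k * gauss a c x <= C.
Proof.
move=> a0; exists (k`!%:R * expR (`|c| + (4 * a)^-1)) => x.
have h1 : `|x| ^+ k <= k`!%:R * expR (`|c| + `|x - c|).
  apply: le_trans (exprn_le_expR k (normr_ge0 x)) _.
  rewrite ler_wpM2l// ler_expR -{1}[x](subrK c) [_ - c + c]addrC; exact: ler_normD.
apply: (le_trans (ler_wpM2r (expR_ge0 _) h1)).
rewrite -mulrA ler_wpM2l// -expRD ler_expR -addrA lerD2l.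
apply: le_trans (sub_sqr_le `|x - c| a0).
by rewrite lerD2l lerN2 ler_pM2l// normr_sqr_le_dot.
Qed.

Lemma gauss_ge0 a c x : 0 <= gauss a c x. Proof. exact: expR_ge0. Qed.

Lemma gauss_class_decay a c f (k : nat) : 0 < a -> gauss_class a c f ->
  exists C, forall x, `|x| ^+ k * `|f x| <= C.
Proof.
move=> a0 cf; elim: cf k => [b|b|{}f g _ IHf _ IHg|r {}f _ IHf|j {}f cf IHf] k.
- have [C hC] := gauss_decay c k a0; exists C => x; apply: le_trans (hC x).
  by rewrite ler_wpM2l ?exprn_ge0// normrM [`|gauss _ _ _|]ger0_norm ?gauss_ge0// ler_piMl ?gauss_ge0// cos_max.
- have [C hC] := gauss_decay c k a0; exists C => x; apply: le_trans (hC x).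
  by rewrite ler_wpM2l ?exprn_ge0// normrM [`|gauss _ _ _|]ger0_norm ?gauss_ge0// ler_piMl ?gauss_ge0// sin_max.
- have [C1 h1] := IHf k; have [C2 h2] := IHg k; exists (C1 + C2) => x.
  apply: le_trans (lerD (h1 x) (h2 x)).
  by rewrite -mulrDr ler_wpM2l ?exprn_ge0// ler_normD.
- have [C h] := IHf k; exists (`|r| * C) => x.
  rewrite normrM mulrCA; apply: ler_wpM2l => //.
- have [C h] := IHf k.+1; exists C => x; apply: le_trans (h x).
  rewrite normrM exprSr -mulrA ler_wpM2l ?exprn_ge0// ler_wpM2r//.
  exact: normr_coord_le.
Qed.

(** Closure under partial derivatives reduces both requirements, smoothness
    and rapid decay of all derivatives, to single members of the class.  The
    index [i0] says that the dimension is positive. *)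
Lemma gauss_class_schwartz (i0 : 'I_d) a c f : 0 < a -> gauss_class a c f -> real_schwartz f.
Proof.
move=> a0 cf; split; first exact: (gauss_class_smooth i0 cf).
by move=> k s; exact: (gauss_class_decay k a0 (gauss_class_partials s cf)).
Qed.

End rV_calculus.

(** * Gaussian packets and their Fourier transforms *)

Section test_functions.
Context {R : realType} {d : nat}.
Local Notation vec := 'rV[R]_d.
Local Notation mu := (lebesgue_rV R d).
Local Notation leb := (@lebesgue_measure R).
Implicit Types (x y v b c : vec).
Local Open Scope complex_scope.

Lemma measurable_dotl b : measurable_fun setT (dot b).
Proof.
apply: measurable_sum => i; apply: measurable_funM => //.
exact: measurable_rV_coord.
Qed.

Lemma measurable_sqdist c : measurable_fun setT (sqdist c).
Proof.
rewrite (_ : sqdist c = fun x => \sum_i (x ord0 i - c ord0 i) ^+ 2); last first.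
  by apply/funext => x; exact: sqdistE.
apply: measurable_sum => i; apply: measurable_funX; apply: measurable_funB => //.
exact: measurable_rV_coord.
Qed.

Lemma measurable_dot : measurable_fun setT (fun xi : vec => dot xi xi).
Proof.
rewrite (_ : (fun xi => _) = sqdist 0); first exact: measurable_sqdist.
by apply/funext => xi; rewrite /sqdist subr0.
Qed.

Lemma measurable_gauss (a : R) c : measurable_fun setT (gauss a c).
Proof.
apply: measurableT_comp => //; apply: measurableT_comp => //.
by apply: measurable_funM => //; exact: measurable_sqdist.
Qed.

Lemma measurable_cosl b : measurable_fun setT (fun x => cos (dot b x)).
Proof.
apply: measurableT_comp; last exact: measurable_dotl.
by apply: continuous_measurable_fun; exact: continuous_cos.
Qed.

Lemma measurable_sinl b : measurable_fun setT (fun x => sin (dot b x)).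
Proof.
apply: measurableT_comp; last exact: measurable_dotl.
by apply: continuous_measurable_fun; exact: continuous_sin.
Qed.

Definition normal_rV c (s : R) x := \prod_i normal_pdf (c ord0 i) s (x ord0 i).

Lemma normal_rV_gauss c s x : 0 < s -> normal_rV c s x = normal_peak s ^+ d * gauss (s ^+ 2 *+ 2)^-1 c x.
Proof.
move=> s0; rewrite /normal_rV /gauss sqdistE mulr_sumr -sumrN expR_sum.
rewrite -[d in X in X * _]card_ord -prodr_const -big_split /=.
apply: eq_bigr => i _; rewrite normal_pdf_exp//; congr (_ * expR _).
by rewrite mulNr mulrC.
Qed.

Lemma L1_normal_rV c s : L1 mu (normal_rV c s).
Proof.
have [|h _] := @Rint_prod R d (fun i => normal_pdf (c ord0 i) s); last exact: h.
by move=> i; exact: integrable_normal_pdf.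
Qed.

Lemma Rint_normal_rV c s : \int[mu]_x normal_rV c s x = 1.
Proof.
have [|_ ->] := @Rint_prod R d (fun i => normal_pdf (c ord0 i) s).
  by move=> i; exact: integrable_normal_pdf.
by apply: big1 => i _; rewrite /Rintegral integral_normal_pdf.
Qed.

Lemma normal_rV_ge0 c s x : 0 <= normal_rV c s x.
Proof. by apply: prodr_ge0 => i _; exact: normal_pdf_ge0. Qed.

Lemma L1_gauss (a : R) c : 0 < a -> L1 mu (gauss a c).
Proof.
move=> a0; pose s := Num.sqrt (2 * a)^-1.
have s0 : 0 < s by rewrite sqrtr_gt0 invr_gt0 mulr_gt0.
have as0 : (s ^+ 2 *+ 2)^-1 = a.
  by rewrite sqr_sqrtr ?invr_ge0 ?mulr_ge0 ?(ltW a0)//; field; rewrite gt_eqF.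
have P0 : normal_peak s ^+ d != 0 by rewrite expf_neq0// gt_eqF// normal_peak_gt0// gt_eqF.
apply: eq_L1 (L1Z (normal_peak s ^+ d)^-1 (L1_normal_rV c s)) => x.
by rewrite normal_rV_gauss// as0 mulKf.
Qed.

Lemma cis0 : cis 0 = 1 :> R[i].
Proof. by rewrite /cis cos0 sin0. Qed.

Lemma cisD (t u : R) : cis (t + u) = cis t * cis u.
Proof. by apply/eqP; rewrite eq_complex ReM ImM /= cosD sinD eqxx /=; apply/eqP; ring. Qed.

Lemma cis_sum n (t : 'I_n -> R) : cis (\sum_i t i) = \prod_i cis (t i).
Proof. by apply: big_morph; [exact: cisD|exact: cis0]. Qed.

(** A plane wave times a normal density, as a test function. *)
Definition packet b c s x : R[i] := cis (dot b x) * (normal_rV c s x)%:C.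

Lemma Re_packet b c s x : complex.Re (packet b c s x) = cos (dot b x) * normal_rV c s x.
Proof. by rewrite ReM /= mulr0 subr0. Qed.

Lemma Im_packet b c s x : complex.Im (packet b c s x) = sin (dot b x) * normal_rV c s x.
Proof. by rewrite ImM /= mulr0 add0r. Qed.

Lemma schwartz_packet (i0 : 'I_d) b c s : 0 < s -> schwartz (packet b c s).
Proof.
move=> s0; have a0 : 0 < (s ^+ 2 *+ 2)^-1 by rewrite invr_gt0 mulrn_wgt0// exprn_gt0.
split.
  apply: (gauss_class_schwartz i0 a0 (c := c)).
  rewrite (_ : (fun x => _) = fun x => normal_peak s ^+ d * (cos (dot b x) * gauss (s ^+ 2 *+ 2)^-1 c x)).
    by apply: gauss_classZ; exact: gauss_class_cos.
  by apply/funext => x; rewrite Re_packet normal_rV_gauss//; ring.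
apply: (gauss_class_schwartz i0 a0 (c := c)).
rewrite (_ : (fun x => _) = fun x => normal_peak s ^+ d * (sin (dot b x) * gauss (s ^+ 2 *+ 2)^-1 c x)).
  by apply: gauss_classZ; exact: gauss_class_sin.
by apply/funext => x; rewrite Im_packet normal_rV_gauss//; ring.
Qed.

(** Both the plane wave and the density factor over the coordinates, which
    reduces the computation to dimension one. *)
Lemma fourier_packet b c s x : 0 < s ->
  fourier (packet b c s) x = cis (dot (b - x) c) * (gauss (s ^+ 2 / 2) b x)%:C.
Proof.
move=> s0; rewrite /fourier -[cintegral]/(cint mu).
have E : (fun y => cis (- dot y x) * packet b c s y) =
   fun y => \prod_i (cis ((b - x) ord0 i * y ord0 i) * (normal_pdf (c ord0 i) s (y ord0 i))%:C).
  apply/funext => y; rewrite /packet mulrA -cisD big_split /= -cis_sum -rmorph_prod.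
  congr (cis _ * _); rewrite /dot -sumrN -big_split /=.
  by apply: eq_bigr => i _; rewrite !mxE mulrBl addrC [y _ _ * _]mulrC.
rewrite E.
have [|_ ->] := @cint_prod R d
  (fun i z => cis ((b - x) ord0 i * z) * (normal_pdf (c ord0 i) s z)%:C).
  by move=> i; exact: cL1_cis_pdf.
under eq_bigr do rewrite cint_cis_pdf//.
rewrite big_split /= -cis_sum -rmorph_prod; congr (cis _ * _%:C).
rewrite /gauss sqdistE mulr_sumr -sumrN expR_sum; apply: eq_bigr => i _.
by rewrite !mxE; congr expR; ring.
Qed.

End test_functions.

(** * Gaussian approximate identity *)

Section inversion.
Context {R : realType} {d : nat} (i0 : 'I_d).
Local Notation vec := 'rV[R]_d.
Local Notation mu := (lebesgue_rV R d).
Implicit Types (x y v b c : vec) (f : vec -> R) (u g : vec -> R[i]).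
Local Open Scope complex_scope.

Lemma schwartz_real (a : R) c f : 0 < a -> gauss_class a c f -> schwartz (fun x => (f x)%:C).
Proof.
move=> a0 cf; split; first exact: (gauss_class_schwartz i0 a0 cf).
apply: (gauss_class_schwartz i0 a0 (c := c)).
rewrite (_ : (fun x => _) = fun x => 0 * f x); first exact: gauss_classZ.
by apply/funext => x; rewrite mul0r.
Qed.

Lemma tempered_gauss_class (a : R) c f u : 0 < a -> gauss_class a c f -> tempered u ->
  L1 mu (fun x => complex.Re (u x) * f x) /\ L1 mu (fun x => complex.Im (u x) * f x).
Proof.
move=> a0 cf /(_ _ (schwartz_real a0 cf))[h1 h2]; split.
  by apply: eq_L1 h1 => x; rewrite ReM /=; ring.
by apply: eq_L1 h2 => x; rewrite ImM /=; ring.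
Qed.

Lemma gauss_class_gauss (a : R) c : gauss_class a c (gauss a c).
Proof.
rewrite (_ : gauss a c = fun x => cos (dot 0 x) * gauss a c x); first exact: gauss_class_cos.
apply/funext => x; rewrite (_ : dot 0 x = 0) ?cos0 ?mul1r//.
by rewrite /dot big1// => i _; rewrite mxE mul0r.
Qed.

Lemma gaussNK (a : R) c x : gauss a c x * gauss (- a) c x = 1.
Proof. by rewrite /gauss -expRD -expR0; congr expR; ring. Qed.

(** Testing against a Gaussian makes [u] times that Gaussian integrable;
    multiplying by the inverse Gaussian recovers [u]. *)
Lemma tempered_measurable u : tempered u ->
  measurable_fun setT (fun x => complex.Re (u x)) /\
  measurable_fun setT (fun x => complex.Im (u x)).
Proof.
move=> tu; have [h1 h2] := tempered_gauss_class ltr01 (gauss_class_gauss 1 0) tu.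
split.
  rewrite (_ : (fun x => _) = fun x => (complex.Re (u x) * gauss 1 0 x) * gauss (- 1) 0 x).
    by apply: measurable_funM; [exact: L1_measurable h1|exact: measurable_gauss].
  by apply/funext => x; rewrite -mulrA gaussNK mulr1.
rewrite (_ : (fun x => _) = fun x => (complex.Im (u x) * gauss 1 0 x) * gauss (- 1) 0 x).
  by apply: measurable_funM; [exact: L1_measurable h2|exact: measurable_gauss].
by apply/funext => x; rewrite -mulrA gaussNK mulr1.
Qed.

Lemma exprn_gauss_le (a : R) (k : nat) : 0 < a ->
  exists2 C, 0 <= C & forall z, 0 <= z -> z ^+ k * expR (- (a * z ^+ 2)) <= C.
Proof.
move=> a0; exists (k`!%:R * expR (4 * a)^-1) => [|z z0]; first by rewrite mulr_ge0// expR_ge0.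
apply: (le_trans (ler_wpM2r (expR_ge0 _) (exprn_le_expR k z0))).
by rewrite -mulrA ler_wpM2l// -expRD ler_expR sub_sqr_le.
Qed.

(** Near [x] continuity of [f] is used; away from [x] a narrow density is
    the product of a fixed Gaussian, against which [f] is integrable, and of a
    factor tending to [0].  No growth condition on [f] other than integrability
    against Gaussians enters, since only that is known of a tempered
    function. *)
Lemma normal_rV_approx_identity f x : {for x, continuous f} ->
  (forall a : R, 0 < a -> L1 mu (fun y => f y * gauss a x y)) ->
  (\int[mu]_y (f y * normal_rV x (n.+1%:R)^-1 y)) @[n --> \oo] --> f x.
Proof.
move=> cf fi.
(* The function that dominates the contribution of the points far from [x]. *)
pose H y := `|f y * gauss (1 / 2) x y| + `|f x| * gauss (1 / 2) x y.
have h0 : 0 < 1 / 2 :> R by rewrite divr_gt0.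
have iH : L1 mu H by apply: L1D; [apply: L1_norm; exact: fi|apply: L1Z; exact: L1_gauss].
have H0 y : 0 <= H y by rewrite addr_ge0// mulr_ge0// gauss_ge0.
have normal_rVE n y : normal_rV x n.+1%:R^-1 y = normal_peak (n.+1%:R^-1) ^+ d * gauss (n.+1%:R ^+ 2 / 2) x y.
  have aE : ((n.+1%:R^-1 : R) ^+ 2 *+ 2)^-1 = n.+1%:R ^+ 2 / 2.
    have n0 : n.+1%:R != 0 :> R by rewrite pnatr_eq0.
    by field.
  by rewrite normal_rV_gauss ?aE// invr_gt0 ltr0Sn.
have ifn n : L1 mu (fun y => f y * normal_rV x n.+1%:R^-1 y).
  apply: eq_L1 (L1Z (normal_peak (n.+1%:R^-1) ^+ d) (fi (n.+1%:R ^+ 2 / 2) _)) => [y|].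
    by rewrite normal_rVE; ring.
  by rewrite divr_gt0// exprn_gt0.
apply/cvgrPdist_le => e e0.
have /nbhs_ballP[r /= r0 hr] := cf _ (nbhsx_ballx (f x) (e / 2) (divr_gt0 e0 (ltr0Sn R 1))).
have r20 : 0 < r ^+ 2 / 2 by rewrite divr_gt0 ?exprn_gt0.
have [C C0 hC] := exprn_gauss_le d.+1 r20.
pose A := C * expR (r ^+ 2 / 2) * \int[mu]_y H y.
have near_bound n y : `|(f y - f x) * normal_rV x n.+1%:R^-1 y| <=
    e / 2 * normal_rV x n.+1%:R^-1 y + C * expR (r ^+ 2 / 2) / n.+1%:R * H y.
  rewrite normrM [`|normal_rV _ _ _|]ger0_norm ?normal_rV_ge0//.
  have [yx|yx] := ltP `|x - y| r.
    rewrite -[leLHS]addr0 lerD//.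
      rewrite ler_wpM2r ?normal_rV_ge0//; have /ltW : ball (f x) (e / 2) (f y).
        by apply: hr; rewrite -ball_normE.
      by rewrite distrC.
    by rewrite mulr_ge0// divr_ge0// mulr_ge0// expR_ge0.
  rewrite -[leLHS]add0r lerD//; first by rewrite mulr_ge0 ?normal_rV_ge0// ltW// divr_gt0.
  have nH : `|f y - f x| * gauss (1 / 2) x y <= H y.
    apply: le_trans (ler_wpM2r (gauss_ge0 _ _ _) (ler_normB _ _)) _.
    by rewrite mulrDl /H normrM [`|gauss _ _ _|]ger0_norm ?gauss_ge0.
  have gE : gauss (n.+1%:R ^+ 2 / 2) x y =
      gauss (1 / 2) x y * (expR (sqdist x y / 2) * expR (- (n.+1%:R ^+ 2 * (sqdist x y / 2)))).
    by rewrite /gauss -!expRD; congr expR; ring.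
  have sr : r ^+ 2 <= sqdist x y.
    rewrite (le_trans _ (normr_sqr_le_dot _))// ler_pXn2r ?nnegrE ?(ltW r0)//.
    by rewrite distrC.
  have n1 : 1 <= n.+1%:R ^+ 2 :> R by rewrite -natrX ler1n expn_gt0.
  have gle : gauss (n.+1%:R ^+ 2 / 2) x y <=
     gauss (1 / 2) x y * (expR (r ^+ 2 / 2) * expR (- (r ^+ 2 / 2 * n.+1%:R ^+ 2))).
    rewrite gE ler_wpM2l ?gauss_ge0// -!expRD ler_expR.
    rewrite -subr_ge0.
    have -> : r ^+ 2 / 2 - r ^+ 2 / 2 * n.+1%:R ^+ 2 -
       (sqdist x y / 2 - n.+1%:R ^+ 2 * (sqdist x y / 2)) =
       (n.+1%:R ^+ 2 - 1) * (sqdist x y - r ^+ 2) / 2 by field.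
    by rewrite divr_ge0// mulr_ge0// subr_ge0.
  (* The peak grows like [n^d]; one more power of [n] is gained from the
     Gaussian factor, which leaves [1 / n]. *)
  have pk : normal_peak n.+1%:R^-1 ^+ d <= n.+1%:R ^+ d :> R.
    apply: lerXn2r; rewrite ?nnegrE ?normal_peak_ge0//.
    have n0 : 0 < n.+1%:R^-1 :> R by rewrite invr_gt0.
    rewrite /normal_peak -[leRHS]invrK lef_pV2 ?posrE ?sqrtr_gt0 ?mulrn_wgt0 ?mulr_gt0 ?exprn_gt0 ?pi_gt0//.
    rewrite -[leLHS](ger0_norm (ltW n0)) -sqrtr_sqr ler_sqrt; last first.
      by rewrite mulrn_wge0// mulr_ge0 ?sqr_ge0// pi_ge0.
    rewrite -mulrnAr ler_peMr ?sqr_ge0// -mulr_natr; have := @pi_ge2 R; lra.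
  rewrite normal_rVE.
  have h1 := hC _ (ler0n R n.+1).
  rewrite mulrCA.
  apply: (le_trans (ler_wpM2l (exprn_ge0 _ (normal_peak_ge0 _)) (ler_wpM2l (normr_ge0 _) gle))).
  rewrite [leLHS](_ : _ = (normal_peak n.+1%:R^-1 ^+ d * expR (- (r ^+ 2 / 2 * n.+1%:R ^+ 2))) *
     expR (r ^+ 2 / 2) * (`|f y - f x| * gauss (1 / 2) x y)); last by ring.
  apply: ler_pM => //.
  - by rewrite !mulr_ge0 ?expR_ge0 ?exprn_ge0 ?normal_peak_ge0.
  - by rewrite mulr_ge0 ?gauss_ge0.
  rewrite [leRHS]mulrAC ler_wpM2r ?expR_ge0// ler_pdivlMr//.
  apply: le_trans h1; rewrite mulrAC ler_wpM2r ?expR_ge0//.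
  by rewrite exprSr ler_wpM2r.
have uE n : \int[mu]_y (f y * normal_rV x n.+1%:R^-1 y) - f x =
    \int[mu]_y ((f y - f x) * normal_rV x n.+1%:R^-1 y).
  rewrite [X in _ - X](_ : f x = \int[mu]_y (f x * normal_rV x n.+1%:R^-1 y)); last first.
    by rewrite RintegralZl ?Rint_normal_rV ?mulr1//; exact: L1_normal_rV.
  rewrite -RintegralB//; last by apply: L1Z; exact: L1_normal_rV.
  by apply: eq_Rint => y; ring.
have bound n : `|\int[mu]_y (f y * normal_rV x n.+1%:R^-1 y) - f x| <= e / 2 + A / n.+1%:R.
  have i1 : L1 mu (fun y => (f y - f x) * normal_rV x n.+1%:R^-1 y).
    by apply: eq_L1 (L1B (ifn n) (L1Z (f x) (L1_normal_rV x n.+1%:R^-1))) => y; ring.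
  rewrite uE (le_trans (le_normr_Rintegral _ i1))//.
  apply: (le_trans (le_Rintegral _ _ _ (fun y _ => near_bound n y))) => //.
  - exact: L1_norm.
  - by apply: L1D; apply: L1Z => //; exact: L1_normal_rV.
  rewrite RintegralD//; [|by apply: L1Z; exact: L1_normal_rV|exact: L1Z].
  rewrite !RintegralZl//; last exact: L1_normal_rV.
  by rewrite Rint_normal_rV mulr1 lerD2l [X in X <= _](_ : _ = A / n.+1%:R)// /A; ring.
have : A * (n.+1%:R^-1) @[n --> \oo] --> A * 0.
  by apply: cvgMr; exact: cvg_harmonic.
rewrite mulr0 => /cvgr0_norm_le /(_ (e / 2) (divr_gt0 e0 (ltr0Sn R 1))).
apply: filterS => n hn; rewrite distrC (le_trans (bound n))//.
by rewrite [leRHS](splitr e) lerD2l (le_trans _ hn)// ler_norm.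
Unshelve. all: by [].
Qed.

End inversion.

(** * Fourier inversion *)

Section pairing.
Context {R : realType} {d : nat} (i0 : 'I_d).
Local Notation vec := 'rV[R]_d.
Local Notation mu := (lebesgue_rV R d).
Implicit Types (x y v b c : vec) (f : vec -> R) (u g : vec -> R[i]).
Local Open Scope complex_scope.

(** The real part of [g(xi) e^(i x.xi)]: as the functions to be recovered are
    real, the imaginary part of the inversion integral can be ignored. *)
Definition inv_integrand g x (xi : vec) : R :=
  complex.Re (g xi) * cos (dot x xi) - complex.Im (g xi) * sin (dot x xi).

(** Equivalent to the complex modulus, and better suited to separate bounds on
    the real and imaginary parts. *)
Definition norm1c g (xi : vec) : R := `|complex.Re (g xi)| + `|complex.Im (g xi)|.

Definition inv_const : R := ((2 * pi)^-1) ^+ d.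

Lemma inv_const_gt0 : 0 < inv_const.
Proof. by rewrite exprn_gt0// invr_gt0 mulr_gt0// pi_gt0. Qed.

Lemma inv_integrand_le g x xi : `|inv_integrand g x xi| <= norm1c g xi.
Proof.
rewrite (le_trans (ler_normB _ _))// !normrM lerD// ler_piMr//.
  exact: cos_max.
exact: sin_max.
Qed.

Lemma measurable_inv_integrand g x :
  measurable_fun setT (fun xi => complex.Re (g xi)) ->
  measurable_fun setT (fun xi => complex.Im (g xi)) ->
  measurable_fun setT (inv_integrand g x).
Proof.
move=> m1 m2; apply: measurable_funB; apply: measurable_funM => //.
  exact: measurable_cosl.
exact: measurable_sinl.
Qed.

Lemma tempered_L1_gauss f (a : R) c : tempered (fun x => (f x)%:C) -> 0 < a ->
  L1 mu (fun x => f x * gauss a c x).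
Proof. by move=> tf a0; have [h _] := tempered_gauss_class i0 a0 (gauss_class_gauss a c) tf. Qed.

(** Duality tested on a packet modulated by [b] and centred at [c]: its
    transform is a Gaussian centred at [b] and modulated by [c]. *)
Lemma fourier_pairing f g b c s : 0 < s -> is_fourier (fun x => (f x)%:C) g ->
  \int[mu]_x (f x * gauss (s ^+ 2 / 2) b x * cos (dot (b - x) c)) =
    \int[mu]_xi (inv_integrand g b xi * normal_rV c s xi) /\
  \int[mu]_x (f x * gauss (s ^+ 2 / 2) b x * sin (dot (b - x) c)) =
    \int[mu]_xi ((complex.Re (g xi) * sin (dot b xi) +
                  complex.Im (g xi) * cos (dot b xi)) * normal_rV c s xi).
Proof.
move=> s0 [tf tg /(_ _ (schwartz_packet i0 b c s0))].
rewrite /cintegral => -[h1 h2]; split.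
  transitivity (\int[mu]_x complex.Re ((f x)%:C * fourier (packet b c s) x)).
    by apply: eq_Rint => x; rewrite fourier_packet// !ReM ImM /=; ring.
  by rewrite h1; apply: eq_Rint => xi; rewrite ReM Re_packet Im_packet /inv_integrand; ring.
transitivity (\int[mu]_x complex.Im ((f x)%:C * fourier (packet b c s) x)).
  by apply: eq_Rint => x; rewrite fourier_packet// !ImM ReM /=; ring.
by rewrite h2; apply: eq_Rint => xi; rewrite ImM Re_packet Im_packet; ring.
Qed.

(** The normalizing constants of the densities of widths [s] and [1 / s],
    which are exchanged by the Fourier transform, multiply to the constant of
    the inversion formula in dimension one. *)
Lemma normal_peak_dual (s : R) : 0 < s ->
  normal_peak s^-1 * normal_peak s = (2 * pi)^-1.
Proof.
move=> s0; have p0 := pi_gt0 R.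
rewrite /normal_peak -invfM -sqrtrM; last first.
  by rewrite mulrn_wge0// mulr_ge0 ?sqr_ge0// ltW.
congr (_^-1); transitivity (Num.sqrt ((2 * pi) ^+ 2 : R)).
  by congr Num.sqrt; field; rewrite gt_eqF.
by rewrite sqrtr_sqr ger0_norm// mulr_ge0// ltW.
Qed.

(** The pairing with a wide packet centred at the frequency [0] is, on the
    other side, the average of [f] against a narrow density around [x].
    Nothing is assumed on [g] beyond temperedness. *)
Lemma regularized_inversion f g x : {for x, continuous f} ->
  is_fourier (fun x => (f x)%:C) g ->
  (inv_const * \int[mu]_xi (inv_integrand g x xi * gauss (n.+1%:R ^+ 2 *+ 2)^-1 0 xi)) @[n --> \oo] --> f x.
Proof.
move=> cf fg; have [tf tg _] := fg.
apply: cvg_trans (normal_rV_approx_identity cf (fun a a0 => tempered_L1_gauss x tf a0)).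
apply: near_eq_cvg; apply: nearW => n.
have n0 : 0 < n.+1%:R :> R by [].
have aE : ((n.+1%:R^-1 : R) ^+ 2 *+ 2)^-1 = n.+1%:R ^+ 2 / 2.
  by field; rewrite gt_eqF.
have [h _] := fourier_pairing x 0 n0 fg.
have a0 : 0 < n.+1%:R ^+ 2 / 2 :> R by rewrite divr_gt0// exprn_gt0.
have dot0 v : dot v 0 = 0 by rewrite /dot big1// => i _; rewrite mxE mulr0.
transitivity (normal_peak n.+1%:R^-1 ^+ d *
  \int[mu]_y (f y * gauss (n.+1%:R ^+ 2 / 2) x y * cos (dot (x - y) 0))).
  rewrite -RintegralZl//; last first.
    by apply: eq_L1 (tempered_L1_gauss x tf a0) => y; rewrite /= dot0 cos0 mulr1.
  apply: eq_Rint => y; rewrite normal_rV_gauss ?aE ?invr_gt0//.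
  by rewrite dot0 cos0 mulr1; ring.
rewrite h /inv_const -(normal_peak_dual n0) exprMn -mulrA; congr (_ * _).
have ig : L1 mu (fun xi => inv_integrand g x xi * gauss (n.+1%:R ^+ 2 *+ 2)^-1 0 xi).
  have b0 : 0 < (n.+1%:R ^+ 2 *+ 2)^-1 :> R by rewrite invr_gt0 mulrn_wgt0// exprn_gt0.
  have [h1 _] := tempered_gauss_class i0 b0 (gauss_class_cos _ 0 x) tg.
  have [_ h2] := tempered_gauss_class i0 b0 (gauss_class_sin _ 0 x) tg.
  by apply: eq_L1 (L1B h1 h2) => xi; rewrite /inv_integrand; ring.
rewrite -RintegralZl//; apply: eq_Rint => xi; rewrite normal_rV_gauss//; ring.
Qed.

Lemma cvg_gauss1 x : gauss (n.+1%:R ^+ 2 *+ 2)^-1 0 x @[n --> \oo] --> (1 : R).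
Proof.
suff : gauss (n.+1%:R ^+ 2 *+ 2)^-1 0 x @[n --> \oo] --> expR (- 0 : R).
  by rewrite oppr0 expR0.
apply: continuous_cvg; first exact: continuous_expR.
apply: cvgN.
apply: norm_cvg0.
apply: (@squeeze_cvgr _ _ _ _ (cst 0) (fun n => sqdist 0 x * n.+1%:R^-1)); last 2 first.
- exact: cvg_cst.
- by rewrite -[X in _ --> X](mulr0 (sqdist 0 x)); apply: cvgMr; exact: cvg_harmonic.
apply: nearW => n; rewrite normr_ge0 /= normrM mulrC [`|sqdist _ _|]ger0_norm ?dot_ge0//.
rewrite ler_wpM2l ?dot_ge0// ger0_norm ?invr_ge0 ?mulrn_wge0 ?sqr_ge0//.
rewrite lef_pV2 ?posrE ?mulrn_wgt0 ?exprn_gt0//.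
by rewrite -natrX -mulrnA ler_nat -mulnn -mulnA leq_pmulr// muln_gt0.
Qed.

Lemma L1_norm1c g : L1 mu (fun xi => complex.Re (g xi)) ->
  L1 mu (fun xi => complex.Im (g xi)) -> L1 mu (norm1c g).
Proof. by move=> g1 g2; apply: L1D; exact: L1_norm. Qed.

Lemma gauss_le1 (a : R) c x : 0 <= a -> gauss a c x <= 1.
Proof. by move=> a0; rewrite -expR0 ler_expR oppr_le0 mulr_ge0// dot_ge0. Qed.

(** When [g] is integrable the Gaussian cut-off in the regularized formula
    can be removed by dominated convergence. *)
Lemma fourier_inversion f g x : {for x, continuous f} ->
  is_fourier (fun x => (f x)%:C) g ->
  L1 mu (fun xi => complex.Re (g xi)) -> L1 mu (fun xi => complex.Im (g xi)) ->
  f x = inv_const * \int[mu]_xi inv_integrand g x xi.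
Proof.
move=> cf fg g1 g2.
have mr := measurable_inv_integrand x (L1_measurable g1) (L1_measurable g2).
suff h : (inv_const * \int[mu]_xi (inv_integrand g x xi * gauss (n.+1%:R ^+ 2 *+ 2)^-1 0 xi)) @[n --> \oo] -->
    inv_const * \int[mu]_xi inv_integrand g x xi by exact: cvg_unique (regularized_inversion cf fg) h.
apply: cvgMr; apply: (@Rint_cvg_dominated _ _ _ mu _ _ (norm1c g)) => [n|xi||n xi].
- by apply: measurable_funM => //; exact: measurable_gauss.
- by rewrite -[X in _ --> X]mulr1; apply: cvgMr; exact: cvg_gauss1.
- exact: L1_norm1c.
- rewrite normrM [`|gauss _ _ _|]ger0_norm ?gauss_ge0// (le_trans _ (inv_integrand_le g x xi))//.
  by rewrite ler_piMr// gauss_le1// invr_ge0 mulrn_wge0// sqr_ge0.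
Qed.

Lemma fourier_sup_le f g x : {for x, continuous f} ->
  is_fourier (fun x => (f x)%:C) g ->
  L1 mu (fun xi => complex.Re (g xi)) -> L1 mu (fun xi => complex.Im (g xi)) ->
  `|f x| <= inv_const * \int[mu]_xi norm1c g xi.
Proof.
move=> cf fg g1 g2; rewrite (fourier_inversion cf fg g1 g2) normrM.
rewrite ger0_norm ?(ltW inv_const_gt0)// ler_pM2l ?inv_const_gt0//.
have ir : L1 mu (inv_integrand g x).
  apply: (@L1_le _ _ _ mu _ (norm1c g)); [|exact: L1_norm1c|exact: inv_integrand_le].
  exact: measurable_inv_integrand (L1_measurable g1) (L1_measurable g2).
rewrite (le_trans (le_normr_Rintegral _ ir))// le_Rintegral//.
- exact: L1_norm.
- exact: L1_norm1c.
- by move=> xi _; exact: inv_integrand_le.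
Qed.

End pairing.
Arguments inv_const : clear implicits.
Arguments inv_const_gt0 : clear implicits.

(** * Integrability of the Fourier transform of a Sobolev function *)

Section weight.
Context {R : realType}.
Local Notation leb := (@lebesgue_measure R).

Lemma powRN_cvgy (r : R) : 0 < r -> (1 + x) `^ (- r) @[x --> +oo] --> (0 : R).
Proof.
move=> r0; apply/cvgrPdist_le => e e0; near=> x.
have M0 : 0 < e `^ (- r^-1) by rewrite powR_gt0.
have xM : e `^ (- r^-1) <= x by near: x; exact: nbhs_pinfty_ge.
rewrite sub0r normrN ger0_norm ?powR_ge0// powRN.
rewrite -[leRHS]invrK lef_pV2 ?posrE ?powR_gt0 ?invr_gt0//; last first.
  by rewrite (lt_le_trans M0)// (le_trans xM)// lerDr.
rewrite -(powR_inv1 (ltW e0)) (_ : -1 = (- r^-1) * r); last first.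
  by field; rewrite gt_eqF.
rewrite powRrM ge0_ler_powR ?nnegrE ?powR_ge0 ?(ltW r0)//.
  by rewrite (le_trans (ltW M0))// (le_trans xM)// lerDr.
by rewrite (le_trans xM)// lerDr.
Unshelve. all: by end_near. Qed.

Lemma integral_powR_tail (q : R) : 1 < q ->
  (\int[leb]_(x in `[0%R, +oo[) ((1 + x) `^ (- q))%:E < +oo)%E.
Proof.
move=> q1.
have x1 (x : R) : 0 <= x -> 0 < 1 + x by move=> x0; lra.
pose F (x : R) := (1 - q)^-1 * (1 + x) `^ (1 - q).
have dF (x : R) : 0 <= x -> is_derive x 1 F ((1 + x) `^ (- q)).
  move=> x0.
  have h1 : is_derive x 1 (fun x : R => 1 + x) 1 by apply: is_derive_eq; rewrite add0r mulr1.
  have h2 := @is_derive1_comp _ (fun y => y `^ (1 - q)) (fun x : R => 1 + x) x _ _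
     (is_derive1_powR (1 - q) (x1 x x0)) h1.
  apply: is_derive_eq; rewrite /GRing.scale /= mulr1 mulrA mulVf ?mul1r.
    by congr (_ `^ _); ring.
  by rewrite lt_eqF// subr_lt0.
rewrite (@ge0_continuous_FTC2y _ (fun x => (1 + x) `^ (- q)) F 0 0).
- by rewrite -EFinB ltry.
- by move=> x _; exact: powR_ge0.
- apply: continuous_in_subspaceT => x; rewrite inE /= in_itv /= andbT => x0.
  apply: differentiable_continuous; apply/derivable1_diffP.
  have h1 : is_derive x 1 (fun x : R => 1 + x) 1 by apply: is_derive_eq; rewrite add0r mulr1.
  by case: (@is_derive1_comp _ (fun y => y `^ (- q)) (fun x : R => 1 + x) x _ _
     (is_derive1_powR (- q) (x1 x x0)) h1).
- rewrite /F -[X in _ --> X](mulr0 (1 - q)^-1); apply: cvgMr.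
  rewrite (_ : 1 - q = - (q - 1)); last by ring.
  by apply: powRN_cvgy; rewrite subr_gt0.
- by move=> x x0; case: (dF x (ltW x0)).
- apply: cvg_at_right_filter; apply: differentiable_continuous; apply/derivable1_diffP.
  by case: (dF 0 (lexx 0)).
- move=> x; rewrite in_itv /= andbT => x0; rewrite derive1E.
  by have h := dF x (ltW x0); exact: derive_val.
Qed.

(** The integrand is even and [(1 + x)^2 <= 2 (1 + x^2)] compares it with
    a power of [1 + x], whose primitive is explicit. *)
Lemma L1_weight1 (p : R) : 2^-1 < p -> L1 leb (fun x => (1 + x ^+ 2) `^ (- p)).
Proof.
move=> p2.
have p0 : 0 < p by apply: lt_trans p2; rewrite invr_gt0.
have c1 (x : R) : 0 < 1 + x ^+ 2 by rewrite ltr_pwDl// sqr_ge0.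
have ch : continuous (fun x : R => (1 + x ^+ 2) `^ (- p)).
  move=> x; apply: differentiable_continuous; apply/derivable1_diffP.
  have h1 : is_derive x 1 (fun x : R => 1 + x ^+ 2) (2 * x).
    by apply: is_derive_eq; rewrite /GRing.scale /=; ring.
  by case: (@is_derive1_comp _ (fun y => y `^ (- p)) (fun x : R => 1 + x ^+ 2) x _ _
     (is_derive1_powR (- p) (c1 x)) h1).
apply/ge0_L1P => [|x|].
- exact: continuous_measurable_fun.
- exact: powR_ge0.
rewrite ge0_symfun_integralT//=; last 2 first.
- by move=> x; exact: powR_ge0.
- by move=> x /=; rewrite sqrrN.
rewrite (_ : [set x | _] = `[0, +oo[%classic); last first.
  by apply/seteqP; split => x/=; rewrite in_itv/= andbT.
have tl : (\int[leb]_(x in `[0%R, +oo[) ((1 + x) `^ (- (2 * p)))%:E < +oo)%E.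
  by apply: integral_powR_tail; rewrite -ltr_pdivrMl// mulr1.
apply: lte_mul_pinfty; [by rewrite lee_fin|by []|].
apply: (@le_lt_trans _ _ (\int[leb]_(x in `[0%R, +oo[) ((2 `^ p)%:E * ((1 + x) `^ (- (2 * p)))%:E))%E).
  apply: ge0_le_integral => //.
  - by move=> x _; rewrite lee_fin powR_ge0.
  - by apply/measurable_EFinP; apply: measurable_funTS; exact: continuous_measurable_fun.
  - apply/measurable_EFinP; apply: measurable_funTS; apply: measurable_funM => //.
    by apply: (measurableT_comp (measurable_powR _)); exact: measurable_funD.
  - move=> x; rewrite /= in_itv /= andbT => x0; rewrite -EFinM lee_fin.
    have x1 : 0 < 1 + x by lra.
    rewrite -mulrN powRrM powR_mulrn ?(ltW x1)//.
    have key : ((1 + x) ^+ 2) `^ p <= 2 `^ p * (1 + x ^+ 2) `^ p.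
      rewrite -(@powRM _ 2)//; last exact: ltW (c1 x).
      apply: ge0_ler_powR; rewrite ?nnegrE ?sqr_ge0 ?(ltW p0)//.
        by rewrite mulr_ge0// (ltW (c1 x)).
      rewrite -subr_ge0 [leRHS](_ : _ = (1 - x) ^+ 2) ?sqr_ge0//; ring.
    by rewrite !powRN ler_pdivlMr ?powR_gt0 ?exprn_gt0// ler_pdivrMl ?powR_gt0// mulrC.
rewrite ge0_integralZl//.
- by rewrite lte_mul_pinfty// lee_fin powR_ge0.
- apply/measurable_EFinP; apply: measurable_funTS.
  by apply: (measurableT_comp (measurable_powR _)); exact: measurable_funD.
- by move=> x _; rewrite lee_fin powR_ge0.
Qed.

End weight.

Section sobolev_bounds.
Context {R : realType} {d : nat} (i0 : 'I_d).
Local Notation vec := 'rV[R]_d.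
Local Notation mu := (lebesgue_rV R d).
Implicit Types (x xi : vec) (f : vec -> R) (g : vec -> R[i]).
Local Open Scope complex_scope.

Let d0 : (0 < d)%N. Proof. by case: d i0 => // -[]. Qed.
Let dR : 0 < d%:R :> R. Proof. by rewrite ltr0n. Qed.

(** Since [1 + |xi|^2] dominates each [1 + xi_i^2], the weight is at most
    the product of [d] one-dimensional weights of exponent [s / d > 1 / 2]. *)
Lemma L1_weight (s : R) : d%:R / 2 < s -> L1 mu (fun xi => (1 + dot xi xi) `^ (- s)).
Proof.
move=> ds; have s0 : 0 < s by rewrite (le_lt_trans _ ds)// divr_ge0.
have p2 : 2^-1 < s / d%:R by rewrite ltr_pdivlMr// mulrC.
have p0 : 0 < s / d%:R by rewrite divr_gt0.
have [|ip _] := @Rint_prod R d (fun i (z : R) => (1 + z ^+ 2) `^ (- (s / d%:R))).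
  by move=> i; exact: L1_weight1.
apply: L1_le ip _.
  apply: (measurableT_comp (measurable_powR _)); apply: measurable_funD => //.
  exact: measurable_dot.
move=> xi; rewrite ger0_norm ?powR_ge0//.
have -> : - s = - (s / d%:R) * d%:R by field; rewrite gt_eqF.
rewrite powRrM powR_mulrn ?powR_ge0// -[X in _ ^+ X]card_ord -prodr_const.
apply: ler_prod => i _; rewrite powR_ge0 /= !powRN.
have c1 (r : R) : 0 <= r -> 0 < 1 + r by move=> ?; lra.
rewrite lef_pV2 ?posrE ?powR_gt0 ?c1 ?sqr_ge0 ?dot_ge0//.
apply: ge0_ler_powR; rewrite ?nnegrE ?(ltW p0) ?(ltW (c1 _ _)) ?sqr_ge0 ?dot_ge0//.
by rewrite lerD2l coord_sqr_le_dot.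
Qed.

Definition normsqc g xi : R := complex.Re (g xi) ^+ 2 + complex.Im (g xi) ^+ 2.

Lemma normsqcE g xi : Normc.normc (g xi) ^+ 2 = normsqc g xi.
Proof. by rewrite /normsqc; case: (g xi) => a b /=; rewrite sqr_sqrtr// addr_ge0 ?sqr_ge0. Qed.

Lemma normsqc_ge0 g xi : 0 <= normsqc g xi.
Proof. by rewrite addr_ge0 ?sqr_ge0. Qed.

Lemma norm1c_ge0 g xi : 0 <= norm1c g xi.
Proof. by rewrite addr_ge0. Qed.

Lemma norm1c_sqr_le g xi : norm1c g xi ^+ 2 <= 2 * normsqc g xi.
Proof.
rewrite /norm1c /normsqc -(real_normK (num_real (complex.Re _))).
rewrite -(real_normK (num_real (complex.Im _))) -subr_ge0.
rewrite [leRHS](_ : _ = (`|complex.Re (g xi)| - `|complex.Im (g xi)|) ^+ 2) ?sqr_ge0//.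
by ring.
Qed.

(** Writing [w = (1 + |xi|^2)^s], the inequality
    [|g| <= (w |g|^2 / eta + eta / w)], up to the constants of [norm1c],
    replaces the Cauchy-Schwarz inequality: the integral of [w |g|^2] is at
    most [eta^2] and that of [1 / w] is finite. *)
Lemma sobolev_norm_lt (s : R) f (eta : R) : d%:R / 2 < s -> 0 < eta ->
  (sobolev_norm s f < eta%:E)%E ->
  exists g, [/\ is_fourier (fun x => (f x)%:C) g,
    L1 mu (fun xi => complex.Re (g xi)), L1 mu (fun xi => complex.Im (g xi)),
    L1 mu (fun xi => norm1c g xi ^+ 2) &
    \int[mu]_xi norm1c g xi <= eta * (1 + \int[mu]_xi (1 + dot xi xi) `^ (- s))].
Proof.
move=> ds eta0 /ereal_inf_lt[_ [g fg <-] Neta]; exists g.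
have s0 : 0 < s by rewrite (le_lt_trans _ ds)// divr_ge0.
have c1 xi : 1 <= 1 + dot xi xi by rewrite lerDl dot_ge0.
have c0 xi : 0 < 1 + dot xi xi by rewrite (lt_le_trans _ (c1 xi)).
have [tf tg _] := fg; have [m1 m2] := tempered_measurable i0 tg.
have mn : measurable_fun setT (normsqc g).
  by apply: measurable_funD; exact: measurable_funX.
have md : measurable_fun setT (fun xi : vec => 1 + dot xi xi).
  by apply: measurable_funD => //; exact: measurable_dot.
pose q xi := (1 + dot xi xi) `^ s * normsqc g xi.
have q0 xi : 0 <= q xi by rewrite mulr_ge0 ?powR_ge0 ?normsqc_ge0.
have mq : measurable_fun setT q.
  by apply: measurable_funM => //; exact: (measurableT_comp (measurable_powR _)).
have Nq : (\int[mu]_xi (q xi)%:E <= (eta ^+ 2)%:E)%E.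
  have <- : (Lnorm mu 2%:E (fun xi =>
      ((1 + dot xi xi) `^ (s / 2) * Normc.normc (g xi))%:E) `^ 2 =
    \int[mu]_xi (q xi)%:E)%E.
    rewrite poweR_Lnorm ?pnatr_eq0//; apply: eq_integral => xi _.
    rewrite abse_EFin poweR_EFin powR_mulrn// real_normK ?num_real//.
    rewrite exprMn normsqcE -[X in X * _]powR_mulrn ?powR_ge0// -powRrM.
    by rewrite divfK.
  move: Neta; set N := Lnorm _ _ _ => Neta.
  have N0 : (0 <= N)%E by exact: Lnorm_ge0.
  have Nf : N \is a fin_num by rewrite ge0_fin_numE// (lt_le_trans Neta)// leey.
  move: Neta N0; rewrite -(fineK Nf) poweR_EFin lte_fin !lee_fin => h1 h2.
  by rewrite powR_mulrn// ler_pXn2r ?nnegrE ?(ltW eta0)// ltW.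
have iq : L1 mu q by apply/ge0_L1P => //; exact: le_lt_trans Nq (ltry _).
have Rq : \int[mu]_xi q xi <= eta ^+ 2.
  by rewrite -lee_fin EFin_Rint.
have iW := L1_weight ds.
have nq xi : normsqc g xi <= q xi.
  rewrite ler_peMl ?normsqc_ge0//.
  by have := ler_powR (c1 xi) (ltW s0); rewrite powRr0.
have key xi : norm1c g xi <= eta^-1 * q xi + eta * (1 + dot xi xi) `^ (- s).
  have h := norm1c_sqr_le g xi; have h0 := norm1c_ge0 g xi.
  pose w := (1 + dot xi xi) `^ s.
  have w0 : 0 < w by rewrite powR_gt0.
  rewrite powRN -/w /q -/w.
  have -> : eta^-1 * (w * normsqc g xi) + eta * w^-1 = (w ^+ 2 * normsqc g xi + eta ^+ 2) / (eta * w).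
    by field; rewrite !gt_eqF.
  rewrite ler_pdivlMr ?mulr_gt0//.
  have h3 : w ^+ 2 * norm1c g xi ^+ 2 <= w ^+ 2 * (2 * normsqc g xi).
    by rewrite ler_wpM2l ?sqr_ge0.
  (* Expanding this square is the arithmetic-geometric inequality behind the
     bound. *)
  have h4 := sqr_ge0 (eta - w * norm1c g xi).
  have h5 := sqr_ge0 (eta).
  have h6 : (eta - w * norm1c g xi) ^+ 2 = eta ^+ 2 - 2 * (norm1c g xi * (eta * w)) +
    w ^+ 2 * norm1c g xi ^+ 2 by ring.
  rewrite h6 in h4; lra.
have msum : measurable_fun setT (norm1c g).
  by apply: measurable_funD; apply: measurableT_comp.
have isum : L1 mu (norm1c g).
  apply: (L1_le msum (L1D (L1Z eta^-1 iq) (L1Z eta iW))) => xi.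
  by rewrite ger0_norm ?norm1c_ge0.
split=> //.
- by apply: (L1_le m1 isum) => xi; rewrite lerDl.
- by apply: (L1_le m2 isum) => xi; rewrite lerDr.
- apply: (L1_le _ (L1Z 2 iq)) => [|xi]; first exact: measurable_funX.
  by rewrite ger0_norm ?sqr_ge0// (le_trans (norm1c_sqr_le _ _))// ler_pM2l.
apply: (@le_trans _ _ (\int[mu]_xi (eta^-1 * q xi + eta * (1 + dot xi xi) `^ (- s)))).
  by apply: le_Rintegral => //; apply: L1D; exact: L1Z.
rewrite RintegralD//; [|exact: L1Z|exact: L1Z].
rewrite !RintegralZl// mulrDr mulr1 lerD2r ler_pdivrMl//.
Qed.

End sobolev_bounds.

(** * Schur test for the Gaussian kernel *)

Section trig_lipschitz.
Context {R : realType}.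

Lemma lipschitz_of_derive (f df : R -> R) (K : R) :
  (forall x : R, is_derive x 1 f (df x)) -> (forall x, `|df x| <= K) ->
  forall a b, `|f a - f b| <= K * `|a - b|.
Proof.
move=> fd dK a b; wlog ab : a b / a <= b.
  move=> H; have [/H//|/ltW/H] := leP a b.
  by rewrite distrC [X in _ <= K * X]distrC.
have cf : {within `[a, b], continuous f}.
  apply: continuous_subspaceT => x; apply: differentiable_continuous.
  by apply/derivable1_diffP; case: (fd x).
have [c _ E] := MVT_segment ab (fun x _ => fd x) cf.
by rewrite distrC E normrM [X in _ * X]distrC ler_wpM2r.
Qed.

Lemma cos_lipschitz (a b : R) : `|cos a - cos b| <= `|a - b|.
Proof.
rewrite -[leRHS]mul1r; apply: (@lipschitz_of_derive cos (fun x => - sin x)) => x.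
by rewrite normrN sin_max.
Qed.

Lemma sin_lipschitz (a b : R) : `|sin a - sin b| <= `|a - b|.
Proof.
rewrite -[leRHS]mul1r; apply: (@lipschitz_of_derive sin cos) => x.
exact: cos_max.
Qed.

End trig_lipschitz.

Section Rint_fubini.
Context {d1 d2} {X : measurableType d1} {Y : measurableType d2} {R : realType}.
Variables (m1 : {sigma_finite_measure set X -> \bar R}).
Variables (m2 : {sigma_finite_measure set Y -> \bar R}).
Variable F : X * Y -> R.
Hypothesis iF : L1 (m1 \x m2)%E F.

Lemma L1_Rint1 : (forall x, L1 m2 (fun y => F (x, y))) ->
  L1 m1 (fun x => \int[m2]_y F (x, y)).
Proof.
move=> i2; have := integrable_fubini_F iF; rewrite /fubini_F.
rewrite (_ : (fun x => _) = EFin \o (fun x => \int[m2]_y F (x, y)))//.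
by apply/funext => x /=; rewrite EFin_Rint.
Qed.

Lemma measurable_Rint2 : (forall y, L1 m1 (fun x => F (x, y))) ->
  measurable_fun setT (fun y => \int[m1]_x F (x, y)).
Proof.
move=> i1; apply/measurable_EFinP; have := measurable_fubini_G iF.
by congr measurable_fun; apply/funext => y /=; rewrite EFin_Rint.
Qed.

Lemma Rint_Fubini : (forall x, L1 m2 (fun y => F (x, y))) ->
  (forall y, L1 m1 (fun x => F (x, y))) ->
  \int[m1]_x \int[m2]_y F (x, y) = \int[m2]_y \int[m1]_x F (x, y).
Proof.
move=> i2 i1; rewrite /Rintegral.
have := Fubini iF => /= H.
rewrite (eq_integral (fun x => (\int[m2]_y (F (x, y))%:E)%E)); last first.
  by move=> x _; rewrite -EFin_Rint.
rewrite H; congr fine; apply: eq_integral => y _.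
by rewrite -EFin_Rint.
Qed.

End Rint_fubini.

Section decay.
Context {R : realType} {d : nat} (i0 : 'I_d).
Local Notation vec := 'rV[R]_d.
Local Notation mu := (lebesgue_rV R d).
Implicit Types (x y v b c xi eta : vec).
Local Open Scope complex_scope.

Lemma measurable_pair_coord (i : 'I_d) :
  measurable_fun setT (fun z : vec * vec => z.1 ord0 i) /\
  measurable_fun setT (fun z : vec * vec => z.2 ord0 i).
Proof.
split; first exact: (measurableT_comp (measurable_rV_coord i) measurable_fst).
exact: (measurableT_comp (measurable_rV_coord i) measurable_snd).
Qed.

Lemma measurable_pair_dot : measurable_fun setT (fun z : vec * vec => dot z.1 z.2).
Proof.
apply: measurable_sum => i; have [? ?] := measurable_pair_coord i.
exact: measurable_funM.
Qed.

Lemma measurable_pair_gauss (a : R) :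
  measurable_fun setT (fun z : vec * vec => gauss a z.1 z.2).
Proof.
apply: measurableT_comp => //; apply: measurableT_comp => //.
apply: measurable_funM => //.
rewrite (_ : (fun z => _) = fun z : vec * vec => \sum_i (z.2 ord0 i - z.1 ord0 i) ^+ 2).
  apply: measurable_sum => i; have [? ?] := measurable_pair_coord i.
  by apply: measurable_funX; exact: measurable_funB.
by apply/funext => z; rewrite sqdistE.
Qed.

Lemma gaussC (a : R) x y : gauss a x y = gauss a y x.
Proof.
rewrite /gauss !sqdistE; congr expR; congr (- (_ * _)).
by apply: eq_bigr => i _; rewrite -sqrrN opprB.
Qed.

Section kernel_bound.
Variables (G : vec -> R) (s : R).
Hypotheses (s0 : 0 < s) (G0 : forall xi, 0 <= G xi)
  (iG : L1 mu G) (iG2 : L1 mu (fun xi => G xi ^+ 2)).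

Let a : R := (s ^+ 2 *+ 2)^-1.
Let a0 : 0 < a. Proof. by rewrite invr_gt0 mulrn_wgt0// exprn_gt0. Qed.
Let K := normal_peak s ^+ d.
Let K0 : 0 <= K. Proof. by rewrite exprn_ge0// normal_peak_ge0. Qed.

Let normal_rVE c x : normal_rV c s x = K * gauss a c x. Proof. exact: normal_rV_gauss. Qed.

Let normal_rVC c x : normal_rV c s x = normal_rV x s c. Proof. by rewrite !normal_rVE gaussC. Qed.

Let L1_mul_normal_rV (h : vec -> R) c : L1 mu h -> L1 mu (fun x => h x * normal_rV c s x).
Proof.
move=> ih; apply: (L1_le _ (L1Z K (L1_norm ih))) => [|x].
  apply: measurable_funM; first exact: L1_measurable ih.
  exact: L1_measurable (L1_normal_rV c s).
rewrite normrM mulrC ler_wpM2r// ger0_norm ?normal_rV_ge0// normal_rVE ler_piMr//.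
by rewrite gauss_le1// ltW.
Qed.

Let mT : measurable_fun setT (fun z : vec * vec => G z.1 ^+ 2 * normal_rV z.1 s z.2).
Proof.
rewrite (_ : (fun z => _) = fun z : vec * vec => G z.1 ^+ 2 * (K * gauss a z.1 z.2)).
  apply: measurable_funM.
    exact: (measurableT_comp (L1_measurable iG2) measurable_fst).
  by apply: measurable_funM => //; exact: measurable_pair_gauss.
by apply/funext => z; rewrite normal_rVE.
Qed.

Let iT : L1 (mu \x mu)%E (fun z : vec * vec => G z.1 ^+ 2 * normal_rV z.1 s z.2).
Proof.
apply/integrable12ltyP; first exact/measurable_EFinP.
rewrite (eq_integral (fun x => (G x ^+ 2)%:E)); last first.
  move=> x _; rewrite /= (eq_integral (fun y => ((G x ^+ 2)%:E * (normal_rV x s y)%:E)%E)).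
    rewrite integralZl//; last exact: L1_normal_rV.
    by rewrite -EFin_Rint ?Rint_normal_rV ?mule1//; exact: L1_normal_rV.
  by move=> y _; rewrite ger0_norm ?mulr_ge0 ?sqr_ge0 ?normal_rV_ge0// EFinM.
by rewrite -EFin_Rint// ltry.
Qed.

Let mT' : measurable_fun setT (fun z : vec * vec => G z.2 ^+ 2 * normal_rV z.1 s z.2).
Proof.
rewrite (_ : (fun z => _) = fun z : vec * vec => G z.2 ^+ 2 * (K * gauss a z.1 z.2)).
  apply: measurable_funM.
    exact: (measurableT_comp (L1_measurable iG2) measurable_snd).
  by apply: measurable_funM => //; exact: measurable_pair_gauss.
by apply/funext => z; rewrite normal_rVE.
Qed.

Let iT' : L1 (mu \x mu)%E (fun z : vec * vec => G z.2 ^+ 2 * normal_rV z.1 s z.2).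
Proof.
apply/integrable21ltyP; first exact/measurable_EFinP.
rewrite (eq_integral (fun x => (G x ^+ 2)%:E)); last first.
  move=> x _; rewrite /= (eq_integral (fun y => ((G x ^+ 2)%:E * (normal_rV x s y)%:E)%E)).
    rewrite integralZl//; last exact: L1_normal_rV.
    by rewrite -EFin_Rint ?Rint_normal_rV ?mule1//; exact: L1_normal_rV.
  by move=> y _; rewrite ger0_norm ?mulr_ge0 ?sqr_ge0 ?normal_rV_ge0// normal_rVC EFinM.
by rewrite -EFin_Rint// ltry.
Qed.

Lemma L1_kernel c : L1 mu (fun x => G x * normal_rV c s x).
Proof. exact: L1_mul_normal_rV. Qed.

(** The Schur test: [G(xi) G(eta) <= (G(xi)^2 + G(eta)^2) / 2] and the kernel
    is symmetric with total mass [1] in each variable. *)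
Lemma kernel_quadratic_le (I : vec -> R) : measurable_fun setT I ->
  (forall xi, `|I xi| <= G xi * \int[mu]_eta (G eta * normal_rV xi s eta)) ->
  \int[mu]_xi I xi <= \int[mu]_xi (G xi ^+ 2).
Proof.
move=> mI hI.
pose T z := G z.1 ^+ 2 * normal_rV z.1 s z.2.
pose T' z := G z.2 ^+ 2 * normal_rV z.1 s z.2.
have s1 x : L1 mu (fun y => T (x, y)) by exact: (L1Z (G x ^+ 2) (L1_normal_rV x s)).
have s2 y : L1 mu (fun x => T (x, y)).
  by apply: eq_L1 (L1_mul_normal_rV y iG2) => x; rewrite /T /= normal_rVC.
have s1' x : L1 mu (fun y => T' (x, y)) by exact: (L1_mul_normal_rV x iG2).
have s2' y : L1 mu (fun x => T' (x, y)).
  by apply: eq_L1 (L1Z (G y ^+ 2) (L1_normal_rV y s)) => x; rewrite /T' /= normal_rVC.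
have e1 : \int[mu]_x \int[mu]_y T (x, y) = \int[mu]_xi (G xi ^+ 2).
  by apply: eq_Rint => x; rewrite /T /= RintegralZl ?Rint_normal_rV ?mulr1//; exact: L1_normal_rV.
have e2 : \int[mu]_x \int[mu]_y T' (x, y) = \int[mu]_xi (G xi ^+ 2).
  rewrite (Rint_Fubini iT' s1' s2'); apply: eq_Rint => y.
  rewrite (@eq_Rint _ _ _ mu _ (fun x => G y ^+ 2 * normal_rV y s x)); last first.
    by move=> x; rewrite /T' /= normal_rVC.
  by rewrite RintegralZl ?Rint_normal_rV ?mulr1//; exact: L1_normal_rV.
have o1 := L1_Rint1 iT s1; have o2 := L1_Rint1 iT' s1'.
(* [T] and [T'] are the two halves of the arithmetic-geometric bound, each of
   integral equal to that of [G^2]. *)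
have hT x : `|I x| <= 2^-1 * \int[mu]_y T (x, y) + 2^-1 * \int[mu]_y T' (x, y).
  apply: (le_trans (hI x)).
  have j1 := L1Z 2^-1 (s1 x); have j2 := L1Z 2^-1 (s1' x).
  have j3 := L1_mul_normal_rV x iG.
  rewrite -(RintegralZl (G x) measurableT j3).
  rewrite -(RintegralZl 2^-1 measurableT (s1 x)) -(RintegralZl 2^-1 measurableT (s1' x)).
  rewrite -(RintegralD measurableT j1 j2).
  apply: le_Rintegral => //.
  - exact: L1Z.
  - exact: L1D.
  - move=> y _; rewrite /T /T' /= mulrA !mulrA -mulrDl ler_wpM2r ?normal_rV_ge0//.
    rewrite -subr_ge0 [leRHS](_ : _ = 2^-1 * (G x - G y) ^+ 2); last by field.
    by rewrite mulr_ge0 ?sqr_ge0.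
have o12 := L1D (L1Z 2^-1 o1) (L1Z 2^-1 o2).
apply: (@le_trans _ _ (\int[mu]_x (2^-1 * \int[mu]_y T (x, y) + 2^-1 * \int[mu]_y T' (x, y)))).
  apply: le_Rintegral => //; first exact: L1_le mI o12 hT.
  by move=> x _; exact: le_trans (ler_norm _) (hT x).
rewrite (RintegralD measurableT (L1Z 2^-1 o1) (L1Z 2^-1 o2)).
rewrite (RintegralZl 2^-1 measurableT o1) (RintegralZl 2^-1 measurableT o2) e1 e2 -mulrDl -[leRHS]mul1r (_ : 2^-1 + 2^-1 = 1)//.
by field.
Qed.

End kernel_bound.

End decay.

(** * Parseval inequality with a Gaussian weight *)

Section decay_at_infinity.
Context {R : realType} {d : nat} (i0 : 'I_d).
Local Notation vec := 'rV[R]_d.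
Local Notation mu := (lebesgue_rV R d).
Implicit Types (x y v b c xi eta : vec).
Local Open Scope complex_scope.
Variables (f : vec -> R) (g : vec -> R[i]).
Hypotheses (cf : continuous f) (fg : is_fourier (fun x => (f x)%:C) g)
  (g1 : L1 mu (fun xi => complex.Re (g xi)))
  (g2 : L1 mu (fun xi => complex.Im (g xi)))
  (gg : L1 mu (fun xi => norm1c g xi ^+ 2)).

Let G := norm1c g.
Let iG : L1 mu G. Proof. exact: L1_norm1c. Qed.
Let M : R := inv_const R d * \int[mu]_xi G xi.
Let fM x : `|f x| <= M. Proof. exact: (fourier_sup_le i0 (cf (x := x)) fg g1 g2). Qed.
Let fE x : f x = inv_const R d * \int[mu]_xi inv_integrand g x xi.
Proof. exact: (fourier_inversion i0 (cf (x := x)) fg g1 g2). Qed.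
Let tf : tempered (fun x => (f x)%:C). Proof. by case: fg. Qed.
Let mf : measurable_fun setT f.
Proof. by have [] := tempered_measurable i0 tf. Qed.
Let mg1 := L1_measurable g1.
Let mg2 := L1_measurable g2.

(** One factor [f(x)] is replaced by the inversion formula and the integrals
    are exchanged.  The inner integral is then the Fourier transform of [f]
    times a Gaussian, that is, by the pairing, [g] averaged against a normal
    density, and the resulting quadratic form in [g] is bounded by the Schur
    test.  The bound does not depend on the width [s]. *)
Lemma parseval_gauss (s : R) : 0 < s ->
  L1 mu (fun x => f x ^+ 2 * gauss (s ^+ 2 / 2) 0 x) /\
  \int[mu]_x (f x ^+ 2 * gauss (s ^+ 2 / 2) 0 x) <= inv_const R d * \int[mu]_xi (G xi ^+ 2).
Proof.
move=> s0; pose w := gauss (s ^+ 2 / 2) (0 : vec).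
have a0 : 0 < s ^+ 2 / 2 by rewrite divr_gt0// exprn_gt0.
have ifw : L1 mu (fun x => f x * w x) by exact: tempered_L1_gauss.
have mw : measurable_fun setT w by exact: measurable_gauss.
have iffw : L1 mu (fun x => f x ^+ 2 * w x).
  apply: (L1_le _ (L1Z M (L1_norm ifw))) => [|x].
    by apply: measurable_funM => //; exact: measurable_funX.
  by rewrite expr2 -mulrA normrM ler_wpM2r.
split=> //.
pose F (z : vec * vec) := f z.1 * w z.1 * inv_integrand g z.1 z.2.
have mF : measurable_fun setT F.
  have mcos : measurable_fun setT (fun z : vec * vec => cos (dot z.1 z.2)).
    apply: measurableT_comp; last exact: measurable_pair_dot.
    by apply: continuous_measurable_fun; exact: continuous_cos.
  have msin : measurable_fun setT (fun z : vec * vec => sin (dot z.1 z.2)).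
    apply: measurableT_comp; last exact: measurable_pair_dot.
    by apply: continuous_measurable_fun; exact: continuous_sin.
  apply: measurable_funM.
    by apply: measurable_funM; [exact: (measurableT_comp mf measurable_fst)|
      exact: (measurableT_comp mw measurable_fst)].
  by apply: measurable_funB; apply: measurable_funM => //;
    [exact: (measurableT_comp mg1 measurable_snd)|
     exact: (measurableT_comp mg2 measurable_snd)].
have iF : L1 (mu \x mu)%E F.
  apply: (L1_le mF (L1_tensor (L1_norm ifw) iG)) => z.
  by rewrite normrM ler_wpM2l// inv_integrand_le.
have ir x : L1 mu (inv_integrand g x).
  by apply: (L1_le _ iG) => [|xi]; [exact: measurable_inv_integrand|exact: inv_integrand_le].
have F1 x : L1 mu (fun xi => F (x, xi)) by exact: (L1Z (f x * w x) (ir x)).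
have icos xi : L1 mu (fun x => f x * w x * cos (dot x xi)).
  apply: (L1_le _ (L1_norm ifw)) => [|x].
    apply: measurable_funM; first exact: measurable_funM.
    rewrite (_ : (fun x => _) = fun x => cos (dot xi x)); first exact: measurable_cosl.
    by apply/funext => x; rewrite dotC.
  by rewrite normrM ler_piMr// cos_max.
have isin xi : L1 mu (fun x => f x * w x * sin (dot x xi)).
  apply: (L1_le _ (L1_norm ifw)) => [|x].
    apply: measurable_funM; first exact: measurable_funM.
    rewrite (_ : (fun x => _) = fun x => sin (dot xi x)); first exact: measurable_sinl.
    by apply/funext => x; rewrite dotC.
  by rewrite normrM ler_piMr// sin_max.
have F2e xi x : F (x, xi) = complex.Re (g xi) * (f x * w x * cos (dot x xi)) -
   complex.Im (g xi) * (f x * w x * sin (dot x xi)) by rewrite /F /inv_integrand /=; ring.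
have F2 xi : L1 mu (fun x => F (x, xi)).
  by apply: eq_L1 (L1B (L1Z (complex.Re (g xi)) (icos xi)) (L1Z (complex.Im (g xi)) (isin xi))) => x.
have mker xi := measurable_funM (L1_measurable iG) (L1_measurable (L1_normal_rV xi s)).
have kb xi (h : vec -> R) : measurable_fun setT h -> (forall eta, `|h eta| <= G eta) ->
    `|\int[mu]_eta (h eta * normal_rV xi s eta)| <= \int[mu]_eta (G eta * normal_rV xi s eta).
  move=> mh hG.
  have ik := L1_kernel s0 iG xi.
  have le1 eta : `|h eta * normal_rV xi s eta| <= G eta * normal_rV xi s eta.
    by rewrite normrM [`|normal_rV _ _ _|]ger0_norm ?normal_rV_ge0// ler_wpM2r// normal_rV_ge0.
  have ihk : L1 mu (fun eta => h eta * normal_rV xi s eta).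
    apply: (L1_le _ ik le1).
    exact: measurable_funM mh (L1_measurable (L1_normal_rV xi s)).
  rewrite (le_trans (le_normr_Rintegral measurableT ihk))// le_Rintegral//.
  exact: L1_norm.
(* The pairing with a packet centred at the frequency [xi] and modulated by
   [0]. *)
have inner xi : `|\int[mu]_x F (x, xi)| <= G xi * \int[mu]_eta (G eta * normal_rV xi s eta).
  rewrite (eq_Rint mu (F2e xi)).
  rewrite (RintegralB measurableT (L1Z (complex.Re (g xi)) (icos xi)) (L1Z (complex.Im (g xi)) (isin xi))).
  rewrite (RintegralZl _ measurableT (icos xi)) (RintegralZl _ measurableT (isin xi)).
  have [p1 p2] := fourier_pairing i0 0 xi s0 fg.
  have dotN x : dot (0 - x) xi = - dot x xi.
    by rewrite sub0r /dot -sumrN; apply: eq_bigr => i _; rewrite mxE mulNr.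
  have e1 : \int[mu]_x (f x * w x * cos (dot x xi)) = \int[mu]_eta (inv_integrand g 0 eta * normal_rV xi s eta).
    by rewrite -p1; apply: eq_Rint => x; rewrite dotN cosN.
  have e2 : \int[mu]_x (f x * w x * sin (dot x xi)) = - \int[mu]_eta
     ((complex.Re (g eta) * sin (dot 0 eta) + complex.Im (g eta) * cos (dot 0 eta)) * normal_rV xi s eta).
    rewrite -p2 -mulN1r -RintegralZl//; last first.
      apply: eq_L1 (L1Z (-1) (isin xi)) => x; rewrite dotN sinN /w; ring.
    by apply: eq_Rint => x; rewrite dotN sinN /w; ring.
  rewrite e1 e2 (le_trans (ler_normB _ _))//.
  rewrite !normrM normrN mulrDl lerD// ler_wpM2l//; apply: kb.
  - exact: measurable_inv_integrand.
  - by move=> eta; exact: inv_integrand_le.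
  - by apply: measurable_funD; apply: measurable_funM => //;
      [exact: measurable_sinl|exact: measurable_cosl].
  - move=> eta; rewrite (le_trans (ler_normD _ _))// !normrM lerD// ler_piMr//.
      exact: sin_max.
    exact: cos_max.
rewrite (@eq_Rint _ _ _ mu _ (fun x => inv_const R d * \int[mu]_xi F (x, xi))); last first.
  move=> x; rewrite (RintegralZl (f x * w x) measurableT (ir x)).
  by rewrite mulrCA -fE /w expr2; ring.
rewrite (RintegralZl _ measurableT (L1_Rint1 iF F1)).
rewrite ler_wpM2l ?(ltW (inv_const_gt0 _ _))// (Rint_Fubini iF F1 F2).
by apply: (kernel_quadratic_le s0) => //; [exact: norm1c_ge0|exact: measurable_Rint2 iF F2].
Qed.

End decay_at_infinity.

(** * Decay at infinity *)

Section vanishing.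
Context {R : realType} {d : nat} (i0 : 'I_d).
Local Notation vec := 'rV[R]_d.
Local Notation mu := (lebesgue_rV R d).
Implicit Types (x y v b c xi eta : vec).
Local Open Scope complex_scope.
Variables (f : vec -> R) (g : vec -> R[i]).
Hypotheses (cf : continuous f) (fg : is_fourier (fun x => (f x)%:C) g)
  (g1 : L1 mu (fun xi => complex.Re (g xi)))
  (g2 : L1 mu (fun xi => complex.Im (g xi)))
  (gg : L1 mu (fun xi => norm1c g xi ^+ 2)).

Let G := norm1c g.
Let iG : L1 mu G. Proof. exact: L1_norm1c. Qed.
Let fE x : f x = inv_const R d * \int[mu]_xi inv_integrand g x xi.
Proof. exact: (fourier_inversion i0 (cf (x := x)) fg g1 g2). Qed.
Let tf : tempered (fun x => (f x)%:C). Proof. by case: fg. Qed.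
Let mf : measurable_fun setT f.
Proof. by have [] := tempered_measurable i0 tf. Qed.
Let mg1 := L1_measurable g1.
Let mg2 := L1_measurable g2.

Let wn (n : nat) : vec -> R := gauss ((n.+1%:R^-1) ^+ 2 / 2) 0.

(* The weight is [exp (- |x|^2 / (2 (n + 1)^2))]; the first form is that of
   [parseval_gauss], the second that of [cvg_gauss1]. *)
Let wnE n x : wn n x = gauss (n.+1%:R ^+ 2 *+ 2)^-1 0 x.
Proof.
have n0 : n.+1%:R != 0 :> R by rewrite pnatr_eq0.
have aE : (n.+1%:R^-1 : R) ^+ 2 / 2 = (n.+1%:R ^+ 2 *+ 2)^-1 by field.
by rewrite /wn aE.
Qed.

Let wn_cvg x : wn n x @[n --> \oo] --> (1 : R).
Proof. by under eq_fun do rewrite wnE; exact: cvg_gauss1. Qed.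

Let wn_le1 n x : wn n x <= 1.
Proof. by rewrite gauss_le1// divr_ge0// sqr_ge0. Qed.

(** The Gaussian weights increase to [1], and the weighted integrals are
    bounded uniformly. *)
Lemma L1_sqr : L1 mu (fun x => f x ^+ 2).
Proof.
apply/ge0_L1P => [|x|]; [exact: measurable_funX|exact: sqr_ge0|].
have n0 n : 0 < n.+1%:R^-1 :> R by rewrite invr_gt0.
have mon x : setT x -> {homo (fun n => (f x ^+ 2 * wn n x)%:E) : m n / (m <= n)%N >-> (m <= n)%E}.
  move=> _ m n mn; rewrite lee_fin ler_wpM2l ?sqr_ge0// ler_expR lerN2 ler_wpM2r ?dot_ge0//.
  rewrite ler_pM2r ?invr_gt0// ler_pXn2r ?nnegrE ?(ltW (n0 _))//.
  by rewrite lef_pV2 ?posrE// ler_nat ltnS.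
have lim x : limn (fun n => (f x ^+ 2 * wn n x)%:E) = (f x ^+ 2)%:E.
  apply/cvg_lim => //; apply: cvg_EFin; first exact: nearW.
  rewrite -[X in _ --> X]mulr1; apply: cvgMr; exact: wn_cvg.
have mfw n : measurable_fun setT (fun x => (f x ^+ 2 * wn n x)%:E).
  apply/measurable_EFinP; apply: measurable_funM; first exact: measurable_funX.
  exact: measurable_gauss.
have fw0 n x : setT x -> (0%R <= (f x ^+ 2 * wn n x)%:E)%E.
  by move=> _; rewrite lee_fin mulr_ge0 ?sqr_ge0// gauss_ge0.
have H := @cvg_monotone_convergence _ vec R mu setT measurableT
  (fun n x => (f x ^+ 2 * wn n x)%:E) mfw fw0 mon.
have : (\int[mu]_x (f x ^+ 2)%:E <= (inv_const R d * \int[mu]_xi (G xi ^+ 2))%:E)%E.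
  rewrite (eq_integral _ _ (fun x _ => esym (lim x))).
  rewrite -(cvg_lim _ H)//; apply: lime_le.
    by apply/cvg_ex; eexists; exact: H.
  apply: nearW => n; have [h1 h2] := parseval_gauss i0 cf fg g1 g2 gg (n0 n).
  by rewrite -EFin_Rint.
by move=> /le_lt_trans; apply; rewrite ltry.
Qed.

Lemma inv_integrand_sub_le x y xi :
  `|inv_integrand g x xi - inv_integrand g y xi| <= G xi * Num.min 2 (`|x - y| * \sum_i `|xi ord0 i|).
Proof.
have dotB : `|dot x xi - dot y xi| <= `|x - y| * \sum_i `|xi ord0 i|.
  rewrite mulr_sumr /dot -sumrB (le_trans (ler_norm_sum _ _ _))// ler_sum// => i _.
  rewrite -mulrBl normrM ler_wpM2r//.
  by have := normr_coord_le (x - y) i; rewrite !mxE.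
set D := _ * \sum_i _ in dotB *.
have lem (u v : R) : `|u| <= 1 -> `|v| <= 1 -> `|u - v| <= D -> `|u - v| <= Num.min 2 D.
  move=> u1 v1 uvD; rewrite le_min uvD andbT (le_trans (ler_normB _ _))//; lra.
have hc := lem _ _ (cos_max _) (cos_max _) (le_trans (cos_lipschitz _ _) dotB).
have hs := lem _ _ (sin_max _) (sin_max _) (le_trans (sin_lipschitz _ _) dotB).
rewrite (_ : _ - _ = complex.Re (g xi) * (cos (dot x xi) - cos (dot y xi)) -
   complex.Im (g xi) * (sin (dot x xi) - sin (dot y xi))); last by rewrite /inv_integrand; ring.
rewrite (le_trans (ler_normB _ _))// !normrM mulrDl lerD// ler_wpM2l//.
Qed.

(** The difference of two plane waves is at most [2], and at most the
    distance of the points times the size of the frequency; dominated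
    convergence makes the integral of the minimum against [|g|] small. *)
Lemma fourier_unif_continuous (e : R) : 0 < e ->
  exists2 r, 0 < r & forall x y, `|x - y| <= r -> `|f x - f y| <= e.
Proof.
move=> e0.
pose S xi : R := \sum_i `|xi ord0 i|.
have S0 xi : 0 <= S xi by exact: sumr_ge0.
have mS : measurable_fun setT S.
  apply: measurable_sum => i; apply: measurableT_comp => //.
  exact: measurable_rV_coord.
pose phi n xi : R := G xi * Num.min 2 (n.+1%:R^-1 * S xi).
have phi_m n : measurable_fun setT (phi n).
  apply: measurable_funM; first exact: L1_measurable iG.
  by apply: measurable_minr => //; exact: measurable_funM.
have min0 n xi : 0 <= Num.min 2 (n.+1%:R^-1 * S xi).
  by rewrite le_min ler0n mulr_ge0.
have phi_le n xi : `|phi n xi| <= 2 * G xi.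
  rewrite ger0_norm ?mulr_ge0 ?norm1c_ge0// /phi [leLHS]mulrC ler_wpM2r ?norm1c_ge0//.
  by rewrite ge_min lexx.
have phi_cvg xi : phi n xi @[n --> \oo] --> (0 : R).
  apply: (@squeeze_cvgr _ _ _ _ (cst 0) (fun n => G xi * S xi * n.+1%:R^-1)).
  - apply: nearW => n; rewrite mulr_ge0 ?norm1c_ge0//= -mulrA ler_wpM2l ?norm1c_ge0//.
    by rewrite ge_min [_ * S _]mulrC lexx orbT.
  - exact: cvg_cst.
  - by rewrite -[X in _ --> X](mulr0 (G xi * S xi)); apply: cvgMr; exact: cvg_harmonic.
have iphi n : L1 mu (phi n) by exact: L1_le (phi_m n) (L1Z 2 iG) (phi_le n).
have := Rint_cvg_dominated phi_m phi_cvg (L1Z 2 iG) phi_le.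
rewrite Rintegral_cst//= mul0r => /cvgr0_norm_le.
have c0 := inv_const_gt0 R d.
move=> /(_ (e / inv_const R d) (divr_gt0 e0 c0)) [n _ /(_ n (leqnn n))] /= hn.
exists n.+1%:R^-1 => [|x y xy]; first by rewrite invr_gt0.
have ir z : L1 mu (inv_integrand g z).
  by apply: (L1_le _ iG) => [|xi]; [exact: measurable_inv_integrand|exact: inv_integrand_le].
rewrite !fE -mulrBr -(RintegralB measurableT (ir x) (ir y)) normrM [`|inv_const R d|](ger0_norm (ltW c0)).
rewrite mulrC -ler_pdivlMr// (le_trans _ hn)//.
have irB := L1B (ir x) (ir y).
rewrite (le_trans (le_normr_Rintegral measurableT irB))//.
rewrite (le_trans _ (ler_norm _))// le_Rintegral//; first exact: L1_norm.
move=> xi _; rewrite (le_trans (inv_integrand_sub_le x y xi))// ler_wpM2l ?norm1c_ge0//.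
by rewrite le_min !ge_min lexx /= (ler_wpM2r (S0 xi) xy) orbT.
Qed.

Lemma lebesgue_cube x (r : R) : 0 <= r ->
  measurable [set y : vec | forall i, `|y ord0 i - x ord0 i| <= r] /\
  mu [set y : vec | forall i, `|y ord0 i - x ord0 i| <= r] = ((2 * r) ^+ d)%:E.
Proof.
move=> r0; pose A (i : 'I_d) : set R := `[x ord0 i - r, x ord0 i + r]%classic.
have AE : [set y : vec | forall i, `|y ord0 i - x ord0 i| <= r] =
    [set y | forall i, A i (y ord0 i)].
  by apply/seteqP; split=> y /= h i; have := h i; rewrite /A /= in_itv /= ler_distl.
have BE : [set y : vec | forall i, A i (y ord0 i)] = \big[setI/setT]_(i < d)
    ((fun y : vec => y ord0 i : measurableTypeR R) @^-1` A i).
  apply/seteqP; split=> y /=; rewrite -bigcap_seq => h i.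
    by move=> _; exact: h.
  by apply: (h i); rewrite /= mem_index_enum.
have mB : measurable (\big[setI/setT]_(i < d)
    ((fun y : vec => y ord0 i : measurableTypeR R) @^-1` A i)).
  apply: bigsetI_measurable => i _; rewrite -[X in measurable X]setTI.
  by apply: measurable_rV_coord => //; exact: measurable_itv.
split; first by rewrite AE -BE in mB *.
rewrite AE.
rewrite lebesgue_rV_box; last by move=> i; exact: measurable_itv.
rewrite (eq_bigr (fun=> (2 * r)%:E)).
  by rewrite prodEFin prodr_const card_ord.
move=> i _; rewrite lebesgue_measure_itv /= lte_fin.
case: ltP => h; first by rewrite -EFinB; congr _%:E; ring.
have -> : r = 0 by apply/eqP; rewrite eq_le r0 andbT; move: h; lra.
by rewrite mulr0.
Qed.

(** If [|f x| > e] then, by uniform continuity, [|f| >= e / 2] on a cube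
    around [x] of fixed size.  Far away this contributes a fixed amount to the
    integral of [f^2 (1 - wide Gaussian)], which tends to [0] as the Gaussian
    widens, because [f^2] is integrable. *)
Lemma fourier_vanishing (e : R) : 0 < e ->
  exists A : R, forall x, A <= `|x| -> `|f x| <= e.
Proof.
move=> e0; have [r r0 hr] := fourier_unif_continuous (divr_gt0 e0 (ltr0Sn R 1)).
pose t n x : R := f x ^+ 2 * (1 - wn n x).
have t0 n x : 0 <= t n x by rewrite mulr_ge0 ?sqr_ge0// subr_ge0.
have mt n : measurable_fun setT (t n).
  apply: measurable_funM; first exact: measurable_funX.
  by apply: measurable_funB => //; exact: measurable_gauss.
have tle n x : `|t n x| <= f x ^+ 2.
  by rewrite ger0_norm// ler_piMr ?sqr_ge0// lerBlDr lerDl gauss_ge0.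
have tcvg x : t n x @[n --> \oo] --> (0 : R).
  rewrite -[X in _ --> X](mulr0 (f x ^+ 2)) -[X in _ * X](subrr 1).
  by apply: cvgMr; apply: cvgB; [exact: cvg_cst|exact: wn_cvg].
have it n : L1 mu (t n) by exact: L1_le (mt n) L1_sqr (tle n).
have := Rint_cvg_dominated mt tcvg L1_sqr tle.
rewrite Rintegral_cst//= mul0r => /cvgr0_norm_lt.
have c0 : 0 < e ^+ 2 / 8 * (2 * r) ^+ d.
  by rewrite mulr_gt0 ?divr_gt0 ?exprn_gt0// mulr_gt0.
move=> /(_ _ c0) [n _ /(_ n (leqnn n))] /= hn.
(* Beyond this radius the cube around [x] stays where the weight is at most
   [1 / 2]. *)
exists (2 * n.+1%:R + r) => x xA; rewrite leNgt; apply/negP => ex.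
move: hn; rewrite ltNge => /negP; apply.
have [mQ muQ] := lebesgue_cube x (ltW r0).
set Q := [set y | _] in mQ muQ.
rewrite (le_trans _ (ler_norm _))// -lee_fin EFin_Rint//.
apply: (@le_trans _ _ (\int[mu]_(y in Q) (t n y)%:E)%E); last first.
  apply: ge0_subset_integral => //; first exact/measurable_EFinP.
  by move=> y _; rewrite lee_fin.
apply: (@le_trans _ _ (\int[mu]_(y in Q) (cst (e ^+ 2 / 8)%:E y))%E).
  rewrite integral_cst//; set m := (X in (_ * X)%E).
  by have -> : m = ((2 * r) ^+ d)%:E by exact: muQ.
apply: ge0_le_integral => //.
- by move=> y _; rewrite lee_fin divr_ge0// sqr_ge0.
- by apply: measurable_funTS; exact/measurable_EFinP.
move=> y Qy; rewrite lee_fin.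
have yx : `|x - y| <= r.
  apply: normr_le_coord; first exact: ltW.
  by move=> i; rewrite !mxE distrC; exact: Qy.
have fy : e / 2 <= `|f y|.
  have := hr _ _ yx; have := ler_normD (f x - f y) (f y); rewrite subrK.
  move: ex; move: `|f x| `|f y| `|f x - f y| => u v z; lra.
have yn : 2 * n.+1%:R <= `|y|.
  have := ler_normD (x - y) y; rewrite subrK.
  move: xA yx; move: `|x| `|y| `|x - y| => u v z; lra.
have w2 : wn n y <= 2^-1.
  rewrite wnE /gauss expRN -[leRHS]invrK lef_pV2 ?posrE ?expR_gt0 ?invr_gt0// invrK.
  apply: le_trans (expR_ge1Dx _); rewrite -[leLHS]/(1 + 1) lerD2l.
  rewrite mulrC ler_pdivlMr ?mulrn_wgt0 ?exprn_gt0// mul1r.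
  rewrite (le_trans _ (normr_sqr_le_dot _))// subr0.
  apply: (@le_trans _ _ ((2 * n.+1%:R) ^+ 2)).
    rewrite exprMn -mulr_natl ler_wpM2r ?sqr_ge0//; lra.
  by rewrite ler_pXn2r ?nnegrE// mulr_ge0.
rewrite /t (_ : e ^+ 2 / 8 = (e / 2) ^+ 2 * 2^-1); last by field.
apply: ler_pM => //; first exact: sqr_ge0.
- rewrite -[leRHS]real_normK ?num_real// ler_pXn2r ?nnegrE//.
  by rewrite ltW// divr_gt0.
- by rewrite -[leLHS](_ : 1 - 2^-1 = _) ?lerD2l ?lerN2//; field.
Qed.

End vanishing.

(** * Calculus along lines *)

Section lines.
Context {R : realType}.

Lemma is_derive_line {V : normedModType R} (f : V -> R) (x v : V) (s : R) :
  derivable f (s *: v + x) v ->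
  is_derive s 1 (fun t : R => f (t *: v + x)) ('D_v f (s *: v + x)).
Proof.
have E : (fun h : R => h^-1 *: (((fun t : R => f (t *: v + x)) \o shift s) (h *: 1) - f (s *: v + x))) =
   (fun h : R => h^-1 *: ((f \o shift (s *: v + x)) (h *: v) - f (s *: v + x))).
  apply/funext => h /=; congr (_ *: (f _ - _)).
  by rewrite scalerDl addrA -[h *: 1]/(h * 1) mulr1.
move=> df; split; first by rewrite /derivable E.
by rewrite /derive E.
Qed.

Lemma derive_cvg_seq {V : normedModType R} (f : V -> R) (x v : V) (r : nat -> R) :
  derivable f x v -> (forall n, r n != 0) -> r n @[n --> \oo] --> 0 ->
  (r n)^-1 * (f (r n *: v + x) - f x) @[n --> \oo] --> 'D_v f x.
Proof.
move=> df r0 rc.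
have := @cvgr_dnbhsP R (fun h : R => h^-1 *: (f (h *: v + x) - f x)) 0 ('D_v f x).
by move=> [/(_ df) H _]; exact: (H r).
Qed.

Lemma derive_le0_right {V : normedModType R} (f : V -> R) (x v : V) (r : R) :
  0 < r -> derivable f x v ->
  (forall h, 0 < h <= r -> f (h *: v + x) <= f x) -> 'D_v f x <= 0.
Proof.
move=> r0 df fle; pose u (n : nat) : R := r * n.+1%:R^-1.
have u0 n : 0 < u n by rewrite mulr_gt0// invr_gt0.
have uc : u n @[n --> \oo] --> (0 : R).
  by rewrite -[X in _ --> X](mulr0 r); apply: cvgMr; exact: cvg_harmonic.
have H := derive_cvg_seq df (fun n => lt0r_neq0 (u0 n)) uc.
apply: (cvgr_to_le H); apply: nearW => n; rewrite pmulr_rle0 ?invr_gt0// subr_le0.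
by apply: fle; rewrite u0 /u ler_piMr ?(ltW r0)// invf_le1// ler1n.
Qed.

Lemma derive_ge0_left {V : normedModType R} (f : V -> R) (x v : V) (r : R) :
  0 < r -> derivable f x v ->
  (forall h, 0 < h <= r -> f (- h *: v + x) <= f x) -> 0 <= 'D_v f x.
Proof.
move=> r0 df fle; pose u (n : nat) : R := - (r * n.+1%:R^-1).
have u0 n : u n < 0 by rewrite oppr_lt0 mulr_gt0// invr_gt0.
have uc : u n @[n --> \oo] --> (0 : R).
  rewrite -[X in _ --> X]oppr0 -[X in _ --> - X](mulr0 r).
  by apply: cvgN; apply: cvgMr; exact: cvg_harmonic.
have H := derive_cvg_seq df (fun n => ltr0_neq0 (u0 n)) uc.
apply: (cvgr_to_ge H); apply: nearW => n.
rewrite nmulr_rge0 ?invr_lt0// subr_le0; apply: fle.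
by rewrite mulr_gt0 ?invr_gt0//= ler_piMr ?(ltW r0)// invf_le1// ler1n.
Qed.

(** Were the second derivative positive, the first derivative, which
    vanishes at [x], would be positive shortly after [x], and [f] would increase
    along the line. *)
Lemma derive2_le0_at_max {V : normedModType R} (f : V -> R) (x v : V) :
  (forall s, f (s *: v + x) <= f x) -> (forall s, derivable f (s *: v + x) v) ->
  derivable ('D_v f) x v -> 'D_v ('D_v f) x <= 0.
Proof.
move=> fle df d2f.
have df0 : derivable f x v by have := df 0; rewrite scale0r add0r.
have D0 : 'D_v f x = 0.
  apply/eqP; rewrite eq_le; apply/andP; split.
    by apply: (derive_le0_right ltr01 df0) => h _; exact: fle.
  by apply: (derive_ge0_left ltr01 df0) => h _; exact: fle.
rewrite leNgt; apply/negP => L0.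
have H : (h^-1 *: ('D_v f (h *: v + x) - 'D_v f x)) @[h --> 0^'] --> 'D_v ('D_v f) x.
  exact: d2f.
have /cvgr_gt := H => /(_ 0 L0) [e /= e0 he].
pose s := e / 2.
have s0 : 0 < s by rewrite divr_gt0.
have pos c : 0 < c -> c < e -> 0 < 'D_v f (c *: v + x).
  move=> c0 ce; have := he c; rewrite /= sub0r normrN gtr0_norm// => /(_ ce).
  move=> /(_ (lt0r_neq0 c0)); rewrite D0 subr0 => h2.
  by have := h2; rewrite /GRing.scale /= pmulr_rgt0 ?invr_gt0.
have fd (c : R) : c \in `]0, s[ -> is_derive c 1 (fun t => f (t *: v + x)) ('D_v f (c *: v + x)).
  by move=> _; apply: is_derive_line; exact: df.
have cf : {within `[0, s], continuous (fun t : R => f (t *: v + x))}.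
  by apply: derivable_within_continuous => c _; case: (is_derive_line (df c)).
have [c] := MVT s0 fd cf.
rewrite in_itv /= => /andP[c0 cs] E.
have : 0 < f (s *: v + x) - f (0 *: v + x).
  rewrite E mulr_gt0 ?subr_gt0// pos// (lt_trans cs)//.
  by rewrite /s ltr_pdivrMr// ltr_pMr// ltr1n.
by rewrite scale0r add0r subr_gt0 ltNge fle.
Qed.

Lemma lipschitz_segment (f df : R -> R) (K a b : R) :
  (forall s : R, `|s - a| <= `|b - a| -> is_derive s 1 f (df s) /\ `|df s| <= K) ->
  `|f a - f b| <= K * `|a - b|.
Proof.
move=> fd; have [ab|/ltW ba] := leP a b.
  have h s : s \in `[a, b] -> `|s - a| <= `|b - a|.
    by rewrite in_itv /= => /andP[h1 h2]; rewrite !ger0_norm ?subr_ge0// lerD2r.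
  have cf : {within `[a, b], continuous f}.
    by apply: derivable_within_continuous => s /h /fd[[]].
  have fd' s : s \in `]a, b[ -> is_derive s 1 f (df s).
    by move=> sab; case: (fd s (h _ (subset_itv_oo_cc sab))).
  have [c cab E] := MVT_segment ab fd' cf.
  by rewrite distrC E normrM [X in _ * X]distrC ler_wpM2r//; case: (fd c (h _ cab)).
have h s : s \in `[b, a] -> `|s - a| <= `|b - a|.
  rewrite in_itv /= => /andP[h1 h2]; rewrite [leLHS]distrC [leRHS]distrC.
  by rewrite !ger0_norm ?subr_ge0// lerD2l lerN2.
have cf : {within `[b, a], continuous f}.
  by apply: derivable_within_continuous => s /h /fd[[]].
have fd' s : s \in `]b, a[ -> is_derive s 1 f (df s).
  by move=> sab; case: (fd s (h _ (subset_itv_oo_cc sab))).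
have [c cab E] := MVT_segment ba fd' cf.
by rewrite E normrM ler_wpM2r//; case: (fd c (h _ cab)).
Qed.

(** Moving from [x] to [y] along one coordinate at a time, the mean value
    theorem on each edge and a local bound on the partial derivatives make [h]
    Lipschitz near [x]. *)
Lemma partials_continuous {d : nat} (h : 'rV[R]_d -> R) :
  (forall i x, derivable h x (delta_mx ord0 i)) ->
  (forall i, continuous (partial i h)) -> continuous h.
Proof.
move=> dh cdh x.
pose B : R := 1 + \sum_i `|partial i h x|.
have B0 : 0 < B by rewrite ltr_wpDr// sumr_ge0.
have near_bd : \forall y \near x, forall i, `|partial i h y| <= B.
  apply: (@filter_forall _ _ (fun i => [set y | `|partial i h y| <= B]) (nbhs x)) => i.
  have cx : partial i h @ x --> partial i h x by exact: cdh.
  apply: (cvgr_norm_le _ cx B).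
  by rewrite /B (bigD1 i)//= ltr_pwDl// lerDl sumr_ge0.
have /nbhs_ballP[r /= r0 hr] := near_bd.
(* [p k] has the first [k] coordinates of [y] and the remaining ones of [x]. *)
have bd y : `|y - x| < r -> `|h y - h x| <= B * \sum_i `|y ord0 i - x ord0 i|.
  move=> yr; pose p (k : nat) : 'rV[R]_d := \row_i (if (i < k)%N then y ord0 i else x ord0 i).
  suff H k : (k <= d)%N ->
      `|h (p k) - h x| <= B * \sum_(i < d | (i < k)%N) `|y ord0 i - x ord0 i|.
    have := H d (leqnn d).
    rewrite (_ : p d = y); last by apply/rowP => i; rewrite mxE ltn_ord.
    by under eq_bigl do rewrite ltn_ord.
  elim: k => [_|k IH kd].
    rewrite (_ : p 0%N = x); last by apply/rowP => i; rewrite mxE.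
    by rewrite subrr normr0 big_pred0 ?mulr0.
  pose ik := Ordinal kd.
  have pS : p k.+1 = (y ord0 ik - x ord0 ik) *: delta_mx ord0 ik + p k.
    apply/rowP => i; rewrite !mxE eqxx /= eq_sym.
    have [<-|ik'] := eqVneq ik i; first by rewrite /= ltnSn ltnn mulr1 subrK.
    rewrite mulr0 add0r ltnS leq_eqVlt.
    rewrite (_ : (i == k :> nat) = false)//; apply/negbTE/negP => /eqP e.
    by move/eqP: ik'; apply; apply: val_inj; rewrite /= e.
  have step : `|h (p k.+1) - h (p k)| <= B * `|y ord0 ik - x ord0 ik|.
    have e0 : h (p k) = h (0 *: delta_mx ord0 ik + p k) by rewrite scale0r add0r.
    have e1 : `|y ord0 ik - x ord0 ik| = `|0 - (y ord0 ik - x ord0 ik)|.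
      by rewrite sub0r normrN.
    rewrite distrC e0 pS [X in _ <= B * X]e1.
    apply: (@lipschitz_segment (fun s => h (s *: delta_mx ord0 ik + p k))
      (fun s => partial ik h (s *: delta_mx ord0 ik + p k)) B 0 (y ord0 ik - x ord0 ik)) => s.
    rewrite !subr0 => sle; split; first by apply: is_derive_line; exact: dh.
    apply: hr; rewrite -ball_normE /= distrC; apply: le_lt_trans yr.
    apply: normr_le_coord => // i; rewrite !mxE eqxx /= eq_sym.
    have [<-|_] := eqVneq ik i.
      rewrite /= ltnn mulr1 addrK (le_trans sle)//.
      by have := normr_coord_le (y - x) ik; rewrite !mxE.
    rewrite mulr0 add0r; case: ifP => _; last by rewrite subrr normr0.
    by have := normr_coord_le (y - x) i; rewrite !mxE.
  rewrite -(subrK (h (p k)) (h (p k.+1))) -addrA (le_trans (ler_normD _ _))//.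
  rewrite (bigD1 ik)/=; last by [].
  rewrite mulrDr lerD// (le_trans (IH (ltnW kd)))// ler_wpM2l ?(ltW B0)//.
  rewrite le_eqVlt; apply/orP; left; apply/eqP; apply: eq_bigl => i.
  by rewrite -(inj_eq val_inj) /= ltn_neqAle andbC.
have FF : Filter (nbhs x) by exact: nbhs_filter.
apply/(@cvgrPdist_le _ _ _ (nbhs x) FF) => e e0; near=> y; rewrite distrC.
have yr : `|y - x| < r by rewrite distrC; near: y; apply: cvgr_dist_lt => //; exact: cvg_id.
rewrite (le_trans (bd y yr))//.
have yd : `|y - x| < e / (B * d.+1%:R).
  rewrite distrC; near: y; apply: cvgr_dist_lt; last by rewrite divr_gt0// mulr_gt0.
  exact: cvg_id.
apply: (@le_trans _ _ (B * (d%:R * `|y - x|))).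
  rewrite ler_wpM2l ?(ltW B0)// -[d in d%:R]card_ord mulr_natl -sumr_const ler_sum// => i _.
  by have := normr_coord_le (y - x) i; rewrite !mxE.
apply: (@le_trans _ _ (B * (d.+1%:R * `|y - x|))).
  by rewrite ler_wpM2l ?(ltW B0)// ler_wpM2r// ler_nat.
by rewrite mulrA mulrC -ler_pdivlMr ?mulr_gt0// ltW.
Unshelve. all: by end_near. Qed.

End lines.

(** * The singular symbol of the gradient field *)

Section multiplier.
Context {R : realType} {d : nat} (i0 : 'I_d).
Local Notation vec := 'rV[R]_d.
Local Notation mu := (lebesgue_rV R d).
Implicit Types (x y v b c xi eta : vec).

(** The symbol of the [j]-th component of the gradient of the inverse Laplacian,
    up to the factor [i]; it is [0] at the origin. *)
Definition grad_symbol (j : 'I_d) xi : R := xi ord0 j / dot xi xi.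

Lemma dot_eq0 xi : dot xi xi = 0 -> xi = 0.
Proof.
move=> h; apply/rowP => i; rewrite mxE; apply/eqP; rewrite -sqrf_eq0 eq_le sqr_ge0 andbT.
by rewrite -h coord_sqr_le_dot.
Qed.

Lemma measurable_grad_symbol j : measurable_fun setT (grad_symbol j).
Proof.
rewrite (_ : grad_symbol j = fun xi => xi ord0 j * dot xi xi `^ (- 1)).
  apply: measurable_funM; first exact: measurable_rV_coord.
  exact: (measurableT_comp (measurable_powR _) measurable_dot).
by apply/funext => xi; rewrite powR_inv1// dot_ge0.
Qed.

Lemma grad_symbol_mul_dot j xi : grad_symbol j xi * dot xi xi = xi ord0 j.
Proof.
rewrite /grad_symbol; have [/dot_eq0 ->|h] := eqVneq (dot xi xi) 0; last by rewrite divfK.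
by rewrite !mxE mul0r mul0r.
Qed.

Lemma grad_symbol_coord_le j xi : `|grad_symbol j xi| * `|xi ord0 j| <= 1.
Proof.
rewrite -normrM /grad_symbol mulrAC -expr2 ger0_norm ?divr_ge0 ?sqr_ge0 ?dot_ge0//.
have [/dot_eq0 ->|h] := eqVneq (dot xi xi) 0; first by rewrite mxE expr0n /= mul0r.
by rewrite ler_pdivrMr ?mul1r ?coord_sqr_le_dot// lt_neqAle eq_sym h dot_ge0.
Qed.

Section swap.
Variables (h T : vec -> R) (j : 'I_d) (k : R).
Hypotheses
  (hL1 : forall a f, 0 < a -> gauss_class a 0 f -> L1 mu (fun xi => h xi * f xi))
  (h0 : forall a f, 0 < a -> gauss_class a 0 f -> \int[mu]_xi (h xi * f xi) = 0)
  (gT : forall a, gauss_class a 0 (fun xi => T xi * gauss a 0 xi))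
  (mT : measurable_fun setT T)
  (Tk : forall xi, `|T xi| <= k * `|xi ord0 j|).

Let k0 : 0 <= k.
Proof.
have := Tk (delta_mx ord0 j); rewrite mxE !eqxx normr1 mulr1.
exact: le_trans.
Qed.

Let I (s : R) xi := h xi * (grad_symbol j xi * T xi * gauss s 0 xi).

Let mh : measurable_fun setT h.
Proof.
rewrite (_ : h = fun x => (h x * gauss 1 0 x) * gauss (- 1) 0 x).
  apply: measurable_funM; last exact: measurable_gauss.
  by apply: L1_measurable (hL1 ltr01 _); exact: gauss_class_gauss.
by apply/funext => x; rewrite -mulrA gaussNK mulr1.
Qed.

Let rT xi : `|grad_symbol j xi * T xi| <= k.
Proof.
rewrite normrM (le_trans (ler_wpM2l (normr_ge0 _) (Tk xi)))// mulrCA.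
by rewrite ler_piMr// grad_symbol_coord_le.
Qed.

Let mI s : measurable_fun setT (I s).
Proof.
apply: measurable_funM => //; apply: measurable_funM; last exact: measurable_gauss.
by apply: measurable_funM => //; exact: measurable_grad_symbol.
Qed.

Let hgauss s : 0 < s -> L1 mu (fun xi => h xi * gauss s 0 xi).
Proof. by move=> s0; apply: (hL1 s0); exact: gauss_class_gauss. Qed.

Let Ile s xi : `|I s xi| <= k * `|h xi * gauss s 0 xi|.
Proof.
rewrite /I mulrCA normrM ler_wpM2r//.
Qed.

Let iI s : 0 < s -> L1 mu (I s).
Proof.
move=> s0; exact: (L1_le (mI s) (L1Z k (L1_norm (hgauss s0))) (Ile s)).
Qed.

(* With [s = expR t] the parameter ranges over the whole line, where a
   function of zero derivative is constant. *)
Let dPsi (t : R) : is_derive t 1 (fun t => \int[mu]_xi I (expR t) xi) 0.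
Proof.
pose df (u : R) xi := - expR u * (h xi * (xi ord0 j * (T xi * gauss (expR u) 0 xi))).
have -> : 0 = \int[mu]_xi df t xi.
  have cl : gauss_class (expR t) 0 (fun xi : vec => xi ord0 j * (T xi * gauss (expR t) 0 xi)).
    by apply: gauss_classX; exact: gT.
  rewrite RintegralZl//; last by apply: hL1 cl; exact: expR_gt0.
  by rewrite (h0 _ cl) ?mulr0// expR_gt0.
pose B xi := expR (t + 1) * k * `|h xi * (xi ord0 j * (xi ord0 j * gauss (expR (t - 1)) 0 xi))|.
have iB : L1 mu B.
  apply: L1Z; apply: L1_norm; apply: (hL1 (expR_gt0 (t - 1))).
  by do 2 apply: gauss_classX; exact: gauss_class_gauss.
apply: (@is_derive_Rint _ _ _ mu _ df B t (t - 1) (t + 1)) => //.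
- by apply/andP; split; lra.
- by move=> u _; apply: iI; exact: expR_gt0.
- move=> u xi _.
  have h1 : is_derive u 1 (fun u : R => - (expR u * sqdist 0 xi)) (- (expR u * sqdist 0 xi)).
    by apply: is_derive_eq; rewrite /GRing.scale /=; ring.
  have h2 := @is_derive1_comp _ expR (fun u : R => - (expR u * sqdist 0 xi)) u _ _ (is_derive_expR _) h1.
  have h3 : is_derive u 1 (fun u : R => (h xi * (grad_symbol j xi * T xi)) * gauss (expR u) 0 xi)
      ((h xi * (grad_symbol j xi * T xi)) * (gauss (expR u) 0 xi * - (expR u * sqdist 0 xi))).
    by apply: is_deriveZ.
  rewrite (_ : df u xi = (h xi * (grad_symbol j xi * T xi)) * (gauss (expR u) 0 xi * - (expR u * sqdist 0 xi))).
    rewrite (_ : (fun x : R => _) = (fun u : R => (h xi * (grad_symbol j xi * T xi)) * gauss (expR u) 0 xi))//.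
    by apply/funext => v; rewrite /I; ring.
  rewrite /df -(grad_symbol_mul_dot j xi) /sqdist subr0; ring.
- move=> u xi /andP[u1 u2]; rewrite /df /B -!mulrA !normrM normrN.
  rewrite [`|expR u|]ger0_norm ?expR_ge0//; apply: ler_pM; rewrite ?expR_ge0//.
    by rewrite ler_expR ltW.
  rewrite [leRHS]mulrCA ler_wpM2l// [leRHS]mulrCA ler_wpM2l// [leRHS]mulrA.
  apply: ler_pM => //.
  rewrite !ger0_norm ?gauss_ge0// ler_expR lerN2 ler_wpM2r ?dot_ge0// ler_expR.
  exact: ltW.
Qed.

Let Ilim : \int[mu]_xi I n.+1%:R xi @[n --> \oo] --> (0 : R).
Proof.
have Icvg xi : I n.+1%:R xi @[n --> \oo] --> (0 : R).
  have [/dot_eq0 x0|x0] := eqVneq (dot xi xi) 0.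
    rewrite (_ : (fun n => _) = fun=> 0); first exact: cvg_cst.
    by apply/funext => n; rewrite /I /grad_symbol x0 mxE !mul0r mulr0.
  have q0 : 0 < dot xi xi by rewrite lt_neqAle eq_sym x0 dot_ge0.
  apply: norm_cvg0.
  apply: (@squeeze_cvgr _ _ _ _ (cst 0) (fun n => k * `|h xi| / dot xi xi * n.+1%:R^-1)).
  - apply: nearW => n; rewrite normr_ge0 /= (le_trans (Ile _ _))//.
    rewrite normrM -!mulrA ler_wpM2l// ler_wpM2l// ger0_norm ?gauss_ge0//.
    rewrite -invfM /gauss expRN lef_pV2 ?posrE ?expR_gt0 ?mulr_gt0// /sqdist subr0.
    by rewrite mulrC (le_trans _ (expR_ge1Dx _))// lerDr.
  - exact: cvg_cst.
  - by rewrite -[X in _ --> X](mulr0 (k * `|h xi| / dot xi xi)); apply: cvgMr; exact: cvg_harmonic.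
have := @Rint_cvg_dominated _ _ _ mu (fun n => I n.+1%:R) (cst 0)
  (fun xi => k * `|h xi * gauss 1 0 xi|).
rewrite Rintegral_cst//= mul0r; apply => //.
- by apply: L1Z; apply: L1_norm; exact: hgauss.
- move=> n xi; rewrite (le_trans (Ile _ _))// ler_wpM2l// !normrM ler_wpM2l//.
  rewrite !ger0_norm ?gauss_ge0// ler_expR lerN2 ler_wpM2r ?dot_ge0// ler1n//.
Qed.

(** Multiplying by [|xi|^2], that is, differentiating in the width [s] of the
    Gaussian, turns [grad_symbol j * T] into [xi_j * T], which is covered by
    the annihilation hypothesis.  The integral is thus constant in [s], and it
    tends to [0] as [s] goes to infinity. *)
Lemma Rint_grad_symbol_eq0 s : 0 < s -> \int[mu]_xi (h xi * (grad_symbol j xi * T xi * gauss s 0 xi)) = 0.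
Proof.
move=> s0; suff H : \int[mu]_xi I n.+1%:R xi @[n --> \oo] --> \int[mu]_xi I s xi.
  exact: cvg_unique H Ilim.
have E n : \int[mu]_xi I n.+1%:R xi = \int[mu]_xi I s xi.
  have := @is_derive_0_is_cst _ (fun t => \int[mu]_xi I (expR t) xi) (ln n.+1%:R) (ln s) dPsi.
  have p1 : n.+1%:R \is @Num.pos R by rewrite posrE.
  have p2 : s \is Num.pos by rewrite posrE.
  by rewrite (lnK p1) (lnK p2).
rewrite (_ : (fun n => \int[mu]_xi I n.+1%:R xi) = fun=> \int[mu]_xi I s xi).
  exact: cvg_cst.
by apply/funext => n; exact: E.
Qed.

End swap.
End multiplier.

(** * Increments of the gradient field *)

Section gradient_increment.
Context {R : realType} {d : nat} (i0 : 'I_d).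
Local Notation vec := 'rV[R]_d.
Local Notation mu := (lebesgue_rV R d).
Implicit Types (x y v b c xi eta : vec).
Local Open Scope complex_scope.

Lemma fourier_gauss_class_unique (u g g' : vec -> R[i]) (a : R) p :
  is_fourier u g -> is_fourier u g' -> 0 < a -> gauss_class a 0 p ->
  \int[mu]_xi (complex.Re (g xi) * p xi) = \int[mu]_xi (complex.Re (g' xi) * p xi) /\
  \int[mu]_xi (complex.Im (g xi) * p xi) = \int[mu]_xi (complex.Im (g' xi) * p xi).
Proof.
move=> [_ _ h] [_ _ h'] a0 cp; have sp := schwartz_real i0 a0 cp.
have := h' _ sp; rewrite (h _ sp) /cintegral => -[e1 e2]; split.
  transitivity (\int[mu]_xi complex.Re (g xi * (p xi)%:C)).
    by apply: eq_Rint => xi; rewrite ReM /=; ring.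
  by rewrite e1; apply: eq_Rint => xi; rewrite ReM /=; ring.
transitivity (\int[mu]_xi complex.Im (g xi * (p xi)%:C)).
  by apply: eq_Rint => xi; rewrite ImM /=; ring.
by rewrite e2; apply: eq_Rint => xi; rewrite ImM /=; ring.
Qed.

Variables (j : 'I_d) (u : vec -> R[i]) (g gj : vec -> R[i]) (Fj : vec -> R).
Hypotheses (ug : is_fourier u g)
  (g1 : L1 mu (fun xi => complex.Re (g xi)))
  (g2 : L1 mu (fun xi => complex.Im (g xi)))
  (ugj : is_fourier u gj)
  (Fgj : is_fourier (fun x => (Fj x)%:C)
     (fun xi => (0 +i* (xi ord0 j / dot xi xi)) * gj xi))
  (cF : continuous Fj).

Section step.
Variables (x : vec) (t : R).
Let x' := t *: delta_mx ord0 j + x.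
Let Tc xi := cos (dot x' xi) - cos (dot x xi).
Let Ts xi := sin (dot x' xi) - sin (dot x xi).

Let dotx' xi : dot x' xi - dot x xi = t * xi ord0 j.
Proof. exact: dot_shift. Qed.

Let Tck xi : `|Tc xi| <= `|t| * `|xi ord0 j|.
Proof. by rewrite -normrM -dotx' cos_lipschitz. Qed.

Let Tsk xi : `|Ts xi| <= `|t| * `|xi ord0 j|.
Proof. by rewrite -normrM -dotx' sin_lipschitz. Qed.

Let cTc (a : R) : gauss_class a 0 (fun xi : vec => Tc xi * gauss a 0 xi).
Proof.
rewrite (_ : (fun xi => _) = fun xi : vec =>
   cos (dot x' xi) * gauss a 0 xi + -1 * (cos (dot x xi) * gauss a 0 xi)).
  by apply: gauss_classD; [exact: gauss_class_cos|apply: gauss_classZ; exact: gauss_class_cos].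
by apply/funext => xi; rewrite /Tc; ring.
Qed.

Let cTs (a : R) : gauss_class a 0 (fun xi : vec => Ts xi * gauss a 0 xi).
Proof.
rewrite (_ : (fun xi => _) = fun xi : vec =>
   sin (dot x' xi) * gauss a 0 xi + -1 * (sin (dot x xi) * gauss a 0 xi)).
  by apply: gauss_classD; [exact: gauss_class_sin|apply: gauss_classZ; exact: gauss_class_sin].
by apply/funext => xi; rewrite /Ts; ring.
Qed.

Let mTc : measurable_fun setT Tc.
Proof. by apply: measurable_funB; exact: measurable_cosl. Qed.

Let mTs : measurable_fun setT Ts.
Proof. by apply: measurable_funB; exact: measurable_sinl. Qed.

Let grad_symbol_T_le T : (forall xi, `|T xi| <= `|t| * `|xi ord0 j|) ->
  forall xi, `|grad_symbol j xi * T xi| <= `|t|.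
Proof.
move=> Tk xi; rewrite normrM (le_trans (ler_wpM2l (normr_ge0 _) (Tk xi)))// mulrCA.
by rewrite ler_piMr// grad_symbol_coord_le.
Qed.

Let L1_swap (a : R) (p T : vec -> R) : 0 < a ->
  measurable_fun setT p -> measurable_fun setT T ->
  (forall xi, `|T xi| <= `|t| * `|xi ord0 j|) ->
  L1 mu (fun xi => p xi * gauss a 0 xi) ->
  L1 mu (fun xi => p xi * (grad_symbol j xi * T xi * gauss a 0 xi)).
Proof.
move=> a0 mp mT Tk ip; apply: (L1_le _ (L1Z `|t| (L1_norm ip))) => [|xi].
  apply: measurable_funM => //; apply: measurable_funM; last exact: measurable_gauss.
  by apply: measurable_funM => //; exact: measurable_grad_symbol.
by rewrite mulrCA normrM ler_wpM2r// grad_symbol_T_le.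
Qed.

Let swap_int (a : R) (p q T : vec -> R) : 0 < a ->
  measurable_fun setT T -> measurable_fun setT p -> measurable_fun setT q ->
  (forall xi, `|T xi| <= `|t| * `|xi ord0 j|) ->
  (forall a : R, gauss_class a 0 (fun xi : vec => T xi * gauss a 0 xi)) ->
  (forall a f, 0 < a -> gauss_class a 0 f -> L1 mu (fun xi => p xi * f xi)) ->
  (forall a f, 0 < a -> gauss_class a 0 f -> L1 mu (fun xi => q xi * f xi)) ->
  (forall a f, 0 < a -> gauss_class a 0 f ->
     \int[mu]_xi (p xi * f xi) = \int[mu]_xi (q xi * f xi)) ->
  \int[mu]_xi (p xi * (grad_symbol j xi * T xi * gauss a 0 xi)) =
  \int[mu]_xi (q xi * (grad_symbol j xi * T xi * gauss a 0 xi)).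
Proof.
move=> a0 mT mp mq Tk cT ip iq pq; apply/eqP; rewrite -subr_eq0; apply/eqP.
have gp := ip _ _ a0 (gauss_class_gauss a 0); have gq := iq _ _ a0 (gauss_class_gauss a 0).
rewrite -RintegralB//; [|exact: L1_swap|exact: L1_swap].
rewrite -[RHS](@Rint_grad_symbol_eq0 R d (fun xi => p xi - q xi) T j `|t| _ _ cT mT Tk a a0).
- by apply: eq_Rint => xi; ring.
- move=> b f b0 cf.
  by apply: eq_L1 (L1B (ip _ _ b0 cf) (iq _ _ b0 cf)) => xi; ring.
- move=> b f b0 cf; rewrite (@eq_Rint _ _ _ mu _ (fun xi => p xi * f xi - q xi * f xi)).
    by rewrite (RintegralB measurableT (ip _ _ b0 cf) (iq _ _ b0 cf)) (pq _ _ b0 cf) subrr.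
  by move=> xi; ring.
Qed.

(** The regularized inversion formula expresses the increment through [g_j]
    and a Gaussian cut-off.  The differences [Tc] and [Ts] of plane waves are
    bounded by a multiple of [|xi_j|], so that [g_j] may be exchanged for [g];
    the integrand is then dominated by [|t| * norm1c g] and the cut-off goes
    away. *)
Lemma gradient_increment : Fj x' - Fj x = - (inv_const R d *
  \int[mu]_xi (grad_symbol j xi * (complex.Im (g xi) * Tc xi + complex.Re (g xi) * Ts xi))).
Proof.
have [_ tg _] := ug; have [_ tgj _] := ugj; have [_ tF _] := Fgj.
have [mgj1 mgj2] := tempered_measurable i0 tgj.
have mg1 := L1_measurable g1; have mg2 := L1_measurable g2.
pose an n : R := (n.+1%:R ^+ 2 *+ 2)^-1.
have an0 n : 0 < an n by rewrite invr_gt0 mulrn_wgt0// exprn_gt0.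
have H := cvgB (regularized_inversion i0 (cF (x := x')) Fgj) (regularized_inversion i0 (cF (x := x)) Fgj).
pose J n xi := grad_symbol j xi * (complex.Im (g xi) * Tc xi + complex.Re (g xi) * Ts xi) * gauss (an n) 0 xi.
have E n : inv_const R d * (\int[mu]_xi (inv_integrand (fun xi => (0 +i* (xi ord0 j / dot xi xi)) * gj xi) x' xi * gauss (an n) 0 xi)) -
     inv_const R d * (\int[mu]_xi (inv_integrand (fun xi => (0 +i* (xi ord0 j / dot xi xi)) * gj xi) x xi * gauss (an n) 0 xi)) =
     - (inv_const R d * \int[mu]_xi J n xi).
  have ir z : L1 mu (fun xi => inv_integrand (fun xi => (0 +i* (xi ord0 j / dot xi xi)) * gj xi) z xi * gauss (an n) 0 xi).
    have [h1 _] := tempered_gauss_class i0 (an0 n) (gauss_class_cos _ 0 z) tF.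
    have [_ h2] := tempered_gauss_class i0 (an0 n) (gauss_class_sin _ 0 z) tF.
    by apply: eq_L1 (L1B h1 h2) => xi; rewrite /inv_integrand; ring.
  rewrite -mulrBr -(RintegralB measurableT (ir x') (ir x)) -mulrN; congr (_ * _).
  have [q1 q2] : L1 mu (fun xi => complex.Re (gj xi) * (grad_symbol j xi * Ts xi * gauss (an n) 0 xi)) /\
     L1 mu (fun xi => complex.Im (gj xi) * (grad_symbol j xi * Tc xi * gauss (an n) 0 xi)).
    have [h1 h2] := tempered_gauss_class i0 (an0 n) (gauss_class_gauss (an n) 0) tgj.
    by split; apply: L1_swap.
  have [r1 r2] : L1 mu (fun xi => complex.Re (g xi) * (grad_symbol j xi * Ts xi * gauss (an n) 0 xi)) /\
     L1 mu (fun xi => complex.Im (g xi) * (grad_symbol j xi * Tc xi * gauss (an n) 0 xi)).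
    have [h1 h2] := tempered_gauss_class i0 (an0 n) (gauss_class_gauss (an n) 0) tg.
    by split; apply: L1_swap.
  (* Here [g_j] is exchanged for [g]. *)
  have s1 : \int[mu]_xi (complex.Re (gj xi) * (grad_symbol j xi * Ts xi * gauss (an n) 0 xi)) =
     \int[mu]_xi (complex.Re (g xi) * (grad_symbol j xi * Ts xi * gauss (an n) 0 xi)).
    apply: swap_int => // a f a0 cf.
    - by have [] := tempered_gauss_class i0 a0 cf tgj.
    - by have [] := tempered_gauss_class i0 a0 cf tg.
    - by have [] := fourier_gauss_class_unique ugj ug a0 cf.
  have s2 : \int[mu]_xi (complex.Im (gj xi) * (grad_symbol j xi * Tc xi * gauss (an n) 0 xi)) =
     \int[mu]_xi (complex.Im (g xi) * (grad_symbol j xi * Tc xi * gauss (an n) 0 xi)).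
    apply: swap_int => // a f a0 cf.
    - by have [] := tempered_gauss_class i0 a0 cf tgj.
    - by have [] := tempered_gauss_class i0 a0 cf tg.
    - by have [] := fourier_gauss_class_unique ugj ug a0 cf.
  transitivity (- \int[mu]_xi (complex.Im (gj xi) * (grad_symbol j xi * Tc xi * gauss (an n) 0 xi) +
     complex.Re (gj xi) * (grad_symbol j xi * Ts xi * gauss (an n) 0 xi))).
    rewrite -mulN1r -(RintegralZl (-1) measurableT (L1D q2 q1)); apply: eq_Rint => xi.
    by rewrite /inv_integrand !ReM !ImM /= -/(grad_symbol j xi) /Tc /Ts; ring.
  rewrite (RintegralD measurableT q2 q1) s1 s2 -(RintegralD measurableT r2 r1).
  by congr (- _); apply: eq_Rint => xi; rewrite /J; ring.
have HJ : - (inv_const R d * \int[mu]_xi J n xi) @[n --> \oo] --> - (inv_const R d *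
  \int[mu]_xi (grad_symbol j xi * (complex.Im (g xi) * Tc xi + complex.Re (g xi) * Ts xi))).
  apply: cvgN; apply: cvgMr.
  apply: (@Rint_cvg_dominated _ _ _ mu _ _ (fun xi => `|t| * norm1c g xi)).
  - move=> n; apply: measurable_funM; last exact: measurable_gauss.
    apply: measurable_funM; first exact: measurable_grad_symbol.
    by apply: measurable_funD; exact: measurable_funM.
  - move=> xi; rewrite -[X in _ --> X]mulr1; apply: cvgMr; exact: cvg_gauss1.
  - by apply: L1Z; exact: L1_norm1c.
  - move=> n xi; rewrite /J normrM [`|gauss _ _ _|]ger0_norm ?gauss_ge0//.
    rewrite (le_trans (ler_piMr _ (gauss_le1 _ _ (ltW (an0 n)))))//.
    rewrite mulrDr (le_trans (ler_normD _ _))// /norm1c [_ + `|complex.Im _|]addrC [leRHS]mulrDr lerD//.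
      by rewrite mulrCA normrM mulrC ler_wpM2r// grad_symbol_T_le.
    by rewrite mulrCA normrM mulrC ler_wpM2r// grad_symbol_T_le.
have H' : - (inv_const R d * \int[mu]_xi J n xi) @[n --> \oo] --> Fj x' - Fj x.
  rewrite (_ : (fun n => - (inv_const R d * \int[mu]_xi J n xi)) = (fun n =>
     inv_const R d * (\int[mu]_xi (inv_integrand (fun xi => (0 +i* (xi ord0 j / dot xi xi)) * gj xi) x' xi * gauss (an n) 0 xi)) -
     inv_const R d * (\int[mu]_xi (inv_integrand (fun xi => (0 +i* (xi ord0 j / dot xi xi)) * gj xi) x xi * gauss (an n) 0 xi)))).
    exact: H.
  by apply/funext => n; rewrite E.
exact: cvg_unique H' HJ.
Qed.

End step.
End gradient_increment.

(** * Divergence of the gradient field *)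

Section divergence_identity.
Context {R : realType} {d : nat} (i0 : 'I_d).
Local Notation vec := 'rV[R]_d.
Local Notation mu := (lebesgue_rV R d).
Implicit Types (x y v b c xi eta : vec).
Local Open Scope complex_scope.

Lemma derive_cvg_harmonic (f : vec -> R) x v : derivable f x v ->
  n.+1%:R * (f (n.+1%:R^-1 *: v + x) - f x) @[n --> \oo] --> 'D_v f x.
Proof.
move=> df.
have H := derive_cvg_seq df (fun n => invr_neq0 (lt0r_neq0 (ltr0Sn R n))) (@cvg_harmonic R).
rewrite (_ : (fun n => _) = (fun n : nat =>
    (n.+1%:R^-1)^-1 * (f (n.+1%:R^-1 *: v + x) - f x))); first exact: H.
by apply/funext => n; rewrite invrK.
Qed.

Section one.
Variables (j : 'I_d) (u : vec -> R[i]) (g gj : vec -> R[i]) (Fj : vec -> R).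
Hypotheses (ug : is_fourier u g)
  (g1 : L1 mu (fun xi => complex.Re (g xi)))
  (g2 : L1 mu (fun xi => complex.Im (g xi)))
  (ugj : is_fourier u gj)
  (Fgj : is_fourier (fun x => (Fj x)%:C)
     (fun xi => (0 +i* (xi ord0 j / dot xi xi)) * gj xi))
  (cF : continuous Fj).

(** The difference quotients of plane waves, multiplied by the symbol, are
    bounded by [1], so dominated convergence applies to the increments of
    [gradient_increment] with [norm1c g] as the dominating function. *)
Lemma partial_inversion x : derivable Fj x (delta_mx ord0 j) ->
  partial j Fj x = - (inv_const R d * \int[mu]_xi (grad_symbol j xi * xi ord0 j * inv_integrand g x xi)).
Proof.
move=> dF; have mg1 := L1_measurable g1; have mg2 := L1_measurable g2.
have H := derive_cvg_harmonic dF.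
pose y n := n.+1%:R^-1 *: delta_mx ord0 j + x.
pose K n xi : R := grad_symbol j xi * (complex.Im (g xi) * (n.+1%:R * (cos (dot (y n) xi) - cos (dot x xi))) +
   complex.Re (g xi) * (n.+1%:R * (sin (dot (y n) xi) - sin (dot x xi)))).
have mc n : measurable_fun setT (fun xi => cos (dot (y n) xi) - cos (dot x xi)).
  by apply: measurable_funB; exact: measurable_cosl.
have ms n : measurable_fun setT (fun xi => sin (dot (y n) xi) - sin (dot x xi)).
  by apply: measurable_funB; exact: measurable_sinl.
have mK n : measurable_fun setT (K n).
  apply: measurable_funM; first exact: measurable_grad_symbol.
  by apply: measurable_funD; apply: measurable_funM => //; exact: measurable_funM.
have dy n xi : dot (y n) xi - dot x xi = n.+1%:R^-1 * xi ord0 j.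
  exact: dot_shift.
have nT n xi (T : R) : `|T| <= `|dot (y n) xi - dot x xi| -> `|grad_symbol j xi * (n.+1%:R * T)| <= 1.
  rewrite dy => hT; have h : `|n.+1%:R * T| <= `|xi ord0 j|.
    rewrite normrM mulrC -ler_pdivlMr ?normr_gt0 ?pnatr_eq0//.
    by rewrite (le_trans hT)// normrM normfV mulrC.
  by rewrite normrM (le_trans (ler_wpM2l (normr_ge0 _) h))// grad_symbol_coord_le.
have Kle n xi : `|K n xi| <= norm1c g xi.
  rewrite /K mulrDr (le_trans (ler_normD _ _))// /norm1c addrC lerD//.
    by rewrite mulrCA normrM ler_piMr// nT// sin_lipschitz.
  by rewrite mulrCA normrM ler_piMr// nT// cos_lipschitz.
have iK n : L1 mu (K n) by exact: L1_le (mK n) (L1_norm1c g1 g2) (Kle n).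
have EK n : n.+1%:R * (Fj (y n) - Fj x) = - (inv_const R d * \int[mu]_xi K n xi).
  rewrite (gradient_increment i0 ug g1 g2 ugj Fgj cF) mulrN mulrCA.
  congr (- (_ * _)); rewrite -RintegralZl//.
    by apply: eq_Rint => xi; rewrite /K; ring.
  have : L1 mu (fun xi => n.+1%:R^-1 * K n xi) by exact: L1Z.
  have n0 : n.+1%:R != 0 :> R by rewrite pnatr_eq0.
  apply: eq_L1 => xi; rewrite /K /y; move: (cos _ - cos _) (sin _ - sin _) => A B.
  by move: n0; move: n.+1%:R => N N0; field.
have Kcvg xi : K n xi @[n --> \oo] --> grad_symbol j xi * xi ord0 j * inv_integrand g x xi.
  have -> : grad_symbol j xi * xi ord0 j * inv_integrand g x xi = grad_symbol j xi * (complex.Im (g xi) * (- sin (dot xi x) * xi ord0 j) +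
     complex.Re (g xi) * (cos (dot xi x) * xi ord0 j)).
    by rewrite /inv_integrand (dotC x); ring.
  have [_ [hc1 hc2]] := is_derive_comp_real (is_derive_cos (dot xi x))
    (differentiable_dotl xi x) (is_derive_dotl xi x (delta_mx ord0 j)).
  have [_ [hs1 hs2]] := is_derive_comp_real (is_derive_sin (dot xi x))
    (differentiable_dotl xi x) (is_derive_dotl xi x (delta_mx ord0 j)).
  have Hc := derive_cvg_harmonic hc1; have Hs := derive_cvg_harmonic hs1.
  rewrite hc2 dot_delta in Hc; rewrite hs2 dot_delta in Hs.
  apply: cvgMr; apply: cvgD; apply: cvgMr.
    rewrite (_ : (fun n => _) = (fun n => n.+1%:R * ((cos \o dot xi) (n.+1%:R^-1 *: delta_mx ord0 j + x) - (cos \o dot xi) x)))//.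
    by apply/funext => n /=; rewrite !(dotC xi).
  rewrite (_ : (fun n => _) = (fun n => n.+1%:R * ((sin \o dot xi) (n.+1%:R^-1 *: delta_mx ord0 j + x) - (sin \o dot xi) x)))//.
  by apply/funext => n /=; rewrite !(dotC xi).
have HK := Rint_cvg_dominated mK Kcvg (L1_norm1c g1 g2) Kle.
have H2 : n.+1%:R * (Fj (y n) - Fj x) @[n --> \oo] --> - (inv_const R d *
   \int[mu]_xi (grad_symbol j xi * xi ord0 j * inv_integrand g x xi)).
  rewrite (_ : (fun n => _) = (fun n => - (inv_const R d * \int[mu]_xi K n xi))).
    by apply: cvgN; apply: cvgMr; exact: HK.
  by apply/funext => n; exact: EK.
exact: cvg_unique H H2.
Qed.

End one.

(** The symbols of the diagonal derivatives are [- xi_j^2 / |xi|^2], which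
    sum to [-1] away from the origin, a null set. *)
Lemma divergence_grad_inv_neg_laplacian (f : vec -> R) (F : vec -> vec) (g : vec -> R[i]) :
  continuous f -> is_fourier (fun x => (f x)%:C) g ->
  L1 mu (fun xi => complex.Re (g xi)) -> L1 mu (fun xi => complex.Im (g xi)) ->
  C1_field F -> is_grad_inv_neg_laplacian f F ->
  forall x, divergence F x = - f x.
Proof.
move=> cf fg g1 g2 CF gradF x.
have mg1 := L1_measurable g1; have mg2 := L1_measurable g2.
have iRj j : L1 mu (fun xi => grad_symbol j xi * xi ord0 j * inv_integrand g x xi).
  apply: (L1_le _ (L1_norm1c g1 g2)) => [|xi].
    apply: measurable_funM; last exact: measurable_inv_integrand.
    by apply: measurable_funM; [exact: measurable_grad_symbol|exact: measurable_rV_coord].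
  rewrite normrM (le_trans _ (inv_integrand_le g x xi))// ler_piMl// normrM.
  exact: grad_symbol_coord_le.
have E j : partial j (fun y => F y ord0 j) x =
    - (inv_const R d * \int[mu]_xi (grad_symbol j xi * xi ord0 j * inv_integrand g x xi)).
  have [gj fgj Fgj] := gradF j.
  apply: (partial_inversion fg g1 g2 fgj Fgj).
    apply: partials_continuous => i; first by move=> y; have [+ _] := CF j i; apply.
    by have [_] := CF j i.
  by have [+ _] := CF j j; apply.
rewrite /divergence (eq_bigr _ (fun j _ => E j)) sumrN -mulr_sumr.
rewrite (fourier_inversion i0 (cf x) fg g1 g2); congr (- (_ * _)).
have sum_int (s : seq 'I_d) : L1 mu (fun xi => \sum_(j <- s) grad_symbol j xi * xi ord0 j * inv_integrand g x xi) /\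
   \sum_(j <- s) \int[mu]_xi (grad_symbol j xi * xi ord0 j * inv_integrand g x xi) =
   \int[mu]_xi (\sum_(j <- s) grad_symbol j xi * xi ord0 j * inv_integrand g x xi).
  elim: s => [|j s [IH1 IH2]].
    split.
      apply: (@eq_L1 _ _ _ mu (cst 0)) => [xi|]; first by rewrite big_nil.
      exact: integrable0.
    rewrite big_nil (@eq_Rint _ _ _ mu _ (cst 0)) => [|xi]; last by rewrite big_nil.
    by rewrite Rintegral_cst//= mul0r.
  split.
    by apply: eq_L1 (L1D (iRj j) IH1) => xi; rewrite big_cons.
  rewrite big_cons IH2 -(RintegralD measurableT (iRj j) IH1).
  by apply: eq_Rint => xi; rewrite big_cons.
have [is1 ->] := sum_int (index_enum 'I_d).
rewrite /Rintegral; congr fine; apply: ae_eq_integral => //.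
- exact: measurable_int is1.
- by apply/measurable_EFinP; exact: measurable_inv_integrand.
have [mc muc] := lebesgue_cube (0 : vec) (lexx (0 : R)).
exists [set y : vec | forall i, `|y ord0 i - (0 : vec) ord0 i| <= 0]; split => //.
  transitivity (((2 * 0 : R) ^+ d)%:E); first exact: muc.
  by rewrite mulr0 expr0n (_ : (d == 0%N) = false)//; case: (d) (i0) => // -[].
move=> xi /= hxi i; rewrite mxE subr0; apply: contrapT => xi0; apply: hxi => _.
congr EFin; rewrite -mulr_suml -[RHS]mul1r; congr (_ * _).
have q0 : dot xi xi != 0.
  apply/negP => /eqP /dot_eq0 h; apply: xi0; by rewrite h mxE normr0.
rewrite -[RHS](divff q0) /dot mulr_suml; apply: eq_bigr => k _.
by rewrite /grad_symbol mulrAC.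
Qed.

End divergence_identity.

(** * Maximum principle *)

Section maximum_principle.
Context {R : realType} {d : nat}.
Local Notation vec := 'rV[R]_d.
Implicit Types (x y : vec).

Lemma within_cvg_slice (T : R) (rho : R -> vec -> R) (t : R) x :
  {within `[0, T] `*` [set: vec], continuous (fun z => rho z.1 z.2)} ->
  0 <= t <= T ->
  rho z.1 z.2 @[z --> within (`[0, T] `*` [set: vec]) (nbhs (t, x))] --> rho t x.
Proof.
move=> /subspace_continuousP H tT.
by apply: (H (t, x)); split => //=; rewrite in_itv.
Qed.

Lemma continuous_slice (T : R) (rho : R -> vec -> R) (t : R) :
  {within `[0, T] `*` [set: vec], continuous (fun z => rho z.1 z.2)} ->
  0 <= t <= T -> continuous (rho t).
Proof.
move=> cr tT x; have H := @within_cvg_slice T rho t x cr tT.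
move=> A /H; rewrite /within /= => -[[U V] /= [Ut Vx] UV].
apply: filterS Vx => y Vy.
by apply: (UV (t, y)) => /=; [split => //; exact: nbhs_singleton Ut|split => //; rewrite /= in_itv].
Qed.

Section bound.
Variables (a T sigma M : R) (rho : R -> vec -> R) (F : R -> vec -> vec).
Hypotheses (T0 : 0 < T) (sg : sigma = 1 \/ sigma = -1) (M0 : 0 <= M)
  (reg : classical_regularity T rho)
  (CF : forall t, 0 < t < T -> C1_field (F t))
  (divF : forall t x, 0 < t < T -> divergence (F t) x = - (rho t x - 1))
  (eqn : forall t x, 0 < t < T ->
    derive1 (rho ^~ x) t - a ^+ 2 * laplacian (rho t) x =
    divergence (fun y => rho t y *: F t y) x)
  (pos : forall t x, 0 <= t <= T -> 0 < rho t x)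
  (vanish : forall e, 0 < e -> exists A : R, forall t x, 0 <= t <= T -> A <= `|x| ->
     `|rho t x - 1| <= e)
  (init : forall x, sigma * (rho 0 x - 1) <= M).

Let u t x := sigma * (rho t x - 1).

Let sigma2 : sigma * sigma = 1.
Proof. by case: sg => ->; rewrite ?mulr1 ?mulN1r ?opprK. Qed.

Let norm_sigma : `|sigma| = 1.
Proof. by case: sg => ->; rewrite ?normrN normr1. Qed.

Let no_interior_max t x : 0 < t < T ->
  (forall y, u t y <= u t x) -> (forall s, 0 <= s <= t -> u s x <= u t x) ->
  u t x <= 0.
Proof.
move=> tT maxx maxt; rewrite leNgt; apply/negP => u0.
have tT' : 0 <= t <= T by case/andP: tT => h1 h2; rewrite !ltW.
have [_ /(_ t x tT)[dt dx _] _ _ _] := reg.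
have dxy y i : derivable (rho t) y (delta_mx ord0 i).
  by have [_ /(_ t y tT)[_ + _] _ _ _] := reg; apply.
have dxx i : derivable (partial i (rho t)) x (delta_mx ord0 i).
  by have [_ /(_ t x tT)[_ _ +] _ _ _] := reg; apply.
have uE y : u t y = sigma * rho t y - sigma by rewrite /u mulrBr mulr1.
have du y i : is_derive y (delta_mx ord0 i) (u t) (sigma * partial i (rho t) y).
  rewrite (_ : u t = fun y => sigma * rho t y - sigma); last by apply/funext => z.
  have h := derivableP (dxy y i).
  by apply: is_derive_eq; rewrite /GRing.scale /= subr0.
have dU i : 'D_(delta_mx ord0 i) (u t) = fun y => sigma * partial i (rho t) y.
  by apply/funext => y; have h := du y i; exact: derive_val.
have dUx i y : 'D_(delta_mx ord0 i) (u t) y = sigma * partial i (rho t) y.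
  by have h := du y i; exact: derive_val.
have grad0 i : partial i (rho t) x = 0.
  have d0 : derivable (u t) x (delta_mx ord0 i) by case: (du x i).
  have E : 'D_(delta_mx ord0 i) (u t) x = 0.
    apply/eqP; rewrite eq_le; apply/andP; split.
      by apply: (derive_le0_right ltr01 d0) => h _; exact: maxx.
    by apply: (derive_ge0_left ltr01 d0) => h _; exact: maxx.
  by move: E; rewrite dUx => /(congr1 (fun z => sigma * z)); rewrite mulrA sigma2 mul1r mulr0.
have dpartial i : is_derive x (delta_mx ord0 i) (fun y => sigma * partial i (rho t) y)
    (sigma * partial i (partial i (rho t)) x).
  have h := derivableP (dxx i).
  exact: (@is_deriveZ R vec R^o).
have lap0 : sigma * laplacian (rho t) x <= 0.
  rewrite /laplacian mulr_sumr; apply: sumr_le0 => i _.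
  have -> : sigma * partial i (partial i (rho t)) x =
      'D_(delta_mx ord0 i) ('D_(delta_mx ord0 i) (u t)) x.
    by rewrite dU; apply/esym; have h := dpartial i; exact: derive_val.
  apply: derive2_le0_at_max => [s|s|].
  - exact: maxx.
  - by case: (du (s *: delta_mx ord0 i + x) i).
  - by rewrite dU; case: (dpartial i).
have time0 : 0 <= sigma * derive1 (rho ^~ x) t.
  have h := derivableP dt.
  have h2 : is_derive t 1 (fun s => u s x) (sigma * 'D_1 (rho ^~ x) t).
    rewrite (_ : (fun s => u s x) = fun s => sigma * rho s x - sigma); last first.
      by apply/funext => s; rewrite /u mulrBr mulr1.
    by apply: is_derive_eq; rewrite /GRing.scale /= subr0.
  have [t0 _] := andP tT.
  rewrite derive1E; have [h3 <-] := h2.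
  apply: (derive_ge0_left t0 h3) => s /andP[s0 st].
  apply: maxt; rewrite -[- s *: 1]/(- s * 1) mulr1; apply/andP; split; lra.
have div : divergence (fun y => rho t y *: F t y) x = - (rho t x * (rho t x - 1)).
  rewrite -mulrN -(divF x tT) /divergence mulr_sumr; apply: eq_bigr => i _.
  have hF : derivable (fun y => F t y ord0 i) x (delta_mx ord0 i).
    by have [+ _] := CF tT i i; apply.
  have h1 := derivableP (dxy x i); have h2 := derivableP hF.
  rewrite /partial (_ : (fun y => (rho t y *: F t y) ord0 i) =
    (rho t : vec -> R) * (fun y => F t y ord0 i)); last first.
    by apply/funext => y; rewrite mxE.
  have g0 : 'D_(delta_mx ord0 i) (rho t) x = 0 by exact: grad0.
  transitivity (rho t x *: 'D_(delta_mx ord0 i) (fun y => F t y ord0 i) x +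
    F t x ord0 i *: 'D_(delta_mx ord0 i) (rho t) x); first exact: (deriveM (dxy x i) hF).
  by rewrite g0 scaler0 addr0.
have := eqn x tT; rewrite div => /(congr1 (fun z => sigma * z)) E.
have r0 := pos x tT'.
have ru : 0 < rho t x * u t x by rewrite mulr_gt0.
have al : a ^+ 2 * (sigma * laplacian (rho t) x) <= 0.
  by rewrite mulr_ge0_le0// sqr_ge0.
move: E al ru time0; rewrite mulrBr mulrN /u (mulrCA sigma (a ^+ 2)) (mulrCA sigma (rho t x)).
lra.
Qed.

(** Let [delta] lie strictly between [M] and the value supposed to exceed it.
    Outside a large cube [sigma u] is at most [delta], so its maximum over the
    compact product of that cube with [[0, t]] is a maximum over the whole of
    space.  It is not attained at time [0], where [sigma u <= M]. *)
Lemma max_principle_open t x : 0 <= t < T -> u t x <= M.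
Proof.
move=> /andP[t0 tT]; rewrite leNgt; apply/negP => uM.
pose delta := (M + u t x) / 2.
have d1 : M < delta by rewrite /delta ltr_pdivlMr//; lra.
have d2 : delta < u t x by rewrite /delta ltr_pdivrMr//; lra.
have [A hA] := vanish (le_lt_trans M0 d1).
pose r := Num.max A `|x|.
pose Q : set vec := [set y | forall i, `[- r, r]%classic (y ord0 i)].
pose K : set (R * vec) := `[0, t]%classic `*` Q.
have cK : compact K.
  apply: compact_setX; first exact: segment_compact.
  exact: (@rV_compact R d (fun=> `[- r, r]%classic) (fun i => @segment_compact R (- r) r)).
have Kx : K (t, x).
  split; first by rewrite /= in_itv /= t0 lexx.
  move=> i; rewrite /= in_itv /= -ler_norml (le_trans (normr_coord_le x i))//.
  by rewrite le_max lexx orbT.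
have cu : {within K, continuous (fun z => u z.1 z.2)}.
  apply/subspace_continuousP => -[s y] [/= st _]; rewrite in_itv /= in st.
  have sT : 0 <= s <= T by case/andP: st => -> st; rewrite (le_trans st)// ltW.
  have [cr _ _ _ _] := reg; have H := @within_cvg_slice T rho s y cr sT.
  have Hu : u z.1 z.2 @[z --> within (`[0, T] `*` [set: vec]) (nbhs (s, y))] --> u s y.
    by apply: cvgMr; apply: cvgB; [exact: H|exact: cvg_cst].
  apply: cvg_trans Hu; apply: cvg_app; apply: within_subset => -[s' y'] [/=].
  rewrite !in_itv /= => /andP[s0 s't] _; split => //.
  by rewrite s0 (le_trans s't)// ltW.
have [[s y] /set_mem [/=]] := compact_EVT_max (ex_intro _ _ Kx) cK cu.
rewrite in_itv /= => /andP[s0 st] Qy hmax.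
have usy : u t x <= u s y by apply: (hmax (t, x)); exact: mem_set.
have far s' y' : 0 <= s' <= t -> ~ Q y' -> u s' y' <= u s y.
  move=> /andP[s'0 s't] nQ.
  have [i hi] : exists i, r < `|y' ord0 i|.
    apply: contrapT => H; apply: nQ => i; rewrite /= in_itv /= -ler_norml leNgt.
    by apply/negP => h; apply: H; exists i.
  have Ay : A <= `|y'|.
    rewrite (le_trans _ (normr_coord_le y' i))// (le_trans _ (ltW hi))//.
    by rewrite le_max lexx.
  have s'T : 0 <= s' <= T by rewrite s'0 (le_trans s't)// ltW.
  rewrite (le_trans _ usy)// (le_trans _ (ltW d2))// (le_trans (ler_norm _))//.
  by rewrite normrM norm_sigma mul1r hA.
have gmax s' y' : 0 <= s' <= t -> u s' y' <= u s y.
  move=> s't; have [Qy'|nQ] := pselect (Q y'); last exact: far.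
  by apply: (hmax (s', y')); apply: mem_set; split => //=; rewrite in_itv.
have s_gt0 : 0 < s.
  rewrite lt_neqAle s0 andbT; apply/negP => /eqP s00.
  have := init y; rewrite s00 -/(u s y); move: usy d1 d2; lra.
have sT : 0 < s < T by rewrite s_gt0 (le_lt_trans st).
have : u s y <= 0.
  apply: no_interior_max => // [y'|s' /andP[s'0 s's]].
    by apply: gmax; rewrite s0 st.
  by apply: gmax; rewrite s'0 (le_trans s's).
move: usy d1 d2 M0; lra.
Qed.

(** The equation is only available before the final time, whence the
    passage to the limit. *)
Lemma max_principle t x : 0 <= t <= T -> u t x <= M.
Proof.
move=> tT; have [t0] := andP tT; rewrite le_eqVlt => /predU1P[tE|tlt]; last first.
  by apply: max_principle_open; rewrite t0.
rewrite leNgt; apply/negP => uM.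
have [cr _ _ _ _] := reg.
have H := @within_cvg_slice T rho t x cr tT.
have Hu : u z.1 z.2 @[z --> within (`[0, T] `*` [set: vec]) (nbhs (t, x))] --> u t x.
  by apply: cvgMr; apply: cvgB; [exact: H|exact: cvg_cst].
have /cvgr_gt/(_ M uM) := Hu; rewrite /within /= => -[[U V] /= [Ut Vx] UV].
have /nbhs_ballP[e /= e0 he] := Ut.
pose k := Num.min (e / 2) (T / 2).
have k0 : 0 < k by rewrite lt_min !divr_gt0.
have kT : k <= T / 2 by rewrite ge_min lexx orbT.
have ke : k <= e / 2 by rewrite ge_min lexx.
have tk : 0 <= t - k < T by rewrite tE; apply/andP; split; lra.
have : M < u (t - k) x.
  apply: (UV (t - k, x)) => /=.
    split; last exact: nbhs_singleton Vx.
    apply: he; rewrite /ball /= opprB addrC subrK gtr0_norm//; lra.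
  by split => //=; rewrite in_itv /=; case/andP: tk => -> /ltW.
by rewrite ltNge max_principle_open.
Qed.

End bound.
End maximum_principle.

(** * Sobolev paths and the theorem *)

Section sobolev_solution.
Context {R : realType} {d : nat} (i0 : 'I_d).
Local Notation vec := 'rV[R]_d.
Local Notation mu := (lebesgue_rV R d).
Implicit Types (x y : vec) (f : vec -> R).
Local Open Scope complex_scope.

Lemma sobolev_fourier (s : R) f : d%:R / 2 < s -> sobolev s f ->
  exists g, [/\ is_fourier (fun x => (f x)%:C) g,
    L1 mu (fun xi => complex.Re (g xi)), L1 mu (fun xi => complex.Im (g xi)) &
    L1 mu (fun xi => norm1c g xi ^+ 2)].
Proof.
move=> ds fs.
have [eta eta0 h] : exists2 eta : R, 0 < eta & (sobolev_norm s f < eta%:E)%E.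
  move: fs; rewrite /sobolev /=; case: (sobolev_norm s f) => [r _|//|_].
    by exists (`|r| + 1); rewrite ?ltr_wpDl// lte_fin (le_lt_trans (ler_norm r))// ltrDl.
  by exists 1; rewrite ?ltNyr.
by have [g [? ? ? ? _]] := sobolev_norm_lt i0 ds eta0 h; exists g.
Qed.

Lemma sobolev_vanishing (s : R) f : d%:R / 2 < s -> continuous f -> sobolev s f ->
  forall e : R, 0 < e -> exists A : R, forall x, A <= `|x| -> `|f x| <= e.
Proof.
move=> ds cf fs e e0; have [g [fg g1 g2 gg]] := sobolev_fourier ds fs.
exact: (fourier_vanishing i0 cf fg g1 g2 gg e0).
Qed.

(** Sobolev embedding in the form needed for differences of slices: a small
    Sobolev norm of exponent above [d / 2] gives a small supremum. *)
Lemma sobolev_sup (s : R) : d%:R / 2 < s -> forall e : R, 0 < e ->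
  exists2 eta : R, 0 < eta & forall f, continuous f ->
    (sobolev_norm s f < eta%:E)%E -> forall x, `|f x| <= e.
Proof.
move=> ds e e0; pose W := \int[mu]_xi (1 + dot xi xi) `^ (- s).
have W0 : 0 < 1 + W by rewrite ltr_pwDl// Rintegral_ge0// => xi _; exact: powR_ge0.
have c0 := inv_const_gt0 R d.
exists (e / (inv_const R d * (1 + W))); first by rewrite divr_gt0// mulr_gt0.
move=> f cf fn x; have eta0 : 0 < e / (inv_const R d * (1 + W)) by rewrite divr_gt0// mulr_gt0.
have [g [fg g1 g2 _ h]] := sobolev_norm_lt i0 ds eta0 fn.
rewrite (le_trans (fourier_sup_le i0 (cf x) fg g1 g2))//.
rewrite (le_trans (ler_wpM2l (ltW c0) h))// -/W.
rewrite le_eqVlt; apply/orP; left; apply/eqP; field.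
by rewrite !gt_eqF.
Qed.

(** A slice near time [t] differs from that at time [t] by at most [e / 2]
    in supremum norm, so the radius found for [t] serves a neighbourhood of
    [t]; finitely many neighbourhoods cover [[0, T]]. *)
Lemma uniform_vanishing (s T : R) (rho : R -> vec -> R) : d%:R / 2 < s ->
  (forall t, 0 <= t <= T -> continuous (rho t)) ->
  continuous_sobolev s T rho ->
  forall e : R, 0 < e -> exists A : R, forall t x, 0 <= t <= T -> A <= `|x| -> `|rho t x| <= e.
Proof.
move=> ds cr [sr cn] e e0; have e20 : 0 < e / 2 by rewrite divr_gt0.
pose P (A t : R) := 0 <= t <= T -> forall x, A <= `|x| -> `|rho t x| <= e.
have /compact_near_coveringP H := @segment_compact R 0 T.
suff : \forall A \near (+oo : set_system R), (`[0, T]%classic : set R) `<=` P A.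
  case=> A [_ hA]; exists (A + 1) => t x tT.
  by apply: (hA (A + 1)); rewrite //= ?in_itv ?ltrDl.
apply: (H R (+oo : set_system R) P) => t; rewrite /= in_itv /= => tT.
have [A hA] := sobolev_vanishing ds (cr t tT) (sr t tT) e20.
have [eta eta0 heta] := sobolev_sup ds e20.
have near_t : \forall t' \near t, 0 <= t' <= T ->
    (sobolev_norm s (fun x => (rho t' x - rho t x)%R) < eta%:E)%E.
  have eN : nbhs (0%E : \bar R) (fun z => (z < eta%:E)%E).
    by apply: open_ereal_lt'; rewrite lte_fin.
  have H2 : \forall t' \near within `[0, T] (nbhs t),
      (sobolev_norm s (fun x => (rho t' x - rho t x)%R) < eta%:E)%E by exact: (cn t tT _ eN).
  move: H2; rewrite near_withinE; apply: filterS.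
  by move=> t' /= h tT'; apply: h; rewrite /= in_itv.
exists ([set t' | 0 <= t' <= T -> (sobolev_norm s (fun x => (rho t' x - rho t x)%R) < eta%:E)%E],
  [set B | A < B]).
  by split; [exact: near_t|exists A; split; [exact: num_real|]].
move=> [t' B] /= [ht' AB] tT' x Bx.
have h1 : `|rho t x| <= e / 2 by apply: hA; rewrite (le_trans (ltW AB)).
have h2 : `|rho t' x - rho t x| <= e / 2.
  apply: (heta (fun x => rho t' x - rho t x)); last exact: ht'.
  move=> y; have c1 : rho t' @ y --> rho t' y by exact: cr.
  have c2 : rho t @ y --> rho t y by exact: cr.
  exact: (cvgB c1 c2).
have := ler_normD (rho t' x - rho t x) (rho t x); rewrite subrK.
by move=> /le_trans; apply; rewrite [leRHS]splitr lerD.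
Qed.

End sobolev_solution.

Theorem lemma3p1 (R : realType) (d m : nat) (a rho1 rho2 T : R)
    (rho0 : 'rV[R]_d -> R) (rho : R -> 'rV[R]_d -> R)
    (gradphi : R -> 'rV[R]_d -> 'rV[R]_d)
    (hd : (1 <= d <= 5)%N)
    (hm : d%:R / 2 + 1 < m%:R :> R)
    (ha : 0 < a)
    (hrho1 : 0 < rho1) (hrho12 : rho1 <= rho2)
    (hrho0 : sobolev (m%:R - 1) (fun x => rho0 x - 1))
    (hrho0_bounds : forall x, rho1 <= rho0 x <= rho2)
    (hT : 0 < T)
    (hrho : continuous_sobolev (m%:R - 1) T (fun t x => rho t x - 1))
    (hrho_pos : exists2 c : R, 0 < c &
       forall (t : R) x, 0 <= t <= T -> c <= rho t x)
    (hsol : classical_solution a T rho0 rho gradphi) :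
  forall (t : R) (x : 'rV[R]_d), 0 <= t <= T -> rho1 <= rho t x <= rho2.
Proof.
have d0 : (0 < d)%N by case/andP: hd.
pose i0 := Ordinal d0.
have ds : d%:R / 2 < m%:R - 1 :> R by rewrite ltrBrDr.
have [reg CF eqn gradF init] := hsol.
have [cr _ _ _ _] := reg.
have crt t : 0 <= t <= T -> continuous (rho t) by exact: continuous_slice cr.
have cut t : 0 <= t <= T -> continuous (fun x => rho t x - 1).
  move=> tT x; have FF : Filter (nbhs x) by exact: nbhs_filter.
  have c1 : rho t @ x --> rho t x by exact: crt.
  have c2 : (fun _ : 'rV[R]_d => 1 : R) @ x --> (1 : R) by exact: cvg_cst.
  exact: (cvgB c1 c2).
have van := uniform_vanishing i0 ds cut hrho.
have [sr _] := hrho.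
have divF t x : 0 < t < T -> divergence (gradphi t) x = - (rho t x - 1).
  move=> tT; have tT' : 0 <= t <= T by case/andP: tT => h1 h2; rewrite !ltW.
  have [g [fg g1 g2 _]] := sobolev_fourier i0 ds (sr t tT').
  exact: (divergence_grad_inv_neg_laplacian i0 (cut t tT') fg g1 g2 (CF t tT) (gradF t tT')).
have pos t x : 0 <= t <= T -> 0 < rho t x.
  by have [c c0 hc] := hrho_pos; move=> tT; exact: lt_le_trans c0 (hc t x tT).
have T00 : 0 <= (0 : R) <= T by rewrite lexx ltW.
(* A point far enough in the direction [(1, ..., 1)]. *)
have far e : 0 < e -> exists x, `|rho0 x - 1| <= e.
  move=> e0; have [A hA] := van e e0.
  exists (const_mx `|A|); rewrite -init; apply: hA => //.
  rewrite (le_trans _ (normr_coord_le _ i0))// mxE normr_id ler_norm//.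
have rho1_le1 : rho1 <= 1.
  apply/ler_addgt0Pr => e e0; have [x hx] := far e e0.
  have /andP[h _] := hrho0_bounds x; have := ler_norm (rho0 x - 1); lra.
have rho2_ge1 : 1 <= rho2.
  apply/ler_addgt0Pr => e e0; have [x hx] := far e e0.
  have /andP[_ h] := hrho0_bounds x; have := ler_norm (- (rho0 x - 1)); rewrite normrN; lra.
move=> t x tT; apply/andP; split.
  have M0 : 0 <= 1 - rho1 by rewrite subr_ge0.
  have i1 y : -1 * (rho 0 y - 1) <= 1 - rho1.
    by rewrite init; have /andP[h _] := hrho0_bounds y; lra.
  have := max_principle hT (or_intror erefl) M0 reg CF divF eqn pos van i1 x tT.
  by rewrite /=; lra.
have M0 : 0 <= rho2 - 1 by rewrite subr_ge0.
have i1 y : 1 * (rho 0 y - 1) <= rho2 - 1.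
  by rewrite init; have /andP[_ h] := hrho0_bounds y; lra.
have := max_principle hT (or_introl erefl) M0 reg CF divF eqn pos van i1 x tT.
by rewrite /=; lra.
Qed.
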